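(* Let $U_1,U_2,\dots$ be i.i.d. random variables uniform on $(0,1)$; let $X_1,X_2,\dots$ be random variables that are all the local minimizers on $(0,1)$ of a one-dimensional Brownian motion $(B_t)_{t\in[0,1]}$, enumerated in an arbitrary measurable way without repetitions; and let $A\subset(0,1)^\infty$ be a Borel set invariant under permutations, i.e. $(x_1,x_2,\dots)\in A$ implies $(x_{\sigma(1)},x_{\sigma(2)},\dots)\in A$ for every bijection $\sigma$ of $\{1,2,\dots\}$. Then $$\mathbb P\big((X_1,X_2,\dots)\in A\big)=\mathbb P\big((U_1,U_2,\dots)\in A\big)\in\{0,1\}.$$
   Context: The local minimizers of a path $t\mapsto B_t$ on $(0,1)$ are the points of the set $M=\{s\in(0,1):\exists\varepsilon>0\ \forall t\in(s-\varepsilon,s)\cup(s,s+\varepsilon)\ B_s<B_t\}$, which is almost surely a dense countable set. A measurable enumeration without repetitions of $M$ is a sequence of $(0,1)$-valued random variables $X_1,X_2,\dots$ such that almost surely $M=\{X_1,X_2,\dots\}$ and $X_k\ne X_l$ for $k\neq l$. *)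

(* Defs.v *)
From HB Require Import structures.
From mathcomp Require Import all_boot all_order all_algebra.
From mathcomp Require Import finmap.
From mathcomp Require Import all_classical all_reals all_analysis.

Set Implicit Arguments.
Unset Strict Implicit.
Unset Printing Implicit Defensive.

Import Order.TTheory GRing.Theory Num.Theory.
Import numFieldNormedType.Exports.

Local Open Scope classical_set_scope.
Local Open Scope ring_scope.

(* The two measures are compared on Borel sets only: on other sets their values
   carry no meaning, so `distribution P X = mu` would be too strong. *)
Definition has_law (d : measure_display) (T : measurableType d) (R : realType)
    (P : probability T R) (X : T -> R) (mu : set R -> \bar R) : Prop :=
  forall E : set R, measurable E -> P (X @^-1` E) = mu E.

Definition mutually_independent (d : measure_display) (T : measurableType d)
    (R : realType) (P : probability T R) (I : choiceType) (X : I -> T -> R) :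
    Prop :=
  forall (J : {fset I}) (E : I -> set R), (forall i, measurable (E i)) ->
    P (\bigcap_(i in [set` J]) (X i @^-1` E i)) =
    (\prod_(i <- J) P (X i @^-1` E i))%E.

Definition iid_uniform01 (d : measure_display) (T : measurableType d)
    (R : realType) (P : probability T R) (U : nat -> {RV P >-> R}) : Prop :=
  mutually_independent P (fun k => U k : T -> R) /\
  forall k, has_law P (U k) (uniform_prob (@ltr01 R)).

(* The process is indexed by the whole real line for convenience; only its
   values at times in [0, 1] are constrained. The second parameter of
   `normal_prob` is the standard deviation. *)
Definition brownian_motion01 (d : measure_display) (T : measurableType d)
    (R : realType) (P : probability T R) (B : R -> {RV P >-> R}) : Prop :=
  [/\ {ae P, forall w, B 0 w = 0},
      forall s t : R, 0 <= s -> s < t -> t <= 1 ->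
        has_law P (B t \- B s) (normal_prob 0 (Num.sqrt (t - s))),
      forall (n : nat) (t : nat -> R), 0 <= t 0%N -> t n <= 1 ->
        (forall i, (i < n)%N -> t i <= t i.+1) ->
        mutually_independent P (fun i : 'I_n => B (t i.+1) \- B (t i)) &
      {ae P, forall w, {within `[0, 1], continuous (fun t => B t w)}}].

(* As s lies in ]0, 1[, e may be shrunk until ]s - e, s + e[ lies in ]0, 1[, so
   values of b outside [0, 1] are irrelevant. *)
Definition local_minimizers01 (R : realType) (b : R -> R) : set R :=
  [set s | 0 < s < 1 /\ exists e : R, 0 < e /\
    forall t, s - e < t < s \/ s < t < s + e -> b s < b t].

Definition measurable_enumeration (d : measure_display) (T : measurableType d)
    (R : realType) (P : probability T R) (M : T -> set R)
    (X : nat -> {RV P >-> R}) : Prop :=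
  (forall k w, 0 < X k w < 1) /\
  {ae P, forall w, M w = range (fun k => X k w) /\
                   injective (fun k => X k w)}.

Definition seq01 (R : realType) : set {ptws nat -> R} :=
  [set x | forall k, 0 < x k < 1].

(* The sigma-algebra on the subspace (0, 1)^oo of the product space R^oo
   generated by its relatively open subsets. *)
Definition borel_seq01 (R : realType) : set_system {ptws nat -> R} :=
  <<s @seq01 R, strace open (@seq01 R) >>.

Definition permutation_invariant (T : Type) (A : set (nat -> T)) : Prop :=
  forall (s : nat -> nat) (x : nat -> T), bijective s -> A x -> A (x \o s).

Arguments iid_uniform01 {d T R} P U.
Arguments brownian_motion01 {d T R} P B.
Arguments measurable_enumeration {d T R} P M X.

(* Main.v *)
(* For every eps > 0 there is a random reordering Y of the local minimizers, using
   auxiliary independent uniform variables, whose law is within eps of the law lam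
   of the sequence U. As A is invariant, X is in A iff Y is, so that
   P(X in A) = lam(A); the zero-one law is that of Hewitt and Savage for lam.

   Y is built by blocks. Suppose that finitely many distinct minimizers have been
   chosen. Pick a uniform point a and, if possible, a local minimizer in the short
   window [a, a + l]. Up to a small probability the minimizers chosen before
   belong to finitely many histories "the minimizer over each of these small
   disjoint intervals"; windows far apart and away from the intervals being
   independent, a second moment estimate shows that, given the history, the law
   of the new minimizer is close to uniform in total variation. To exhaust all
   minimizers, the first unused X_i is also added, and exchanged with a random one
   of K such candidates. The law of X_i given the history is nearly absolutely
   continuous, by translation invariance of the increments, and an orthogonality
   argument shows that the exchange makes it disappear as K grows. *)

Require Import Defs.
From HB Require Import structures.
From mathcomp Require Import all_boot all_order all_algebra.
From mathcomp Require Import finmap.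
From mathcomp Require Import all_classical all_reals all_analysis.
From mathcomp Require Import measurable_realfun ring lra.

Set Implicit Arguments.
Unset Strict Implicit.
Unset Printing Implicit Defensive.

Import Order.TTheory GRing.Theory Num.Theory.
Import numFieldNormedType.Exports.

Local Open Scope classical_set_scope.
Local Open Scope ring_scope.


(** * Expectations of bounded functions *)

(** The set [A] is only measurable, so weak convergence would not help: all estimates are in total
    variation. The reordering is an infinite construction, finished before any event is tested;
    hence each step first produces its points and then satisfies a bound for all tests [G] with
    values in [0, 1] at once, and neither the window length nor [K] depends on [G]. Stage [k] may
    lose [e / 2 ^+ k.+1]. Upper bounds suffice, because they are applied to [A] and to its
    complement.

    The obstacle is that the enumeration [X] is arbitrary: a given [X k] may depend on the whole
    path. Histories are therefore never conditioned upon. Where the listed points agree with the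
    minimizers over some boxes, the integrand is replaced by a functional of the increments over
    these boxes, and the error is bounded by a sum over all boxes of the cover, without restriction
    to the event of agreement. This costs a factor equal to the number of boxes, which is harmless
    since the cover is fixed before the window length, or before [K]. The auxiliary randomness is
    one more sequence of law [lam], whence the product space [T * seqS R]. *)

Definition bmeas (d : measure_display) (T : measurableType d) (R : realType)
    (f : T -> R) : Prop :=
  measurable_fun setT f /\ exists M : R, forall x, `|f x| <= M.

(** For functions satisfying [bmeas] nothing is infinite, so real values are enough and inequalities
    between expectations become linear arithmetic. *)
Definition Ex (d : measure_display) (T : measurableType d) (R : realType)
    (P : probability T R) (f : T -> R) : R := Rintegral P setT f.

Section bounded_measurable.
Context (d : measure_display) (T : measurableType d) (R : realType).
Implicit Types f g : T -> R.

Lemma bmeas_cst (c : R) : bmeas (fun _ : T => c).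
Proof. by split; [exact: measurable_cst|exists `|c|]. Qed.

Lemma bmeasD f g : bmeas f -> bmeas g -> bmeas (fun x => f x + g x).
Proof.
move=> [mf [M hM]] [mg [N hN]]; split; first exact: measurable_funD.
by exists (M + N) => x; rewrite (le_trans (ler_normD _ _))// lerD.
Qed.

Lemma bmeasM f g : bmeas f -> bmeas g -> bmeas (fun x => f x * g x).
Proof.
move=> [mf [M hM]] [mg [N hN]]; split; first exact: measurable_funM.
by exists (M * N) => x; rewrite normrM ler_pM.
Qed.

Lemma bmeasN f : bmeas f -> bmeas (fun x => - f x).
Proof.
move=> [mf [M hM]]; split; first exact: measurableT_comp.
by exists M => x; rewrite normrN.
Qed.

Lemma bmeasB f g : bmeas f -> bmeas g -> bmeas (fun x => f x - g x).
Proof. by move=> hf hg; apply: bmeasD => //; exact: bmeasN. Qed.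

Lemma bmeas_norm f : bmeas f -> bmeas (fun x => `|f x|).
Proof.
move=> [mf [M hM]]; split; first exact: measurableT_comp.
by exists M => x; rewrite normr_id.
Qed.

Lemma bmeas_sum (I : Type) (s : seq I) (f : I -> T -> R) :
  (forall i, bmeas (f i)) -> bmeas (fun x => \sum_(i <- s) f i x).
Proof.
move=> hf; elim: s => [|i s IH].
  by under [X in bmeas X]funext do rewrite big_nil; exact: bmeas_cst.
by under [X in bmeas X]funext do rewrite big_cons; exact: bmeasD.
Qed.

Lemma bmeas_indic (E : set T) : measurable E -> bmeas (\1_E : T -> R).
Proof.
move=> mE; split; first exact: measurable_indic.
by exists 1 => x; rewrite indicE; case: (_ \in _); rewrite ?normr1 ?normr0.
Qed.

Lemma bmeas_01 f : measurable_fun setT f -> (forall x, 0 <= f x <= 1) ->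
  bmeas f.
Proof.
move=> mf h; split => //; exists 1 => x.
by have /andP[h0 h1] := h x; rewrite ger0_norm.
Qed.

Lemma bmeas_comp (d' : measure_display) (T' : measurableType d')
    (f : T' -> R) (g : T -> T') :
  bmeas f -> measurable_fun setT g -> bmeas (fun x => f (g x)).
Proof.
move=> [mf [M hM]] mg; split; last by exists M.
exact: (measurableT_comp mf mg).
Qed.

End bounded_measurable.

Section expectation.
Context (d : measure_display) (T : measurableType d) (R : realType).
Variable P : probability T R.
Implicit Types f g : T -> R.

Lemma bmeas_integrable f : bmeas f -> P.-integrable setT (EFin \o f).
Proof.
move=> [mf [M hM]]; apply: measurable_bounded_integrable => //.
  by apply: (@le_lt_trans _ _ 1%E); [exact: probability_le1|exact: ltry].
exists M; split; first exact: num_real.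
by move=> y My x _ /=; rewrite (le_trans (hM x))// ltW.
Qed.

Lemma ExE f : bmeas f -> (Ex P f)%:E = (\int[P]_x (f x)%:E)%E.
Proof.
move=> /bmeas_integrable fi; rewrite /Ex /Rintegral fineK//.
exact: integrable_fin_num.
Qed.

Lemma Ex_cst (c : R) : Ex P (fun=> c) = c.
Proof. by rewrite /Ex Rintegral_cst//= probability_setT /= mulr1. Qed.

Lemma ExD f g : bmeas f -> bmeas g -> Ex P (fun x => f x + g x) = Ex P f + Ex P g.
Proof. by move=> hf hg; rewrite /Ex RintegralD//; exact: bmeas_integrable. Qed.

Lemma ExB f g : bmeas f -> bmeas g -> Ex P (fun x => f x - g x) = Ex P f - Ex P g.
Proof. by move=> hf hg; rewrite /Ex RintegralB//; exact: bmeas_integrable. Qed.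

Lemma ExZ c f : bmeas f -> Ex P (fun x => c * f x) = c * Ex P f.
Proof. by move=> hf; rewrite /Ex RintegralZl//; exact: bmeas_integrable. Qed.

Lemma Ex_sum (I : Type) (s : seq I) (f : I -> T -> R) :
  (forall i, bmeas (f i)) ->
  Ex P (fun x => \sum_(i <- s) f i x) = \sum_(i <- s) Ex P (f i).
Proof.
move=> hf; elim: s => [|i s IH].
  rewrite big_nil -[RHS](Ex_cst 0) /Ex.
  by under eq_Rintegral do rewrite big_nil.
rewrite /Ex; under eq_Rintegral do rewrite big_cons.
by rewrite big_cons -IH -ExD//; apply: bmeas_sum.
Qed.

Lemma Ex_ext f g : (forall x, f x = g x) -> Ex P f = Ex P g.
Proof. by move=> fg; congr Ex; apply/funext. Qed.

Lemma Ex_le f g : bmeas f -> bmeas g -> (forall x, f x <= g x) ->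
  Ex P f <= Ex P g.
Proof.
by move=> hf hg fg; apply: le_Rintegral => //; exact: bmeas_integrable.
Qed.

Lemma Ex_ge0 f : (forall x, 0 <= f x) -> 0 <= Ex P f.
Proof. by move=> f0; exact: Rintegral_ge0. Qed.

Lemma Ex_01 f : measurable_fun setT f -> (forall x, 0 <= f x <= 1) ->
  0 <= Ex P f <= 1.
Proof.
move=> mf h; apply/andP; split; first by apply: Ex_ge0 => x; case/andP: (h x).
apply: (@le_trans _ _ (Ex P (fun=> 1))); last by rewrite Ex_cst.
apply: Ex_le; [exact: bmeas_01|exact: bmeas_cst|].
by move=> x; case/andP: (h x).
Qed.

Lemma Ex_norm f : bmeas f -> `|Ex P f| <= Ex P (fun x => `|f x|).
Proof.
by move=> hf; apply: le_normr_Rintegral => //; exact: bmeas_integrable.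
Qed.

Lemma Ex_indic (E : set T) : measurable E -> (Ex P \1_E)%:E = P E.
Proof.
by move=> mE; rewrite ExE ?integral_indic ?setIT//; exact: bmeas_indic.
Qed.

Lemma Ex_null f g (N : set T) : bmeas f -> bmeas g -> measurable N ->
  P N = 0%E -> (forall x, ~ N x -> f x = g x) -> Ex P f = Ex P g.
Proof.
move=> hf hg mN N0 fg; apply: EFin_inj; rewrite !ExE//.
rewrite (negligible_integral mN)//; last exact: bmeas_integrable.
rewrite [RHS](negligible_integral mN)//; last exact: bmeas_integrable.
by apply: eq_integral => x; rewrite inE => -[_ /fg ->].
Qed.

End expectation.

Section expectation_maps.
Context (d1 d2 : measure_display) (T1 : measurableType d1)
  (T2 : measurableType d2) (R : realType).
Variables (P1 : probability T1 R) (P2 : probability T2 R).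

Lemma Ex_distribution (X : {mfun T1 >-> T2}) (f : T2 -> R) : bmeas f ->
  Ex (distribution P1 X) f = Ex P1 (fun w => f (X w)).
Proof.
move=> hf; apply: EFin_inj.
have hfX : bmeas (fun w => f (X w)) by exact: bmeas_comp.
rewrite !ExE//.
rewrite (@integral_distribution _ _ _ _ _ P1 X (EFin \o f))//.
  by apply/measurable_EFinP; case: hf.
exact: (bmeas_integrable P1 hfX).
Qed.

(** Measurability in the parameter comes from Fubini on the product with [P1], which can be any
    probability on the parameter space. *)
Lemma bmeas_Ex (f : T1 -> T2 -> R) : bmeas (fun p : T1 * T2 => f p.1 p.2) ->
  bmeas (fun x => Ex P2 (f x)).
Proof.
move=> hf.
have hfx x : bmeas (f x).
  by apply: (@bmeas_comp _ _ _ _ _ (fun p : T1 * T2 => f p.1 p.2) (pair x)).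
split.
  apply/measurable_EFinP.
  rewrite [X in measurable_fun _ X](_ : _ =
    fubini_F P2 (fun p => (f p.1 p.2)%:E)); last first.
    by apply/funext => x /=; rewrite ExE.
  by apply: measurable_fubini_F; exact: (bmeas_integrable (P1 \x P2)%E hf).
case: (hf) => _ [M hM]; exists M => x.
rewrite (le_trans (Ex_norm _ (hfx x)))// -(Ex_cst P2 M).
apply: Ex_le => //; [exact: bmeas_norm|exact: bmeas_cst|].
by move=> y; exact: (hM (x, y)).
Qed.

Lemma Ex_prod (f : T1 * T2 -> R) : bmeas f ->
  Ex (P1 \x P2)%E f = Ex P1 (fun x => Ex P2 (fun y => f (x, y))).
Proof.
move=> hf; apply: EFin_inj; rewrite ExE//.
have hfx x : bmeas (fun y => f (x, y)).
  by apply: (@bmeas_comp _ _ _ _ _ f (pair x)).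
rewrite ExE; last first.
  apply: (@bmeas_Ex (fun x y => f (x, y))).
  by rewrite [X in bmeas X](_ : _ = f)//; apply/funext => -[].
rewrite -(integral12_prod_meas1 (bmeas_integrable (P1 \x P2)%E hf)).
by apply: eq_integral => x _; rewrite /fubini_F ExE.
Qed.

End expectation_maps.

Lemma Ex_prodr (d1 d2 : measure_display) (T1 : measurableType d1)
    (T2 : measurableType d2) (R : realType)
    (P1 : probability T1 R) (P2 : probability T2 R) (f : T1 * T2 -> R) :
  bmeas f -> Ex (P1 \x P2)%E f = Ex P2 (fun y => Ex P1 (fun x => f (x, y))).
Proof.
move=> hf; apply: EFin_inj; rewrite ExE//.
have hfy y : bmeas (fun x => f (x, y)).
  by apply: (@bmeas_comp _ _ _ _ _ f (fun x => (x, y))).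
rewrite ExE; last first.
  apply: (bmeas_Ex (f := fun y x => f (x, y)) P2 P1).
  apply: (bmeas_comp hf); exact: measurable_swap.
rewrite -(integral21_prod_meas1 (bmeas_integrable (P1 \x P2)%E hf)).
by apply: eq_integral => x _; rewrite /fubini_G ExE.
Qed.

Lemma Ex_swap (d1 d2 : measure_display) (T1 : measurableType d1)
    (T2 : measurableType d2) (R : realType)
    (P1 : probability T1 R) (P2 : probability T2 R) (f : T1 -> T2 -> R) :
  bmeas (fun p : T1 * T2 => f p.1 p.2) ->
  Ex P1 (fun x => Ex P2 (f x)) = Ex P2 (fun y => Ex P1 (fun x => f x y)).
Proof. by move=> hf; rewrite -(Ex_prod P1 P2 hf) (Ex_prodr P1 P2 hf). Qed.

Lemma Ex_law (d1 d2 d : measure_display) (T1 : measurableType d1)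
    (T2 : measurableType d2) (S : measurableType d) (R : realType)
    (P1 : probability T1 R) (P2 : probability T2 R)
    (X : T1 -> S) (Y : T2 -> S) (f : S -> R) :
  measurable_fun setT X -> measurable_fun setT Y ->
  (forall E, measurable E -> P1 (X @^-1` E) = P2 (Y @^-1` E)) ->
  bmeas f -> Ex P1 (fun w => f (X w)) = Ex P2 (fun w => f (Y w)).
Proof.
move=> mX mY XY hf.
pose X' : {mfun T1 >-> S} := mfun_Sub (mem_set mX : X \in mfun).
pose Y' : {mfun T2 >-> S} := mfun_Sub (mem_set mY : Y \in mfun).
rewrite -(Ex_distribution P1 X' hf) -(Ex_distribution P2 Y' hf).
apply: EFin_inj; rewrite !ExE//.
by apply: eq_measure_integral => E mE _; exact: XY.
Qed.

(** * Laws of sequences *)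

Section sequence_space.
Variable R : realType.

Definition rect (n : nat) (E : nat -> set R) : set (nat -> R) :=
  [set x | forall i, (i < n)%N -> E i (x i)].

Definition rects : set (set (nat -> R)) :=
  [set A | exists n E, (forall i, measurable (E i)) /\ A = rect n E].

(* The product topology is not used here: Borel sets for it are measurable for
   this sigma-algebra by [measurable_ptws_open]. *)
Definition seqS : Type := g_sigma_algebraType rects.
HB.instance Definition _ := Measurable.on seqS.
Lemma measurable_seqSE : @measurable _ seqS = <<s rects >>. Proof. by []. Qed.

Lemma rects_setI : setI_closed rects.
Proof.
move=> _ _ [n [E [mE ->]]] [m [F [mF ->]]].
exists (maxn n m), (fun i => (if (i < n)%N then E i else setT) `&`
  (if (i < m)%N then F i else setT)); split.
  by move=> i; apply: measurableI; case: ifP.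
apply/seteqP; split=> x /=.
  move=> [xE xF] i _; split; case: ifP => //; [exact: xE|exact: xF].
move=> h; split=> i lti.
  by have [+ _] := h i (leq_trans lti (leq_maxl _ _)); rewrite lti.
by have [_ +] := h i (leq_trans lti (leq_maxr _ _)); rewrite lti.
Qed.

Lemma measurable_rect n (E : nat -> set R) : (forall i, measurable (E i)) ->
  measurable (rect n E : set seqS).
Proof. by move=> mE; apply: sub_sigma_algebra; exists n, E. Qed.

Lemma measurable_coord (i : nat) : measurable_fun setT (fun x : seqS => x i).
Proof.
move=> _ E mE; rewrite setTI.
rewrite (_ : _ @^-1` E = rect i.+1 (fun j => if j == i then E else setT)).
  by apply: measurable_rect => j; case: ifP.
apply/seteqP; split=> x /=; first by move=> Ex j _; case: eqP => // ->.
by move=> /(_ i (ltnSn i)); rewrite eqxx.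
Qed.

Lemma measurable_seqP (d : measure_display) (T : measurableType d)
    (f : T -> seqS) :
  (forall i, measurable_fun setT (fun w => f w i)) -> measurable_fun setT f.
Proof.
move=> mf; apply: (@measurability _ _ T seqS setT f rects measurable_seqSE).
move=> _ [_ [n [E [mE ->]]] <-]; rewrite setTI.
rewrite (_ : _ @^-1` _ = \bigcap_i (if (i < n)%N then (fun w => f w i) @^-1` E i
   else setT)).
  apply: bigcapT_measurable => i; case: ifP => // _.
  by rewrite -[X in measurable X]setTI; exact: mf.
apply/seteqP; split=> w /=; first by move=> h i _; case: ifP => // /h.
by move=> h i lti; have := h i I; rewrite lti.
Qed.

Lemma seq_law_unique (d1 d2 : measure_display) (T1 : measurableType d1)
    (T2 : measurableType d2) (P1 : probability T1 R) (P2 : probability T2 R)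
    (X : T1 -> seqS) (Y : T2 -> seqS) :
  measurable_fun setT X -> measurable_fun setT Y ->
  (forall n E, (forall i, measurable (E i)) ->
    P1 (X @^-1` rect n E) = P2 (Y @^-1` rect n E)) ->
  forall E, measurable E -> P1 (X @^-1` E) = P2 (Y @^-1` E).
Proof.
move=> mX mY XY E mE.
pose X' : {mfun T1 >-> seqS} := mfun_Sub (mem_set mX : X \in mfun).
pose Y' : {mfun T2 >-> seqS} := mfun_Sub (mem_set mY : Y \in mfun).
apply: (@measure_unique _ R seqS rects (fun=> setT) measurable_seqSE _ _ _
  (distribution P1 X') (distribution P2 Y')) => //.
- exact: rects_setI.
- by move=> _; exists 0%N, (fun=> setT); split=> //; apply/seteqP; split.
- by rewrite bigcup_const.
- by move=> _ [n [F [mF ->]]]; exact: XY.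
- move=> _; apply: (@le_lt_trans _ _ 1%E); last exact: ltry.
  exact: probability_le1.
Qed.

Definition determined (n : nat) (C : set (nat -> R)) :=
  forall x y, (forall i, (i < n)%N -> x i = y i) -> C x -> C y.

Lemma rational_box_of_open (O : set {ptws nat -> R}) : open O ->
  O = \bigcup_(p in [set p : seq rat * nat |
     rect (size p.1) (fun i => ball (ratr (nth 0 p.1 i) : R) p.2.+1%:R^-1) `<=` O])
     rect (size p.1) (fun i => ball (ratr (nth 0 p.1 i) : R) p.2.+1%:R^-1).
Proof.
move=> oO; apply/seteqP; split=> [f Of|f [p /= pO] /pO//].
(* Otherwise a counterexample for each [N] would give points outside the open set [O] converging
   pointwise to [f]. *)
have [N NO] : exists N : nat,
    forall x : nat -> R, (forall i, (i < N)%N -> `|x i - f i| < N.+1%:R^-1) -> O x.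
  apply: contrapT => /forallNP nex.
  have {}nex N : exists x : nat -> R,
      (forall i, (i < N)%N -> `|x i - f i| < N.+1%:R^-1) /\ ~ O x.
    by have /existsNP[x /not_implyP[h1 h2]] := nex N; exists x.
  have [x hx] := choice nex.
  have xf : {ptws, x @ \oo --> f}.
    apply/(@pointwise_cvgP _ _ (x @ \oo) _) => t.
    suff : (fun n => x n t) @ \oo --> f t by [].
    apply/cvgrPdist_lt => e e0; near=> n.
    have := (hx n).1 t; rewrite distrC => /(_ _)/lt_trans; apply.
      by near: n; exists t.+1.
    near: n; exact: near_infty_natSinv_lt (PosNum e0).
  have : nbhs (f : {ptws nat -> R}) O by exact: open_nbhs_nbhs.
  by move/xf => [n _ /(_ n (leqnn n))] /=; exact: (hx n).2.
(* Half of [N.+1%:R^-1]: one half pays for approximating [f] by rationals, the other is the radius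
   of the box. *)
pose e : R := (N + N).+2%:R^-1.
have e0 : 0 < e by rewrite invr_gt0 ltr0n.
have /choice[q hq] : forall i, exists q : rat, `|f i - ratr q| < e.
  move=> i; have : f i - e < f i + e by lra.
  move=> /rat_in_itvoo[q]; rewrite in_itv/= => qe; exists q.
  by rewrite ltr_distlC.
have sq : size (mkseq q N) = N by rewrite size_mkseq.
exists (mkseq q N, (N + N).+1).
  move=> x /=; rewrite /rect/= sq => h; apply: NO => i iN.
  have := h i iN; rewrite nth_mkseq// /ball/= => h1.
  have h2 := hq i.
  have -> : N.+1%:R^-1 = e + e :> R.
    have N0 : (0 : R) < N.+1%:R by rewrite ltr0n.
    by rewrite /e -addSn -addnS natrD; field; lra.
  rewrite (_ : x i - f i = - (ratr (q i) - x i) - (f i - ratr (q i))); last by ring.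
  by rewrite (le_lt_trans (ler_normB _ _))// normrN ltrD.
move=> i; rewrite /= sq => iN; rewrite nth_mkseq// /ball/=.
by rewrite distrC; exact: hq.
Unshelve. all: by end_near. Qed.

Lemma measurable_ptws_open (O : set {ptws nat -> R}) : open O ->
  measurable (O : set seqS).
Proof.
move=> /rational_box_of_open ->.
rewrite bigcup_mkcond; apply: countable_bigcupT_measurable => // p.
case: ifP => // _; apply: measurable_rect => i.
exact: measurable_ball.
Qed.

End sequence_space.

(** Continuity from above, in the form that replaces a countable cover by a finite one. *)
Lemma prob_bigcup_tail (d : measure_display) (T : measurableType d)
    (R : realType) (P : probability T R) (F : nat -> set T) (e : R) :
  (forall k, measurable (F k)) -> 0 < e ->
  exists N, forall n, (N <= n)%N ->
    Ex P \1_(\bigcup_k F k `\` \bigcup_(k in `I_n) F k) < e.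
Proof.
move=> mF e0.
pose G n := \bigcup_k F k `\` \bigcup_(k in `I_n) F k.
have mU : measurable (\bigcup_k F k) by exact: bigcupT_measurable.
have mG n : measurable (G n).
  by apply: measurableD => //; apply: bigcup_measurable => k _.
have G0 : \bigcap_n G n = set0.
  apply/seteqP; split=> // x h; have [[k _ Fkx] _] := h 0%N I.
  by have [_] := h k.+1 I; apply; exists k => /=.
have cvgG : P (G n) @[n --> \oo] --> P (\bigcap_n G n).
  apply: nonincreasing_cvg_mu => //.
  - by rewrite (@le_lt_trans _ _ 1%E) ?ltry//; exact: probability_le1.
  - by rewrite G0.
  - move=> m n mn; apply/subsetPset => x [Ux h]; split => // -[k /= km Fkx].
    by apply: h; exists k => //=; exact: leq_trans km mn.
rewrite G0 measure0 in cvgG.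
have {}cvgG : Ex P \1_(G n) @[n --> \oo] --> (0 : R).
  rewrite (_ : (fun n => Ex P \1_(G n)) = fine \o (P \o G)).
    exact: (@fine_cvg R nat \oo _ (P \o G) 0).
  by apply/funext => n /=; rewrite -Ex_indic.
have /cvgrPdist_lt/(_ e e0)[N _ hN] := cvgG.
exists N => n Nn; have := hN n Nn; rewrite sub0r normrN ger0_norm//.
by apply: Ex_ge0 => x; rewrite indicE.
Qed.

(** * Approximation of measurable sets of sequences by cylinders *)

Section cylinder_approximation.
Variable R : realType.
Implicit Types C E : set (nat -> R).

Lemma measurable_borel_seq01 (A : set {ptws nat -> R}) : borel_seq01 A ->
  measurable (A : set (seqS R)).
Proof.
have mD : measurable (@seq01 R : set (seqS R)).
  rewrite (_ : @seq01 R = \bigcap_k [set x : seqS R | 0 < x k < 1]); last first.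
    by apply/seteqP; split=> x h k //=; exact: h.
  apply: bigcapT_measurable => k.
  have := @measurable_coord R k measurableT `]0, 1[%classic (measurable_itv _).
  by rewrite setTI; congr measurable; apply/seteqP; split=> x /=; rewrite in_itv.
suff : @borel_seq01 R `<=` (@measurable _ (seqS R)) by apply.
apply: smallest_sub.
  split; [exact: measurable0| |].
  - by move=> B mB; exact: measurableD.
  - by move=> F mF; exact: bigcupT_measurable.
by move=> _ [W oW <-]; apply: measurableI => //; exact: measurable_ptws_open.
Qed.

Definition sdiff (E C : set (nat -> R)) (x : seqS R) : R :=
  `|\1_E x - \1_C x|.

Lemma bmeas_sdiff E C : measurable (E : set (seqS R)) ->
  measurable (C : set (seqS R)) -> bmeas (sdiff E C).
Proof.
by move=> mE mC; apply: bmeas_norm; apply: bmeasB; exact: bmeas_indic.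
Qed.

Lemma determinedS n m C : (n <= m)%N -> determined n C -> determined m C.
Proof. by move=> nm h x y xy; apply: h => i /leq_trans/(_ nm); exact: xy. Qed.

(** The approximable sets form a sigma-algebra containing the rectangles. One [C] serves two
    measures, because the law of the reordered enumeration and [lam] have to be compared on the same
    cylinder. *)
Lemma cylinder_approx (m1 m2 : probability (seqS R) R) E :
  measurable (E : set (seqS R)) -> forall e : R, 0 < e ->
  exists n C, [/\ measurable (C : set (seqS R)), determined n C,
    Ex m1 (sdiff E C) < e & Ex m2 (sdiff E C) < e].
Proof.
pose K : set (set (seqS R)) := [set E : set (nat -> R) |
  measurable (E : set (seqS R)) /\ forall e : R, 0 < e ->
  exists n C, [/\ measurable (C : set (seqS R)), determined n C,
    Ex m1 (sdiff E C) < e & Ex m2 (sdiff E C) < e]].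
have sdiffid C (x : seqS R) : sdiff C C x = 0 by rewrite /sdiff subrr normr0.
have KU A B : K A -> K B -> K (A `|` B).
  move=> [mA hA] [mB hB]; split; first exact: measurableU.
  move=> e e0; have e20 : 0 < e / 2 by rewrite divr_gt0.
  have [n [C [mC dC A1 A2]]] := hA _ e20.
  have [n' [C' [mC' dC' B1 B2]]] := hB _ e20.
  have gen (m : probability (seqS R) R) : Ex m (sdiff A C) < e / 2 ->
      Ex m (sdiff B C') < e / 2 -> Ex m (sdiff (A `|` B) (C `|` C')) < e.
    move=> h1 h2.
    apply: (@le_lt_trans _ _ (Ex m (sdiff A C) + Ex m (sdiff B C'))); last by lra.
    rewrite -ExD; [|exact: bmeas_sdiff|exact: bmeas_sdiff].
    apply: Ex_le; [by apply: bmeas_sdiff; exact: measurableU|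
      by apply: bmeasD; exact: bmeas_sdiff|].
    move=> x; rewrite /sdiff !indicE !in_setU.
    case: (x \in A); case: (x \in B); case: (x \in C); case: (x \in C');
    rewrite /= ?subrr ?subr0 ?sub0r ?normrN ?normr1 ?normr0 ?addr0 ?add0r ?ler01//; lra.
  exists (maxn n n'), (C `|` C'); split; first exact: measurableU.
    move=> x y xy [Cx|Cx]; [left|right].
      by apply: (determinedS (leq_maxl n n') dC) Cx.
    by apply: (determinedS (leq_maxr n n') dC') Cx.
  - exact: gen.
  - exact: gen.
have Ksig : sigma_algebra setT K.
  split.
  - split; first exact: measurable0.
    move=> e e0; exists 0%N, set0; split => //.
      by under Ex_ext do rewrite sdiffid; rewrite Ex_cst.
    by under Ex_ext do rewrite sdiffid; rewrite Ex_cst.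
  - move=> A [mA hA]; rewrite setTD; split; first exact: measurableC.
    move=> e e0; have [n [C [mC dC A1 A2]]] := hA _ e0.
    exists n, (~` C); split; first exact: measurableC.
    + move=> x y xy nCx Cy; apply: nCx; apply: dC Cy => i /xy; exact: esym.
    + rewrite (@Ex_ext _ _ _ _ _ (sdiff A C))// => x; rewrite /sdiff !indicE !in_setC.
      by case: (x \in A); case: (x \in C); rewrite /= ?subrr// distrC.
    + rewrite (@Ex_ext _ _ _ _ _ (sdiff A C))// => x; rewrite /sdiff !indicE !in_setC.
      by case: (x \in A); case: (x \in C); rewrite /= ?subrr// distrC.
  - move=> F hF.
    have mF k : measurable (F k) by have [] := hF k.
    have KF n : K (\bigcup_(k in `I_n) F k).
      elim: n => [|n IH].
        rewrite II0 bigcup_set0; split; first exact: measurable0.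
        move=> e e0; exists 0%N, set0; split => //.
          by under Ex_ext do rewrite sdiffid; rewrite Ex_cst.
        by under Ex_ext do rewrite sdiffid; rewrite Ex_cst.
      by rewrite IIS bigcup_setU bigcup_set1; exact: KU.
    split; first exact: bigcupT_measurable.
    move=> e e0; have e20 : 0 < e / 2 by rewrite divr_gt0.
    have [N1 h1] := prob_bigcup_tail m1 mF e20.
    have [N2 h2] := prob_bigcup_tail m2 mF e20.
    have {h1} := h1 _ (leq_maxl N1 N2); have {h2} := h2 _ (leq_maxr N1 N2).
    set n := maxn N1 N2 => h2 h1.
    have [mU hU] := KF n.
    have [m [C [mC dC A1 A2]]] := hU _ e20.
    have mbU : measurable (\bigcup_k F k) by exact: bigcupT_measurable.
    have gen (p : probability (seqS R) R) :
        Ex p \1_(\bigcup_k F k `\` \bigcup_(k in `I_n) F k) < e / 2 ->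
        Ex p (sdiff (\bigcup_(k in `I_n) F k) C) < e / 2 ->
        Ex p (sdiff (\bigcup_k F k) C) < e.
      move=> i1 i2.
      apply: (@le_lt_trans _ _ (Ex p \1_(\bigcup_k F k `\` \bigcup_(k in `I_n) F k)
        + Ex p (sdiff (\bigcup_(k in `I_n) F k) C))); last by lra.
      have bD : bmeas (\1_(\bigcup_k F k `\` \bigcup_(k in `I_n) F k) : seqS R -> R).
        by apply: bmeas_indic; exact: measurableD.
      rewrite -ExD; [|exact: bD|exact: bmeas_sdiff].
      apply: Ex_le; [exact: bmeas_sdiff|by apply: bmeasD => //; exact: bmeas_sdiff|].
      move=> x; rewrite /sdiff !indicE in_setD.
      have : (x \in \bigcup_(k in `I_n) F k) -> x \in \bigcup_k F k.
        by rewrite !inE => -[k _ Fk]; exists k.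
      case: (x \in C); case: (x \in \bigcup_k F k);
        case: (x \in \bigcup_(k in `I_n) F k); rewrite /= ?subrr ?subr0 ?sub0r
         ?normrN ?normr1 ?normr0 ?addr0 ?add0r ?ler01// => /(_ erefl)//.
    by exists m, C; split => //; exact: gen.
move=> mE; have : K E; last by case.
move: E mE; rewrite measurable_seqSE.
apply: smallest_sub => // _ [n [E [mE ->]]].
split; first exact: measurable_rect.
move=> e e0; exists n, (rect n E); split.
- exact: measurable_rect.
- by move=> x y xy h i lin; rewrite -xy//; exact: h.
- by under Ex_ext do rewrite sdiffid; rewrite Ex_cst.
- by under Ex_ext do rewrite sdiffid; rewrite Ex_cst.
Qed.

End cylinder_approximation.

(* [uniform_prob] lives on [measurableTypeR R], whose display differs from the
   one of the canonical measurable structure of [R]. *)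
Definition id_R (R : realType) (x : measurableTypeR R) : Real.sort R := x.

Lemma measurable_id_R (R : realType) :
  @measurable_fun _ default_measure_display (measurableTypeR R) R setT (@id_R R).
Proof. by move=> _ E mE; rewrite setTI; exact: mE. Qed.

HB.instance Definition _ (R : realType) :=
  @isMeasurableFun.Build _ default_measure_display (measurableTypeR R) R
    (@id_R R) (@measurable_id_R R).

Definition uniform01 (R : realType) : probability R R :=
  @distribution _ default_measure_display (measurableTypeR R) R R
    (uniform_prob (@ltr01 R)) (@id_R R).

Arguments uniform01 : simpl never.

(** The tail restarts at [v 0]: for independent [x] and [v] of the same i.i.d. law the spliced
    sequence has this law again, and what lies beyond place [n] can be resampled. *)
Definition hyb (R : realType) (n : nat) (x v : seqS R) : seqS R :=
  fun k => if (k < n)%N then x k else v (k - n)%N.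

Lemma measurable_hyb (R : realType) n (d : measure_display)
    (T : measurableType d) (f g : T -> seqS R) :
  measurable_fun setT f -> measurable_fun setT g ->
  measurable_fun setT (fun w => hyb n (f w) (g w)).
Proof.
move=> mf mg; apply: measurable_seqP => i; rewrite /hyb.
case: (i < n)%N.
  exact: (measurableT_comp (@measurable_coord R i) mf).
exact: (measurableT_comp (@measurable_coord R _) mg).
Qed.

Definition iid_law (R : realType) (L : probability (seqS R) R) : Prop :=
  forall n E, (forall i, measurable (E i)) ->
    L (rect n E) = (\prod_(i < n) uniform01 R (E i))%E.

Lemma measurable_seq_of (d : measure_display) (T : measurableType d)
    (R : realType) (P : probability T R) (X : nat -> {RV P >-> R}) :
  measurable_fun setT (fun w => (fun k => X k w) : seqS R).
Proof. by apply: measurable_seqP => i; exact: measurable_funP. Qed.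

Lemma iid_law_distribution (d : measure_display) (T : measurableType d)
    (R : realType) (P : probability T R) (U : nat -> {RV P >-> R}) :
  iid_uniform01 P U ->
  exists L : probability (seqS R) R, iid_law L /\
    forall E, measurable (E : set (seqS R)) ->
      P [set w | E (fun k => U k w)] = L E.
Proof.
move=> [ind law].
pose U' : {mfun T >-> seqS R} := mfun_Sub (mem_set (measurable_seq_of U) : _ \in mfun).
exists (distribution P U'); split=> // n E mE.
have := ind [fset i in iota 0 n]%fset E mE.
rewrite (_ : \bigcap_(i in _) _ = U' @^-1` rect n E); last first.
  apply/seteqP; split => w /= h i.
    by move=> lin; apply: h => /=; rewrite inE mem_iota.
  by rewrite /= inE mem_iota add0n /= => lin; exact: h.
move=> indE; rewrite [LHS]indE -(big_mkord xpredT (fun i => uniform01 R (E i))).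
rewrite (perm_big (iota 0 n)).
  by rewrite /index_iota subn0; apply: eq_bigr => i _; exact: law.
apply: uniq_perm; [exact: fset_uniq|exact: iota_uniq|].
by move=> i; rewrite inE.
Qed.

(** * Independent uniform sequences and the zero-one law *)

Section iid_sequence.
Variables (R : realType) (L : probability (seqS R) R).
Hypothesis hL : iid_law L.
Local Notation U1 := (uniform01 R).

(** Adding full sides lets a rectangle be seen with any larger number of sides, so that a splitting
    index or the range of a permutation fits in. *)
Let pad (m : nat) (E : nat -> set R) (i : nat) : set R :=
  if (i < m)%N then E i else setT.

Let measurable_pad m E : (forall i, measurable (E i)) ->
  forall i, measurable (pad m E i).
Proof. by move=> mE i; rewrite /pad; case: ifP. Qed.

Let rect_pad m M E : (m <= M)%N -> rect m E = rect M (pad m E) :> set (seqS R).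
Proof.
move=> mM; apply/seteqP; split=> x h i; rewrite /pad.
  by case: ifP => // lim _; exact: h.
by move=> lim; have := h i (leq_trans lim mM); rewrite /pad lim.
Qed.

Lemma law_hyb n E : measurable (E : set (seqS R)) ->
  (L \x L)%E ((fun p => hyb n p.1 p.2) @^-1` E) = L E.
Proof.
move: E; apply: (@seq_law_unique _ _ _ _ _ (L \x L)%E L _ id) => //.
  by apply: measurable_hyb.
move=> m E mE; rewrite (rect_pad E (leq_addl n m)).
set E' := pad m E; have mE' := measurable_pad m mE : forall i, measurable (E' i).
rewrite (_ : _ @^-1` _ = rect n E' `*` rect m (fun i => E' (n + i)%N)); last first.
  apply/seteqP; split=> -[u v] /=.
    move=> h; split=> i ltin /=.
      by have := h i (leq_trans ltin (leq_addr _ _)); rewrite /hyb ltin.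
    have := h (n + i)%N; rewrite ltn_add2l => /(_ ltin).
    by rewrite /hyb ltnNge leq_addr /= addKn.
  move=> [hu hv] i; rewrite /hyb; case: (ltnP i n) => [lin _|nin lim]; first exact: hu.
  have := hv (i - n)%N; rewrite subnKC//; apply.
  by rewrite ltn_subLR.
rewrite [LHS](@product_measure1E _ _ _ _ _ L L); [|exact: measurable_rect|
  by apply: measurable_rect => i; exact: mE'].
rewrite preimage_id !hL// big_split_ord/=; congr (_ * _)%E.
  exact: hL.
by apply: hL => i; exact: mE'.
Qed.

Lemma Ex_hyb n (F : seqS R -> R) : bmeas F ->
  Ex L F = Ex L (fun u => Ex L (fun v => F (hyb n u v))).
Proof.
move=> hF.
rewrite -(@Ex_prod _ _ _ _ _ L L (fun p => F (hyb n p.1 p.2))); last first.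
  by apply: (bmeas_comp hF); apply: measurable_hyb.
rewrite (@Ex_law _ _ _ _ _ _ _ (L \x L)%E L (fun p => hyb n p.1 p.2) id F)//.
- by apply: measurable_hyb.
- by move=> E mE; exact: law_hyb.
Qed.

Lemma finite_involution_lt (s : nat -> nat) K M : involutive s ->
  (forall i, (K <= i)%N -> s i = i) -> (K <= M)%N ->
  forall i, (i < M)%N -> (s i < M)%N.
Proof.
move=> sK sfix KM i iM; rewrite ltnNge; apply/negP => Msi.
have := sfix (s i) (leq_trans KM Msi); rewrite sK => si.
by move: Msi; rewrite -si leqNgt iM.
Qed.

Lemma measurable_reindex (s : nat -> nat) :
  measurable_fun setT (fun x : seqS R => (x \o s) : seqS R).
Proof. by apply: measurable_seqP => i; exact: measurable_coord. Qed.

(** A rectangle with enough sides goes to the rectangle with permuted sides. Only exchanges of two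
    blocks or of two places occur later, hence involutions. *)
Lemma law_perm (s : nat -> nat) K : involutive s ->
  (forall i, (K <= i)%N -> s i = i) ->
  forall E, measurable (E : set (seqS R)) ->
  L ((fun x : seqS R => (x \o s) : seqS R) @^-1` E) = L E.
Proof.
move=> sK sfix; apply: (@seq_law_unique _ _ _ _ _ L L _ id) => //.
  exact: measurable_reindex.
move=> m E mE; rewrite (rect_pad E (leq_maxl m K)).
set M := maxn m K; set E' := pad m E.
have mE' := measurable_pad m mE : forall i, measurable (E' i).
have sM := finite_involution_lt sK sfix (leq_maxr m K).
rewrite (_ : _ @^-1` _ = rect M (E' \o s)); last first.
  apply/seteqP; split=> x /= h i iM.
    by have := h (s i) (sM i iM); rewrite /= sK.
  by have := h (s i) (sM i iM); rewrite /= sK.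
rewrite preimage_id !hL//; last by move=> i; exact: mE'.
pose s' (i : 'I_M) : 'I_M := Ordinal (sM i (ltn_ord i)).
have s'K : involutive s' by move=> i; apply: val_inj; rewrite /= sK.
by rewrite [RHS](reindex_inj (inv_inj s'K)).
Qed.

Lemma Ex_perm (s : nat -> nat) K (F : seqS R -> R) : involutive s ->
  (forall i, (K <= i)%N -> s i = i) -> bmeas F ->
  Ex L (fun x => F (x \o s)) = Ex L F.
Proof.
move=> sK sfix hF.
rewrite (@Ex_law _ _ _ _ _ _ _ L L (fun x : seqS R => (x \o s) : seqS R) id F)//.
- exact: measurable_reindex.
- by move=> E mE; rewrite (law_perm sK sfix).
Qed.

Lemma Ex_coord i (f : R -> R) : bmeas f -> Ex L (fun x => f (x i)) = Ex U1 f.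
Proof.
move=> hf; rewrite (@Ex_law _ _ _ _ _ _ _ L U1 (fun x : seqS R => x i) id f)//.
  exact: measurable_coord.
move=> E mE; rewrite preimage_id.
rewrite (_ : _ @^-1` E = rect i.+1 (fun j => if j == i then E else setT)).
  rewrite hL; last by move=> j; case: ifP.
  rewrite big_ord_recr /= eqxx big1 ?mul1e// => j _.
  by rewrite ltn_eqF//; exact: probability_setT.
apply/seteqP; split=> x /=; first by move=> Ex j _; case: eqP => // ->.
by move=> /(_ i (ltnSn i)); rewrite eqxx.
Qed.

Lemma Ex_coord2 i j (f g : R -> R) : (i < j)%N -> bmeas f -> bmeas g ->
  Ex L (fun x => f (x i) * g (x j)) = Ex U1 f * Ex U1 g.
Proof.
move=> ij hf hg.
have hfi : bmeas (fun x : seqS R => f (x i)).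
  by apply: (bmeas_comp hf); exact: measurable_coord.
have hgj k : bmeas (fun x : seqS R => g (x k)).
  by apply: (bmeas_comp hg); exact: measurable_coord.
rewrite (Ex_hyb j (bmeasM hfi (hgj j))).
rewrite (@Ex_ext _ _ _ _ _ (fun u : seqS R => Ex U1 g * f (u i))); last first.
  move=> u; rewrite -(Ex_coord 0 hg) mulrC -ExZ//; apply: Ex_ext => v.
  by rewrite /hyb ij ltnn subnn.
by rewrite ExZ// Ex_coord// mulrC.
Qed.

(** Approximate [A] by an event [C] on the first [n] coordinates and let [s] exchange the blocks
    [[0, n[] and [[n, 2n[]. By invariance [C] moved by [s] approximates [A] as well, and it is
    independent of [C]; so the probability of [A] is close both to [c] and to [c * c]. *)
Lemma hewitt_savage (A : set (nat -> R)) : measurable (A : set (seqS R)) ->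
  permutation_invariant A -> L A = 0%E \/ L A = 1%E.
Proof.
move=> mA pA.
pose a : R := Ex L (\1_A : seqS R -> R).
have aE : L A = a%:E by rewrite /a Ex_indic.
have bA : bmeas (\1_A : seqS R -> R) by exact: bmeas_indic.
suff : a * (1 - a) = 0.
  move/eqP; rewrite mulf_eq0 subr_eq0 => /orP[/eqP a0|/eqP a1].
    by left; rewrite aE a0.
  by right; rewrite aE -a1.
apply/eqP; rewrite -normr_le0; apply/ler_addgt0Pr => e e0; rewrite add0r.
have e40 : 0 < e / 4 by rewrite divr_gt0.
have [n [C [mC dC AC _]]] := cylinder_approx L L mA e40.
pose s i := if (i < n)%N then (i + n)%N else if (i < n + n)%N then (i - n)%N else i.
have sK : involutive s.
  move=> i; rewrite /s; case: (ltnP i n) => h1.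
    by rewrite ltnNge leq_addl /= ltn_add2r h1 addnK.
  case: (ltnP i (n + n)) => h2.
    by rewrite ltn_subLR// h2 subnK.
  by rewrite ltnNge h1 /= ltnNge h2.
have sfix i : (n + n <= i)%N -> s i = i.
  move=> h; rewrite /s !ltnNge h /=.
  by rewrite (leq_trans (leq_addr _ _) h).
have bC : bmeas (\1_C : seqS R -> R) by exact: bmeas_indic.
have bCs : bmeas (fun x : seqS R => \1_C (x \o s) : R).
  by apply: (bmeas_comp bC); exact: measurable_reindex.
have As (x : seqS R) : \1_A (x \o s) = \1_A x :> R.
  rewrite !indicE; congr ((nat_of_bool _)%:R); apply/idP/idP; rewrite !inE.
    move=> /(pA s _ (inv_bij sK)); congr A.
    by apply/funext => i /=; rewrite sK.
  exact: (pA s _ (inv_bij sK)).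
set c := Ex L (\1_C : seqS R -> R).
have c2 : Ex L (fun x : seqS R => \1_C x * \1_C (x \o s)) = c * c.
  rewrite (Ex_hyb n (bmeasM bC bCs)).
  rewrite (@Ex_ext _ _ _ _ _ (fun u : seqS R => c * \1_C u)); last first.
    move=> u; rewrite mulrC -ExZ//; apply: Ex_ext => v; congr (_ * _).
      rewrite !indicE; congr ((nat_of_bool _)%:R); apply/idP/idP; rewrite !inE.
        by apply: dC => i lin; rewrite /hyb lin.
      by apply: dC => i lin; rewrite /hyb lin.
    have hs i : (i < n)%N -> hyb n u v (s i) = v i.
      by move=> lin; rewrite /hyb /s lin ltnNge leq_addl /= addnK.
    rewrite !indicE; congr ((nat_of_bool _)%:R); apply/idP/idP; rewrite !inE.
      by apply: dC => i lin /=; rewrite hs.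
    by apply: dC => i lin /=; rewrite hs.
  by rewrite ExZ.
have sdE : Ex L (fun x => sdiff A C (x \o s)) = Ex L (sdiff A C).
  by rewrite (Ex_perm sK sfix)//; exact: bmeas_sdiff.
have h1 : `|a - c| < e / 4.
  apply: le_lt_trans AC; rewrite /a /c -ExB//; apply: Ex_norm; exact: bmeasB.
have h2 : `|a - c * c| < e / 4 + e / 4.
  rewrite -c2 /a -ExB//; last exact: bmeasM.
  apply: (@le_lt_trans _ _ (Ex L (sdiff A C) + Ex L (fun x => sdiff A C (x \o s)))).
    have bs := bmeas_sdiff mA mC.
    have bss : bmeas (fun x : seqS R => sdiff A C (x \o s)).
      by apply: (bmeas_comp bs); exact: measurable_reindex.
    have bb : bmeas (fun x : seqS R => \1_A x - \1_C x * \1_C (x \o s) : R).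
      by apply: bmeasB => //; exact: bmeasM.
    rewrite (le_trans (Ex_norm _ bb))// -ExD//; apply: Ex_le.
    - exact: bmeas_norm.
    - exact: bmeasD.
    - move=> x; rewrite /sdiff As !indicE.
      by case: (x \in A); case: (x \in C); case: (_ \in C);
        rewrite /= ?mulr0 ?mulr1 ?mul0r ?subrr ?subr0 ?sub0r ?normrN
         ?normr1 ?normr0 ?addr0 ?add0r ?ler01//; lra.
  by rewrite sdE ltrD.
have a01 : 0 <= a <= 1.
  apply: Ex_01; first by case: bA.
  by move=> x; rewrite indicE; case: (_ \in _); rewrite ?lexx ?ler01.
have c01 : 0 <= c <= 1.
  apply: Ex_01; first by case: bC.
  by move=> x; rewrite indicE; case: (_ \in _); rewrite ?lexx ?ler01.
move: h1; rewrite ltr_norml => /andP[h3 h4].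
move: h2; rewrite ltr_norml => /andP[h5 h6].
move: a01 c01 => /andP[? ?] /andP[? ?].
(* [a - a * a] is the sum of [a - c * c], smaller than [e / 2], and of [(c - a)] times [(c + a)],
   where [c + a <= 2] and [c - a] is smaller than [e / 4]. *)
by rewrite ler_norml; apply/andP; split; nra.
Qed.

End iid_sequence.

(** * Translations of the uniform law *)

Section uniform_shift.
Variable R : realType.
Local Notation U1 := (uniform01 R).
Local Notation leb := (@lebesgue_measure R).

Lemma Ex_uniform01 (f : R -> R) : bmeas f -> (forall x, 0 <= f x) ->
  (Ex U1 f)%:E = (\int[leb]_(x in `[0%R, 1%R]) (f x)%:E)%E.
Proof.
move=> hf f0; rewrite ExE//.
have mf : measurable_fun setT (EFin \o f) by apply/measurable_EFinP; case: hf.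
rewrite [LHS](@ge0_integral_distribution _ default_measure_display
  (measurableTypeR R) R R (uniform_prob (@ltr01 R)) (@id_R R) (EFin \o f) mf).
  rewrite [LHS](@integral_uniform R 0 1 (@ltr01 R) (EFin \o f)).
  - by rewrite subr0 invr1 mul1e.
  - exact: mf.
  - by move=> x; rewrite lee_fin.
by move=> x; rewrite lee_fin.
Qed.

Lemma lebesgue_measure_translate (x : R) (A : set R) : measurable A ->
  pushforward leb (+%R x : R -> measurableTypeR R) A = leb A.
Proof.
move=> mA.
have mx : measurable_fun setT (+%R x : R -> R).
  by apply: measurable_funD; [exact: measurable_cst|exact: measurable_id].
apply/esym/lebesgue_measure_unique => //= _ [[a b]] _ <-.
rewrite /pushforward (_ : _ @^-1` _ = `]a - x, b - x]%classic); last first.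
  by apply/seteqP; split=> y /=; rewrite !in_itv/= => /andP[? ?];
    apply/andP; split; lra.
rewrite !lebesgue_measure_itv/= !lte_fin ltrD2r.
by case: ifP => // _; congr EFin; ring.
Qed.

(** Translation invariance of Lebesgue measure: a translated uniform variable has density at most 1
    on the unit interval, and the indicator discards what leaves it. *)
Lemma Ex_uniform_shift (x : R) (f : R -> R) : bmeas f -> (forall y, 0 <= f y) ->
  Ex U1 (fun s => f (x + s) * \1_`[0%R, 1%R] (x + s)) <= Ex U1 f.
Proof.
move=> hf f0.
have mD : measurable (`[0%R, 1%R]%classic : set R) by exact: measurable_itv.
pose g (y : R) := f y * \1_`[0%R, 1%R] y.
have hg : bmeas g by apply: bmeasM => //; exact: bmeas_indic.
have g0 y : 0 <= g y by rewrite /g mulr_ge0// indicE.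
have mx : measurable_fun setT (+%R x : R -> R).
  by apply: measurable_funD; [exact: measurable_cst|exact: measurable_id].
have hgx : bmeas (fun s => g (x + s)) by apply: (bmeas_comp hg).
have mg : measurable_fun setT (EFin \o g) by apply/measurable_EFinP; case: hg.
rewrite -lee_fin !Ex_uniform01//.
have -> : (\int[leb]_(y in `[0%R, 1%R]) (f y)%:E = \int[leb]_y (g y)%:E)%E.
  rewrite integral_mkcond; apply: eq_integral => y _.
  rewrite patchE /g indicE; case: ifP => _; rewrite ?mulr1 ?mulr0//.
have -> : (\int[leb]_y (g y)%:E = \int[leb]_y (g (x + y))%:E)%E.
  transitivity (\int[pushforward leb (+%R x : R -> measurableTypeR R)]_y (g y)%:E)%E.
    apply: eq_measure_integral => A mA _.
    by apply/esym/lebesgue_measure_translate.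
  have mx' : @measurable_fun _ _ (measurableTypeR R) (measurableTypeR R)
      setT (+%R x) by exact: mx.
  rewrite [LHS](@ge0_integral_pushforward _ _ (measurableTypeR R)
    (measurableTypeR R) R (+%R x) mx' leb setT (EFin \o g))// => y _.
  by rewrite lee_fin.
apply: ge0_subset_integral => //.
- by apply/measurable_EFinP; case: hgx.
- by move=> y _; rewrite lee_fin; exact: g0.
- by move=> y; exact: g0.
Qed.

Lemma Ex_uniform_itv (a b : R) : a <= b -> Ex U1 \1_`[a, b] <= b - a.
Proof.
move=> ab; have mI : measurable (`[a, b]%classic : set R) by exact: measurable_itv.
have bI : bmeas (\1_`[a, b] : R -> R) by exact: bmeas_indic.
have I0 x : 0 <= (\1_`[a, b] : R -> R) x by rewrite indicE.
rewrite -lee_fin (Ex_uniform01 bI I0) (_ : (b - a)%:E = leb `[a, b]); last first.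
  by rewrite lebesgue_measure_itv/= lte_fin; case: ltgtP ab => // -> _; rewrite subrr.
rewrite (_ : leb `[a, b] = \int[leb]_y ((\1_`[a, b] : R -> R) y)%:E)%E; last first.
  by rewrite integral_indic// setIT.
apply: ge0_subset_integral => //.
by apply/measurable_EFinP; exact: measurable_indic.
Qed.

Lemma Ex_uniform_le_itv (f : R -> R) (a b : R) : a <= b ->
  measurable_fun setT f -> (forall x, 0 <= f x <= 1) ->
  (forall x, f x != 0 -> a <= x <= b) -> Ex U1 f <= b - a.
Proof.
move=> ab mf f01 fab; apply: le_trans (Ex_uniform_itv ab).
apply: Ex_le; [exact: bmeas_01|by apply: bmeas_indic; exact: measurable_itv|].
move=> x; rewrite indicE; case: (eqVneq (f x) 0) => [->//|/fab h].
have /andP[_ h1] := f01 x.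
by rewrite mem_set//= in_itv/= h.
Qed.

(** The part of the unit interval pushed beyond 1 has length at most [x], and [f] is at most 1
    there. *)
Lemma Ex_uniform_shift_le (x : R) (f : R -> R) : 0 <= x ->
  measurable_fun setT f -> (forall y, 0 <= f y <= 1) ->
  Ex U1 (fun a => f (a + x)) <= Ex U1 f + x.
Proof.
move=> x0 mf f01.
have f0 y : 0 <= f y by case/andP: (f01 y).
have hf := bmeas_01 mf f01.
have mx : measurable_fun setT (+%R x : R -> R).
  by apply: measurable_funD; [exact: measurable_cst|exact: measurable_id].
have mD : measurable (`[0%R, 1%R]%classic : set R) by exact: measurable_itv.
have mE : measurable (`[1 - x, 1]%classic : set R) by exact: measurable_itv.
have bI : bmeas (\1_`[0%R, 1%R] : R -> R) by exact: bmeas_indic.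
have b1 : bmeas (fun s => f (x + s) * \1_`[0%R, 1%R] (x + s)).
  apply: bmeasM; first exact: (bmeas_comp hf).
  exact: (bmeas_comp bI).
have b2 : bmeas (\1_`[1 - x, 1] : R -> R) by exact: bmeas_indic.
have b3 : bmeas (fun a : R => f (a + x)).
  rewrite (_ : (fun a => _) = (fun a => f (x + a))); first exact: (bmeas_comp hf).
  by apply/funext => a; rewrite addrC.
apply: (@le_trans _ _ (Ex U1 (fun s => f (x + s) * \1_`[0%R, 1%R] (x + s)) +
   Ex U1 \1_`[1 - x, 1])); last first.
  apply: lerD; first exact: Ex_uniform_shift.
  by apply: le_trans (Ex_uniform_itv _) _; lra.
(* outside [0, 1] both sides are irrelevant for the uniform law *)
have supp (g : R -> R) : bmeas g -> (forall y, 0 <= g y) ->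
    Ex U1 g = Ex U1 (fun s => g s * \1_`[0%R, 1%R] s).
  move=> hg g0; apply: EFin_inj; rewrite !Ex_uniform01//.
  - apply: eq_integral => y; rewrite inE/= => yI.
    by rewrite indicE mem_set// mulr1.
  - by apply: bmeasM.
  - by move=> y; rewrite mulr_ge0// indicE.
rewrite supp// -ExD//; apply: Ex_le; [exact: bmeasM|exact: bmeasD|].
move=> s; rewrite !indicE; have /andP[h0 h1] := f01 (x + s); rewrite (addrC s).
have [sI|] := boolP (s \in _); last by rewrite mulr0 addr_ge0// mulr_ge0.
have [xsI|xsI] := boolP (x + s \in _); first by rewrite !mulr1 lerDl.
rewrite mulr0 add0r mulr1 mem_set//=.
move: sI xsI; rewrite inE/= in_itv/= => /andP[s0 s1] /negP.
rewrite inE/= in_itv/= => /negP; rewrite negb_and -!ltNge in_itv/=.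
by move=> /orP[|] ?; apply/andP; split; lra.
Qed.

End uniform_shift.

(** * Minimizers as measurable functionals of a path *)

Section first_selection.
Context (d d' : measure_display) (T : measurableType d) (V : measurableType d').
Variables (G : nat -> set T) (f : nat -> T -> V) (f0 : T -> V).

Definition first_sel (w : T) : V :=
  if pselect (exists k, `[< G k w >]) is left h then f (ex_minn h) w else f0 w.

Lemma first_selP w :
  (exists k, [/\ G k w, forall j, (j < k)%N -> ~ G j w & first_sel w = f k w]) \/
  ((forall k, ~ G k w) /\ first_sel w = f0 w).
Proof.
rewrite /first_sel; case: pselect => [h|h].
  left; case: ex_minnP => k /asboolP Gk kmin; exists k; split => // j jk Gj.
  by have /kmin := asboolT Gj; rewrite leqNgt jk.
by right; split => // k Gk; apply: h; exists k; exact: asboolT.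
Qed.

Lemma measurable_first_sel : (forall k, measurable (G k)) ->
  (forall k, measurable_fun setT (f k)) -> measurable_fun setT f0 ->
  measurable_fun setT first_sel.
Proof.
move=> mG mf mf0 _ E mE; rewrite setTI.
rewrite (_ : _ @^-1` E =
   \bigcup_k ((G k `&` (\bigcap_j (if (j < k)%N then ~` G j else setT))) `&` f k @^-1` E)
   `|` ((\bigcap_k ~` G k) `&` f0 @^-1` E)); last first.
  apply/seteqP; split=> w /=.
    have [[k [Gk kmin ->]]|[nG ->]] := first_selP w.
      left; exists k => //; split => //; split => // j _.
      by case: ifP => // /kmin.
    by right; split=> // k _; exact: nG.
  have [[k [Gk kmin ->]]|[nG ->]] := first_selP w.
    move=> [[k' _ [[Gk' h] Ek']]|[h _]]; last by have := h k I.
    suff -> : k = k' by [].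
    have [kk'|k'k|//] := ltngtP k k'.
      by have := h k I; rewrite kk'.
    by have := kmin _ k'k.
  by move=> [[k _ [[Gk _] _]]|[]//]; have := nG k.
have mpre (g : T -> V) : measurable_fun setT g -> measurable (g @^-1` E).
  by move=> mg; rewrite -[X in measurable X]setTI; exact: mg.
apply: measurableU; last first.
  apply: measurableI; last exact: mpre.
  by apply: bigcapT_measurable => k; exact: measurableC.
apply: bigcupT_measurable => k; apply: measurableI; last exact: mpre.
apply: measurableI => //; apply: bigcapT_measurable => j.
by case: ifP => // _; exact: measurableC.
Qed.

End first_selection.

Section strict_argmin.
Variable R : realType.
Implicit Types (p q c d r t : rat) (w : seqS R).

(* A path is coded by its values at the rationals. *)
Definition path_of (g : R -> R) : seqS R :=
  fun k => oapp (fun q : rat => g (ratr q)) 0 (choice.unpickle k).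

(** The margin [k.+1%:R^-1] does not depend on [t], so that strictness survives the passage from
    rational to real times by continuity. *)
Definition localized p q c d : set (seqS R) :=
  [set w | exists r (k : nat), c < r < d /\ forall t,
     p <= t <= q -> ~~ (c < t < d) ->
     w (choice.pickle r) + k.+1%:R^-1 <= w (choice.pickle t)].

Definition bracket p q (cd : rat * rat) : bool :=
  [&& p < cd.1, cd.1 < cd.2 & cd.2 < q].

(* For a continuous path: the minimum over [p, q] is attained at a single point,
   which lies in ]p, q[. It is stated with rationals only, hence measurable. *)
Definition strict_min p q : set (seqS R) :=
  [set w | forall n : nat, exists2 cd, bracket p q cd /\
     ratr (cd.2 - cd.1) < n.+1%:R^-1 :> R & localized p q cd.1 cd.2 w].

(* -1 is a junk value. *)
Definition argm p q w : R :=
  if `[< strict_min p q w >] then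
    inf [set ratr cd.2 | cd in [set cd | bracket p q cd /\ localized p q cd.1 cd.2 w]]
  else -1.

Lemma measurable_localized p q c d : measurable (localized p q c d).
Proof.
rewrite (_ : localized p q c d = \bigcup_(r : rat) \bigcup_(k : nat)
   \bigcap_(n : nat) [set w | c < r < d /\ oapp (fun t : rat =>
      p <= t <= q -> ~~ (c < t < d) -> w (choice.pickle r) + k.+1%:R^-1 <= w (choice.pickle t))
      True (choice.unpickle n)]); last first.
  apply/seteqP; split=> w.
    move=> [r [k [crd h]]]; exists r => //; exists k => // n _ /=; split=> //.
    by case: choice.unpickle => //= t; exact: h.
  move=> [r _ [k _ h]]; exists r, k; split; first by have [] := h 0%N I.
  by move=> t; have [_] := h (choice.pickle t) I; rewrite choice.pickleK.
apply: bigcupT_measurable_rat => r; apply: bigcupT_measurable => k.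
apply: bigcapT_measurable => n.
case: (c < r < d); last first.
  by rewrite (_ : mkset _ = set0)//; apply/seteqP; split=> // w [].
case: (choice.unpickle n) => [t|] /=; last first.
  by rewrite (_ : mkset _ = setT)//; apply/seteqP; split.
case: (p <= t <= q); last first.
  by rewrite (_ : mkset _ = setT)//; apply/seteqP; split.
case: (c < t < d).
  by rewrite (_ : mkset _ = setT)//; apply/seteqP; split.
rewrite (_ : mkset _ = [set w | w (choice.pickle r) + k.+1%:R^-1 <= w (choice.pickle t)]).
  have mf : measurable_fun setT (fun w : seqS R =>
      w (choice.pickle r) + k.+1%:R^-1 <= w (choice.pickle t)).
    apply: measurable_fun_ler; last exact: measurable_coord.
    by apply: measurable_funD; [exact: measurable_coord|exact: measurable_cst].
  have := mf measurableT [set true] I.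
  by rewrite setTI; congr measurable; apply/seteqP; split.
by apply/seteqP; split=> w /=; [move=> [_]; exact|move=> h; split].
Qed.

Lemma measurable_strict_min p q : measurable (strict_min p q).
Proof.
rewrite (_ : strict_min p q = \bigcap_(n : nat) \bigcup_(c : rat) \bigcup_(d : rat)
  (if bracket p q (c, d) && (ratr (d - c) < n.+1%:R^-1 :> R) then localized p q c d
   else set0)); last first.
  apply/seteqP; split=> w.
    move=> h n _; have [[c d] [/= h1 h2] h3] := h n.
    by exists c => //; exists d => //; rewrite h1 h2.
  move=> h n; have [c _ [d _]] := h n I; case: ifP => // /andP[h1 h2] h3.
  by exists (c, d).
apply: bigcapT_measurable => n.
apply: bigcupT_measurable_rat => c; apply: bigcupT_measurable_rat => d.
by case: ifP => // _; exact: measurable_localized.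
Qed.

(** Unfolds the infimum, so that preimages of half-lines under [argm] become countable unions of
    events [localized]. *)
Lemma argm_lt p q w (x : R) : strict_min p q w ->
  argm p q w < x <-> exists c d, [/\ bracket p q (c, d),
     localized p q c d w & ratr d < x].
Proof.
move=> sw; rewrite /argm asboolT//.
set A := (X in inf X).
have hA : has_inf A.
  split.
    by have [cd [h1 _] h2] := sw 0%N; exists (ratr cd.2), cd.
  exists (ratr p) => _ [cd [/and3P[h1 h2 _] _] <-].
  by rewrite ler_rat ltW// (lt_trans h1).
split.
  move=> /(inf_lt hA.1)[_ [[c d] [/= h1 h2] <-]] dx.
  by exists c, d.
move=> [c [d [h1 h2 dx]]]; apply: le_lt_trans dx.
by apply: ge_inf => //; [exact: hA.2|exists (c, d)].
Qed.

Lemma measurable_argm p q : measurable_fun setT (argm p q).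
Proof.
apply: (measurability _ (RGenInftyO.measurableE R)) => _ [_ [x ->] <-].
rewrite setTI (_ : _ @^-1` _ =
  (strict_min p q `&` \bigcup_(c : rat) \bigcup_(d : rat)
     (if bracket p q (c, d) && (ratr d < x) then localized p q c d else set0))
  `|` (~` strict_min p q `&` [set _ | -1 < x])); last first.
  apply/seteqP; split=> w /=; rewrite in_itv/=.
    have [sw|nsw] := pselect (strict_min p q w).
      move=> /(argm_lt _ sw)[c [d [h1 h2 h3]]]; left; split=> //.
      by exists c => //; exists d => //; rewrite h1 h3.
    by rewrite /argm asboolF// => h; right.
  move=> [[sw [c _ [d _]]]|[nsw]]; last by rewrite /argm asboolF.
  case: ifP => // /andP[h1 h2] h3; apply/(argm_lt _ sw).
  by exists c, d.
apply: measurableU.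
  apply: measurableI; first exact: measurable_strict_min.
  apply: bigcupT_measurable_rat => c; apply: bigcupT_measurable_rat => d.
  by case: ifP => // _; exact: measurable_localized.
apply: measurableI; first by apply: measurableC; exact: measurable_strict_min.
case: (-1 < x).
  by rewrite (_ : mkset _ = setT)//; apply/seteqP; split.
by rewrite (_ : mkset _ = set0)//; apply/seteqP; split.
Qed.

End strict_argmin.

Section strict_argmin_correct.
Variable R : realType.
Implicit Types (p q c d r t : rat) (w : seqS R) (b : R -> R).

Lemma continuous_eps b (x e : R) : continuous b -> 0 < e ->
  exists2 dl, 0 < dl & forall y, `|y - x| < dl -> `|b y - b x| < e.
Proof.
move=> cb e0; have /cvgrPdist_lt/(_ e e0) := cb x.
move=> /nbhs_ballP[dl /= dl0 h]; exists dl => // y xy.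
by rewrite distrC; apply: h; rewrite /ball/= distrC.
Qed.

Lemma le_of_rat b p q (m v : R) : continuous b -> p < q ->
  ratr p <= m <= ratr q ->
  (forall t, p <= t <= q -> v <= b (ratr t)) -> v <= b m.
Proof.
move=> cb pq /andP[pm mq] h; rewrite leNgt; apply/negP => bmv.
have [|dl dl0 hd] := @continuous_eps b m (v - b m) cb; first by rewrite subr_gt0.
have pq' : ratr p < ratr q :> R by rewrite ltr_rat.
have : Num.max (ratr p) (m - dl) < Num.min (ratr q) (m + dl).
  by rewrite lt_min !gt_max; apply/andP; split; apply/andP; split; lra.
move=> /rat_in_itvoo[t]; rewrite in_itv/= gt_max lt_min.
move=> /andP[/andP[pt mt] /andP[tq tm]].
have /hd : `|ratr t - m| < dl by rewrite ltr_distlC; apply/andP; split; lra.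
rewrite ltr_norml => /andP[_ h1].
have : p <= t <= q by rewrite -(ler_rat R) -(ler_rat R t) !ltW.
by move=> /h; lra.
Qed.

(** If [m] were outside []c, d[], the density of the rationals in [[p, c]] or [[d, q]] would extend
    the margin to [m], and [m] would lie strictly above the rational point [r]. *)
Lemma localized_minimizer b p q c d w (m : R) : continuous b ->
  (forall t, p <= t <= q -> w (choice.pickle t) = b (ratr t)) ->
  bracket p q (c, d) -> localized p q c d w ->
  ratr p <= m <= ratr q ->
  (forall t, p <= t <= q -> b m <= b (ratr t)) -> ratr c < m < ratr d.
Proof.
move=> cb wb /and3P[/= pc cd dq] [r [k [/andP[cr rd] h]]] /andP[pm mq] mmin.
have k0 : (0 : R) < k.+1%:R^-1 by rewrite invr_gt0 ltr0n.
have pr : p <= r <= q by rewrite (ltW (lt_trans pc cr)) (ltW (lt_trans rd dq)).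
have rE := wb r pr.
have mr := mmin r pr.
apply/andP; split; rewrite ltNge; apply/negP => hm.
  have : b (ratr r) + k.+1%:R^-1 <= b m.
    apply: (le_of_rat (p := p) (q := c)) => //; first by rewrite pm.
    move=> t /andP[pt tc].
    have pt' : p <= t <= q.
      by rewrite pt (le_trans tc)// (ltW (lt_trans cd dq)).
    rewrite -rE -wb//; apply: h => //.
    by rewrite negb_and -leNgt tc.
  by move=> /le_trans/(_ mr); rewrite gerDl leNgt k0.
have : b (ratr r) + k.+1%:R^-1 <= b m.
  apply: (le_of_rat (p := d) (q := q)) => //; first by rewrite hm.
  move=> t /andP[dt tq].
  have pt' : p <= t <= q.
    by rewrite tq andbT (le_trans _ dt)// (ltW (lt_trans pc cd)).
  rewrite -rE -wb//; apply: h => //.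
  by rewrite negb_and -!leNgt dt orbT.
by move=> /le_trans/(_ mr); rewrite gerDl leNgt k0.
Qed.

(** A minimum exists by compactness. Every bracket contains every point where it is attained, and
    brackets are arbitrarily short: so the point is unique and equals the infimum of the right
    ends. *)
Lemma strict_min_argm b p q w : continuous b -> p < q ->
  (forall t, p <= t <= q -> w (choice.pickle t) = b (ratr t)) ->
  strict_min p q w ->
  ratr p < argm p q w < ratr q /\
  forall x, ratr p <= x <= ratr q -> x != argm p q w -> b (argm p q w) < b x.
Proof.
move=> cb pq wb sw.
have pq' : ratr p <= ratr q :> R by rewrite ler_rat ltW.
have [m] := EVT_min pq' (continuous_subspaceT cb).
rewrite in_itv/= => pmq mmin.
have ratin t : p <= t <= q -> ratr t \in `[ratr p : R, ratr q]%R.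
  by move=> /andP[pt tq]; rewrite in_itv/= !ler_rat pt tq.
have loc (x : R) c d : bracket p q (c, d) -> localized p q c d w ->
    ratr p <= x <= ratr q -> b x <= b m -> ratr c < x < ratr d.
  move=> h1 h2 h3 h4; apply: (localized_minimizer cb wb h1 h2 h3) => t /ratin/mmin.
  exact: le_trans.
have uniq (x : R) : ratr p <= x <= ratr q -> b x <= b m -> x = m.
  move=> px bxm; apply/eqP; rewrite -subr_eq0 -normr_le0.
  apply/ler_addgt0Pr => e e0; rewrite add0r.
  have [n hn] : exists n : nat, n.+1%:R^-1 < e.
    have /cvgrPdist_lt/(_ e e0)[n _ /(_ n (leqnn n))] := @cvg_harmonic R.
    rewrite sub0r normrN ger0_norm ?invr_ge0//= => hn.
    by exists n.
  have [[c d] [/= h1 h2] h3] := sw n.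
  have /andP[k1 k2] := loc x c d h1 h3 px bxm.
  have /andP[k3 k4] := loc m c d h1 h3 pmq (lexx _).
  move: h2 hn; rewrite rmorphB/=; move: (_%:R^-1) => K h2 hn.
  by rewrite ler_norml; apply/andP; split; lra.
have -> : argm p q w = m.
  apply/eqP; rewrite eq_le; apply/andP; split.
    apply/ler_addgt0Pr => e e0; apply: ltW; apply/(argm_lt _ sw).
    have [n hn] : exists n : nat, n.+1%:R^-1 < e.
      have /cvgrPdist_lt/(_ e e0)[n _ /(_ n (leqnn n))] := @cvg_harmonic R.
      rewrite sub0r normrN ger0_norm ?invr_ge0//= => hn.
      by exists n.
    have [[c d] [/= h1 h2] h3] := sw n; exists c, d; split => //.
    have /andP[k3 k4] := loc m c d h1 h3 pmq (lexx _).
    by move: h2 hn; rewrite rmorphB/=; move: (_%:R^-1) => K h2 hn; lra.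
  rewrite leNgt; apply/negP => /(argm_lt _ sw)[c [d [h1 h2 h3]]].
  have /andP[k3 k4] := loc m c d h1 h2 pmq (lexx _).
  by have := lt_trans h3 k4; rewrite ltxx.
split.
  have [[c d] [/= h1 h2] h3] := sw 0%N.
  have /andP[k3 k4] := loc m c d h1 h3 pmq (lexx _).
  have /and3P[/= pc _ dq] := h1.
  rewrite -(ltr_rat R) in pc; rewrite -(ltr_rat R) in dq.
  by apply/andP; split; lra.
move=> x px xm; rewrite ltNge; apply/negP => bxm.
by move/eqP: xm; apply; exact: uniq.
Qed.

Lemma argm_of_strict b p q w (s : R) : continuous b -> p < q ->
  (forall t, p <= t <= q -> w (choice.pickle t) = b (ratr t)) ->
  ratr p < s < ratr q ->
  (forall x, ratr p <= x <= ratr q -> x != s -> b s < b x) ->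
  strict_min p q w /\ argm p q w = s.
Proof.
move=> cb pq wb /andP[ps sq] smin.
have sw : strict_min p q w.
  move=> n.
  have : (0 : R) < n.+1%:R^-1 by rewrite invr_gt0 ltr0n.
  move: (_%:R^-1) => K n0.
  have /rat_in_itvoo[c] : Num.max (ratr p) (s - K / 2) < s.
    by rewrite gt_max; apply/andP; split; lra.
  rewrite in_itv/= gt_max => /andP[/andP[pc sc] cs].
  have /rat_in_itvoo[d] : s < Num.min (ratr q) (s + K / 2).
    by rewrite lt_min; apply/andP; split; lra.
  rewrite in_itv/= lt_min => /andP[sd /andP[dq ds]].
  have br : bracket p q (c, d).
    apply/and3P; split; rewrite /= -(ltr_rat R) => //.
    exact: lt_trans cs sd.
  exists (c, d); first by split => //=; rewrite rmorphB/=; lra.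
  have [m1 m1i m1min] := EVT_min (ltW pc) (continuous_subspaceT cb).
  have [m2 m2i m2min] := EVT_min (ltW dq) (continuous_subspaceT cb).
  rewrite in_itv/= in m1i; rewrite in_itv/= in m2i.
  move: m1i m2i => /andP[? ?] /andP[? ?].
  have bm1 : b s < b m1.
    by apply: smin; [apply/andP; split; lra|rewrite lt_eqF//; lra].
  have bm2 : b s < b m2.
    by apply: smin; [apply/andP; split; lra|rewrite gt_eqF//; lra].
  (* Half of the gap between [b s] and the minimum outside []c, d[]: one half bounds the loss when
     [s] is replaced by a rational [r], the other contains the margin [k.+1%:R^-1]. *)
  pose g := (Num.min (b m1) (b m2) - b s) / 2.
  have g0 : 0 < g by rewrite divr_gt0// subr_gt0 lt_min bm1 bm2.
  have gm1 : b s + g + g <= b m1.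
    have : Num.min (b m1) (b m2) <= b m1 by rewrite ge_min lexx.
    by rewrite /g; lra.
  have gm2 : b s + g + g <= b m2.
    have : Num.min (b m1) (b m2) <= b m2 by rewrite ge_min lexx orbT.
    by rewrite /g; lra.
  have [dl dl0 hdl] := continuous_eps s cb g0.
  have /rat_in_itvoo[r] : Num.max (ratr c) (s - dl) < Num.min (ratr d) (s + dl).
    by rewrite lt_min !gt_max; apply/andP; split; apply/andP; split; lra.
  rewrite in_itv/= gt_max lt_min => /andP[/andP[cr sr] /andP[rd rs]].
  have br' : b (ratr r) < b s + g.
    have /hdl : `|ratr r - s| < dl by rewrite ltr_distlC; apply/andP; split; lra.
    by rewrite ltr_norml => /andP[]; lra.
  have [k hk] : exists k : nat, k.+1%:R^-1 < g.
    have /cvgrPdist_lt/(_ g g0)[k _ /(_ k (leqnn k))] := @cvg_harmonic R.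
    by rewrite sub0r normrN ger0_norm ?invr_ge0//= => hk; exists k.
  have pr : p <= r <= q.
    by apply/andP; split; rewrite -(ler_rat R); lra.
  exists r, k; split; first by apply/andP; split; rewrite -(ltr_rat R).
  move=> t pt; rewrite negb_and -!leNgt => tcd; rewrite !wb//.
  move: pt => /andP[]; rewrite -(ler_rat R p) -(ler_rat R t) => pt tq.
  have [tc|dt] := orP tcd.
    rewrite -(ler_rat R) in tc.
    have : b m1 <= b (ratr t) by apply: m1min; rewrite in_itv/= pt tc.
    by move: hk; move: (_%:R^-1) => K0 *; lra.
  rewrite -(ler_rat R) in dt.
  have : b m2 <= b (ratr t) by apply: m2min; rewrite in_itv/= dt tq.
  by move: hk; move: (_%:R^-1) => K0 *; lra.
split => //.
have [/andP[h1 h2] h3] := strict_min_argm cb pq wb sw.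
apply/eqP; apply: contraT => h.
have h4 : b s < b (argm p q w) by apply: smin => //; rewrite !ltW.
have : b (argm p q w) < b s.
  by apply: h3; [apply/andP; split; lra|rewrite eq_sym].
by move=> /lt_trans/(_ h4); rewrite ltxx.
Qed.

End strict_argmin_correct.

(** * Independent increments *)

Section independence_of_generated.
Context (d : measure_display) (T : measurableType d) (R : realType).
Variable P : probability T R.

Lemma sub_measurable_generated (C : set (set T)) : C `<=` measurable ->
  <<s C >> `<=` measurable.
Proof. by move=> h; apply: smallest_sub => //; exact: sigma_algebra_measurable. Qed.

Let half (C : set (set T)) (F : set T) : C `<=` measurable -> setI_closed C ->
  measurable F -> (forall E, C E -> P (E `&` F) = (P E * P F)%E) ->
  forall E, <<s C >> E -> P (E `&` F) = (P E * P F)%E.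
Proof.
move=> mC CI mF h E sE.
(* Uniqueness of measures needs an exhausting sequence inside the pi-system, which [setT]
   provides. *)
pose C' := C `|` [set setT].
have C'I : setI_closed C'.
  move=> A B [CA|->] [CB|->]; rewrite ?setIT ?setTI; try by [left|right].
  by left; exact: CI.
have mC' : C' `<=` measurable by move=> A [/mC//|->].
have rF : (0 <= fine (P F)) by rewrite fine_ge0.
pose m2 := mscale (NngNum rF) P.
have m2E A : m2 A = (P A * P F)%E.
  by rewrite /m2 /mscale/= fineK ?fin_num_measure// muleC.
suff K : mrestr P mF E = m2 E by rewrite -m2E.
apply: (@g_sigma_algebra_measure_unique _ R T C' mC' (fun=> setT) _ _
  (mrestr P mF) m2) => //.
- by move=> _; right.
- by rewrite bigcup_const.
- move=> A CA; apply/esym; apply: (etrans (m2E A)); rewrite /= /mrestr.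
  case: CA => [CA|->]; first by rewrite h.
  by rewrite setTI probability_setT mul1e.
- move=> _; apply: (@le_lt_trans _ _ 1%E); last exact: ltry.
  by apply: probability_le1; exact: measurableI.
- by apply: sub_sigma_algebra2 sE => A CA; left.
Qed.

Lemma pi_indep (C D : set (set T)) : C `<=` measurable -> D `<=` measurable ->
  setI_closed C -> setI_closed D ->
  (forall E F, C E -> D F -> P (E `&` F) = (P E * P F)%E) ->
  forall E F, <<s C >> E -> <<s D >> F -> P (E `&` F) = (P E * P F)%E.
Proof.
move=> mC mD CI DI h E F sE sF.
have mE := sub_measurable_generated mC sE.
rewrite setIC muleC; apply: (half mD DI mE) sF => F' DF'.
rewrite setIC muleC; apply: (half mC CI (mD _ DF')) sE => E' CE'.
exact: h.
Qed.

End independence_of_generated.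

Section independent_increments.
Context (d : measure_display) (T : measurableType d) (R : realType).
Variables (P : probability T R) (B : R -> T -> R).
Hypothesis mB : forall t, measurable_fun setT (B t).
Hypothesis indB : forall (n : nat) (t : nat -> R), 0 <= t 0%N -> t n <= 1 ->
  (forall i, (i < n)%N -> t i <= t i.+1) ->
  mutually_independent P (fun i : 'I_n => B (t i.+1) \- B (t i)).

Definition incr (s t : R) (w : T) : R := B t w - B s w.

Lemma measurable_incr s t : measurable_fun setT (incr s t).
Proof. exact: measurable_funB. Qed.

Lemma measurable_incr_pre s t E : measurable E -> measurable (incr s t @^-1` E).
Proof.
by move=> mE; rewrite -[X in measurable X]setTI; exact: measurable_incr.
Qed.

Lemma grid_prob n (t : nat -> R) (E : nat -> set R) :
  0 <= t 0%N -> t n <= 1 -> (forall i, (i < n)%N -> t i <= t i.+1) ->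
  (forall i, measurable (E i)) ->
  P [set w | forall i, (i < n)%N -> E i (incr (t i) (t i.+1) w)] =
  (\prod_(i < n) P (incr (t i) (t i.+1) @^-1` E i))%E.
Proof.
move=> t0 tn tS mE.
have := indB t0 tn tS [fset i in enum 'I_n]%fset (fun i => mE i).
rewrite (_ : \bigcap_(i in _) _ =
  [set w | forall i, (i < n)%N -> E i (incr (t i) (t i.+1) w)]); last first.
  apply/seteqP; split => w /= h i.
    by move=> lin; apply: (h (Ordinal lin)); rewrite /= inE mem_enum.
  by move=> _; exact: h.
move=> ->; rewrite (perm_big (index_enum 'I_n))//.
apply: uniq_perm; [exact: fset_uniq|exact: index_enum_uniq|].
by move=> i; rewrite mem_index_enum inE mem_enum.
Qed.

Definition grid (l : seq R) : seq R := sort <=%R (undup l).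

Lemma mem_grid l x : (x \in grid l) = (x \in l).
Proof. by rewrite mem_sort mem_undup. Qed.

Lemma grid_lt l i j : (i < j < size (grid l))%N ->
  nth 0%R (grid l) i < nth 0%R (grid l) j.
Proof.
move=> /andP[ij js].
have ss : sorted <%R (grid l) by rewrite sort_lt_sorted undup_uniq.
by apply: (sorted_ltn_nth lt_trans 0 ss) => //; rewrite inE// (ltn_trans ij).
Qed.

Lemma grid_le l i j : (i <= j < size (grid l))%N ->
  nth 0%R (grid l) i <= nth 0%R (grid l) j.
Proof.
move=> /andP[]; rewrite leq_eqVlt => /orP[/eqP->//|ij js].
by apply/ltW/grid_lt; rewrite ij js.
Qed.

Lemma grid_index_le l s t : s \in l -> t \in l -> s <= t ->
  (index s (grid l) <= index t (grid l))%N.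
Proof.
move=> sl tl st; rewrite leqNgt; apply/negP => h.
have := @grid_lt l (index t (grid l)) (index s (grid l)).
rewrite h index_mem mem_grid sl => /(_ erefl).
by rewrite !nth_index ?mem_grid// ltNge st.
Qed.

Lemma incr_grid l s t w : s \in l -> t \in l -> s <= t ->
  incr s t w = \sum_(index s (grid l) <= k < index t (grid l))
    incr (nth 0%R (grid l) k) (nth 0%R (grid l) k.+1) w.
Proof.
move=> sl tl st; rewrite /incr.
rewrite (telescope_sumr (fun k => B (nth 0%R (grid l) k) w)) ?grid_index_le//.
by rewrite !nth_index ?mem_grid.
Qed.

(** [I] selects cells of the grid spanned by [l]. Increments over distinct cells are independent, so
    complementary selections generate independent sigma-algebras. *)
Definition cell_rects (l : seq R) (I : pred nat) : set (set T) :=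
  [set A | exists2 E : nat -> set R, (forall i, measurable (E i)) &
     A = [set w | forall i, (i < (size (grid l)).-1)%N -> I i ->
       E i (incr (nth 0%R (grid l) i) (nth 0%R (grid l) i.+1) w)]].

Lemma cell_rects_measurable l I : cell_rects l I `<=` measurable.
Proof.
move=> _ [E mE ->].
rewrite (_ : mkset _ = \bigcap_i (if (i < (size (grid l)).-1)%N && I i then
  incr (nth 0%R (grid l) i) (nth 0%R (grid l) i.+1) @^-1` E i else setT)).
  apply: bigcapT_measurable => i; case: ifP => // _.
  exact: measurable_incr_pre.
apply/seteqP; split=> w /= h i.
  by move=> _; case: ifP => // /andP[]; exact: h.
by move=> iN Ii; have := h i Logic.I; rewrite iN Ii.
Qed.

Lemma cell_rects_setI l I : setI_closed (cell_rects l I).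
Proof.
move=> _ _ [E mE ->] [F mF ->]; exists (fun i => E i `&` F i).
  by move=> i; exact: measurableI.
apply/seteqP; split=> w /=; first by move=> [h1 h2] i iN Ii; split; [exact: h1|exact: h2].
by move=> h; split=> i iN Ii; have [] := h i iN Ii.
Qed.

Definition in01 (l : seq R) := forall x, x \in l -> 0 <= x <= 1.

Lemma cell_rects_prob l (I : pred nat) (E : nat -> set R) :
  in01 l -> (forall i, measurable (E i)) ->
  P [set w | forall i, (i < (size (grid l)).-1)%N -> I i ->
       E i (incr (nth 0%R (grid l) i) (nth 0%R (grid l) i.+1) w)] =
  (\prod_(i < (size (grid l)).-1) if I i then
      P (incr (nth 0%R (grid l) i) (nth 0%R (grid l) i.+1) @^-1` E i) else 1)%E.
Proof.
move=> l01 mE.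
have [s0|s0] := posnP (size (grid l)).
  rewrite s0/= big_ord0 (_ : mkset _ = setT) ?probability_setT//.
  by apply/seteqP; split.
have g01 i : (i < size (grid l))%N -> 0 <= nth 0%R (grid l) i <= 1.
  by move=> is_; apply: l01; rewrite -mem_grid mem_nth.
pose E' i := if I i then E i else setT.
rewrite (_ : mkset _ = [set w | forall i, (i < (size (grid l)).-1)%N ->
    E' i (incr (nth 0%R (grid l) i) (nth 0%R (grid l) i.+1) w)]); last first.
  apply/seteqP; split=> w /= h i iN; rewrite /E'.
    by case: ifP => // Ii; exact: h.
  by move=> Ii; have := h i iN; rewrite /E' Ii.
rewrite grid_prob//.
- by apply: eq_bigr => i _; rewrite /E'; case: (I i) => //; rewrite preimage_setT probability_setT.
- by have /andP[] := g01 0%N s0.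
- by have /andP[] := g01 (size (grid l)).-1 (eq_leq (prednK s0)).
- move=> i iN; apply: grid_le; rewrite leqnSn/=.
  by rewrite -(prednK s0) ltnS.
- by move=> i; rewrite /E'; case: ifP.
Qed.

Lemma cell_rects_indep l (I : pred nat) : in01 l ->
  forall E F, <<s cell_rects l I >> E -> <<s cell_rects l (predC I) >> F ->
  P (E `&` F) = (P E * P F)%E.
Proof.
move=> l01; apply: pi_indep; [exact: cell_rects_measurable|
  exact: cell_rects_measurable|exact: cell_rects_setI|exact: cell_rects_setI|].
move=> _ _ [E mE ->] [F mF ->].
rewrite !cell_rects_prob//.
pose EF i := if I i then E i else F i.
have mEF i : measurable (EF i) by rewrite /EF; case: ifP.
rewrite (_ : _ `&` _ = [set w | forall i, (i < (size (grid l)).-1)%N -> predT i ->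
       EF i (incr (nth 0%R (grid l) i) (nth 0%R (grid l) i.+1) w)]); last first.
  apply/seteqP; split=> w /=.
    move=> [h1 h2] i iN _; rewrite /EF; case: ifP => Ii; first exact: h1.
    by apply: h2 => //=; rewrite Ii.
  move=> h; split=> i iN Ii; have := h i iN isT; rewrite /EF; first by rewrite Ii.
  by rewrite (negbTE Ii).
rewrite cell_rects_prob// -big_split/=; apply: eq_bigr => i _.
by rewrite /EF; case: (I i); rewrite /= ?mule1 ?mul1e.
Qed.

Lemma incr_cell_measurable l (I : pred nat) s t E : measurable E ->
  s \in l -> t \in l -> s <= t ->
  (forall k, (index s (grid l) <= k < index t (grid l))%N -> I k) ->
  <<s cell_rects l I >> (incr s t @^-1` E).
Proof.
move=> mE sl tl st hI.
pose G : measurableType _ := g_sigma_algebraType (cell_rects l I).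
have mcell k : (index s (grid l) <= k < index t (grid l))%N ->
    measurable_fun setT (incr (nth 0%R (grid l) k) (nth 0%R (grid l) k.+1) : G -> R).
  move=> hk _ F mF; rewrite setTI; apply: sub_sigma_algebra.
  exists (fun i => if i == k then F else setT); first by move=> i; case: ifP.
  apply/seteqP; split=> w /=; first by move=> h i _ _; case: eqP => // ->.
  move=> /(_ k); rewrite eqxx; apply; last exact: hI.
  case/andP: hk => _ kt; apply: leq_trans kt _.
  rewrite -ltnS; apply: (@leq_trans (size (grid l))); last exact: leqSpred.
  by rewrite index_mem mem_grid.
(* The summands outside the range are replaced by 0, so that all of them are measurable for the
   sigma-algebra of the selected cells. *)
have mS : measurable_fun setT (fun w : G =>
    \sum_(index s (grid l) <= k < index t (grid l))
      (if (index s (grid l) <= k < index t (grid l))%N then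
       incr (nth 0%R (grid l) k) (nth 0%R (grid l) k.+1) w else 0)).
  apply: measurable_sum => k.
  case: (boolP (index s (grid l) <= k < index t (grid l))%N) => [|_].
    exact: mcell.
  exact: measurable_cst.
have := mS measurableT E mE; rewrite setTI; congr (<<s _ >> _).
apply/funext => w /=; congr (E _); rewrite (incr_grid _ sl tl st).
by apply: eq_big_nat => k ->.
Qed.

Definition incr_rects (D : R -> R -> Prop) : set (set T) :=
  [set A | exists m (s t : nat -> R) (E : nat -> set R),
     [/\ forall i, measurable (E i), forall i, (i < m)%N -> D (s i) (t i) &
       A = [set w | forall i, (i < m)%N -> E i (incr (s i) (t i) w)]]].

Lemma incr_rects_measurable D : incr_rects D `<=` measurable.
Proof.
move=> _ [m [s [t [E [mE _ ->]]]]].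
rewrite (_ : mkset _ = \bigcap_i (if (i < m)%N then incr (s i) (t i) @^-1` E i else setT)).
  by apply: bigcapT_measurable => i; case: ifP => // _; exact: measurable_incr_pre.
apply/seteqP; split=> w /= h i.
  by move=> _; case: ifP => //; exact: h.
by move=> im; have := h i I; rewrite im.
Qed.

Lemma incr_rects_setI D : setI_closed (incr_rects D).
Proof.
move=> _ _ [m [s [t [E [mE hD ->]]]]] [m' [s' [t' [E' [mE' hD' ->]]]]].
pose pick A (f g : nat -> A) i := if (i < m)%N then f i else g (i - m)%N.
exists (m + m')%N, (pick _ s s'), (pick _ t t'), (pick _ E E'); split.
- by move=> i; rewrite /pick; case: ifP.
- move=> i; rewrite /pick; case: (ltnP i m) => [im _|mi imm']; first exact: hD.
  by apply: hD'; rewrite ltn_subLR.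
- apply/seteqP; split=> w /=.
    move=> [h1 h2] i; rewrite /pick; case: (ltnP i m) => [im _|mi imm']; first exact: h1.
    by apply: h2; rewrite ltn_subLR.
  move=> h; split=> i im.
    by have := h i (leq_trans im (leq_addr _ _)); rewrite /pick im.
  have := h (m + i)%N; rewrite ltn_add2l => /(_ im).
  by rewrite /pick ltnNge leq_addr /= addKn.
Qed.

Definition inside (a b s t : R) : Prop := [/\ a <= s, s <= t & t <= b].

Definition outside (a b s t : R) : Prop :=
  [/\ 0 <= s, s <= t, t <= 1 & t <= a \/ b <= s].

(** Two finite families of increments live on one common grid, where each increment is a telescoping
    sum over cells. Those inside [[a, b]] and those outside use complementary sets of cells; a
    pi-system argument extends this to the generated sigma-algebras. *)
Lemma inside_outside_indep (a b : R) : 0 <= a -> b <= 1 ->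
  forall E F, <<s incr_rects (inside a b) >> E ->
    <<s incr_rects (outside a b) >> F -> P (E `&` F) = (P E * P F)%E.
Proof.
move=> a0 b1; apply: pi_indep; [exact: incr_rects_measurable|
  exact: incr_rects_measurable|exact: incr_rects_setI|exact: incr_rects_setI|].
move=> _ _ [m [s [t [E [mE hD ->]]]]] [m' [s' [t' [E' [mE' hD' ->]]]]].
pose l := mkseq s m ++ mkseq t m ++ mkseq s' m' ++ mkseq t' m'.
have memS i : (i < m)%N -> s i \in l.
  by move=> im; rewrite !mem_cat (_ : s i \in mkseq s m)//; apply/mapP; exists i; rewrite ?mem_iota.
have memT i : (i < m)%N -> t i \in l.
  by move=> im; rewrite !mem_cat (_ : t i \in mkseq t m) ?orbT//; apply/mapP; exists i; rewrite ?mem_iota.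
have memS' i : (i < m')%N -> s' i \in l.
  by move=> im; rewrite !mem_cat (_ : s' i \in mkseq s' m') ?orbT//; apply/mapP; exists i; rewrite ?mem_iota.
have memT' i : (i < m')%N -> t' i \in l.
  by move=> im; rewrite !mem_cat (_ : t' i \in mkseq t' m') ?orbT//; apply/mapP; exists i; rewrite ?mem_iota.
have l01 : in01 l.
  move=> x; rewrite !mem_cat => /or4P[] /mapP[i]; rewrite mem_iota add0n/= => im ->.
  - by have [? ? ?] := hD i im; apply/andP; split; lra.
  - by have [? ? ?] := hD i im; apply/andP; split; lra.
  - by have [? ? ? _] := hD' i im; apply/andP; split; lra.
  - by have [? ? ? _] := hD' i im; apply/andP; split; lra.
(* The points [a] and [b] themselves need not belong to the grid: a cell straddling one of them is
   used by neither family of increments. *)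
pose I k := (a <= nth 0%R (grid l) k) && (nth 0%R (grid l) k.+1 <= b).
have between x y k : x \in l -> y \in l ->
    (index x (grid l) <= k < index y (grid l))%N ->
    [/\ x <= nth 0%R (grid l) k, nth 0%R (grid l) k < nth 0%R (grid l) k.+1 &
      nth 0%R (grid l) k.+1 <= y].
  move=> xl yl /andP[xk ky].
  have ys : (index y (grid l) < size (grid l))%N by rewrite index_mem mem_grid.
  split.
  - rewrite -[leLHS](nth_index 0 (s := grid l)) ?mem_grid//.
    by apply: grid_le; rewrite xk (ltn_trans ky).
  - by apply: grid_lt; rewrite ltnSn (leq_ltn_trans ky).
  - rewrite -[leRHS](nth_index 0 (s := grid l)) ?mem_grid//.
    by apply: grid_le; rewrite ky.
have gen (J : pred nat) n (u v : nat -> R) (F : nat -> set R) :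
    (forall i, measurable (F i)) -> (forall i, (i < n)%N -> u i \in l) ->
    (forall i, (i < n)%N -> v i \in l) -> (forall i, (i < n)%N -> u i <= v i) ->
    (forall i k, (i < n)%N ->
      (index (u i) (grid l) <= k < index (v i) (grid l))%N -> J k) ->
    <<s cell_rects l J >> [set w | forall i, (i < n)%N -> F i (incr (u i) (v i) w)].
  move=> mF ul vl uv hJ.
  rewrite (_ : mkset _ = \bigcap_i (if (i < n)%N then incr (u i) (v i) @^-1` F i else setT)).
    apply: (@bigcapT_measurable _ (g_sigma_algebraType (cell_rects l J))) => i.
    case: ifP => // lin; apply: incr_cell_measurable => //.
    - exact: ul.
    - exact: vl.
    - exact: uv.
    - by move=> k; exact: hJ.
  apply/seteqP; split=> w /= h i.
    by move=> _; case: ifP => //; exact: h.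
  by move=> lin; have := h i Logic.I; rewrite lin.
apply: (@cell_rects_indep l I l01).
  apply: gen => //; first by move=> i /hD[].
  move=> i k im /(between _ _ _ (memS i im) (memT i im))[h1 h2 h3].
  by have [? ? ?] := hD i im; apply/andP; split; lra.
apply: gen => //; first by move=> i /hD'[].
move=> i k im /(between _ _ _ (memS' i im) (memT' i im))[h1 h2 h3].
have [_ _ _ h] := hD' i im; rewrite /I/= negb_and -!ltNge.
by case: h => h; apply/orP; [left|right]; lra.
Qed.

End independent_increments.

(** * Joint measurability and stationarity of windows *)

Section caratheodory.
Context (d : measure_display) (T : measurableType d) (R : realType).

(** By continuity in time, [B] is the pointwise limit of its values at the preceding point of a grid
    of mesh [n.+1%:R^-1]. This allows windows starting at a random time. *)
Lemma measurable_caratheodory (B : R -> T -> R) :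
  (forall t, measurable_fun setT (B t)) -> (forall w, continuous (B^~ w)) ->
  measurable_fun setT (fun p : R * T => B p.1 p.2).
Proof.
move=> mB cB.
pose g (n : nat) (p : R * T) : R :=
  B ((Num.floor (n.+1%:R * p.1))%:~R / n.+1%:R) p.2.
have mg n : measurable_fun setT (g n).
  move=> _ E mE; rewrite setTI.
  have n0 : (0 : R) < n.+1%:R by rewrite ltr0n.
  rewrite (_ : _ @^-1` E = \bigcup_(z : int)
    (`[z%:~R / n.+1%:R, (z + 1)%:~R / n.+1%:R[%classic `*`
     B (z%:~R / n.+1%:R) @^-1` E)); last first.
    apply/seteqP; split=> -[a w] /=.
      move=> h; exists (Num.floor (n.+1%:R * a)) => //=; split => //=.
      rewrite in_itv/= ler_pdivrMr// ltr_pdivlMr// mulrC.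
      exact: floor_itv.
    move=> [z _ /= [+ +]]; rewrite in_itv/= ler_pdivrMr// ltr_pdivlMr// mulrC.
    by move=> zE; rewrite /g/= (floor_def zE).
  apply: countable_bigcupT_measurable => // z.
  apply: measurableX; first exact: measurable_itv.
  by rewrite -[X in measurable X]setTI; exact: mB.
apply: (measurable_fun_cvg (h := g)) => // -[a w] _ /=.
pose u (n : nat) : R := (Num.floor (n.+1%:R * a))%:~R / n.+1%:R.
have ua : u @ \oo --> a.
  apply/cvgrPdist_lt => e e0; near=> n.
  have n0 : (0 : R) < n.+1%:R by rewrite ltr0n.
  have h1 : n.+1%:R^-1 < e by near: n; exact: near_infty_natSinv_lt (PosNum e0).
  have /andP[] := floor_itv (n.+1%:R * a); rewrite intrD => z1 z2.
  apply: le_lt_trans h1.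
  rewrite ger0_norm; first by rewrite lerBlDr -[X in X + _]mul1r -mulrDl
    ler_pdivlMr// mulrC addrC ltW.
  by rewrite subr_ge0 /u ler_pdivrMr// [leRHS]mulrC.
exact: (cvg_comp u (B^~ w) ua (cB w a)).
Unshelve. all: by end_near. Qed.

End caratheodory.

Section rescaled_path.
Context (d : measure_display) (T : measurableType d) (R : realType).
Variables (P : probability T R) (B : R -> T -> R).
Hypothesis mB : forall t, measurable_fun setT (B t).
Hypothesis cB : forall w, continuous (B^~ w).
Hypothesis indB : forall (n : nat) (t : nat -> R), 0 <= t 0%N -> t n <= 1 ->
  (forall i, (i < n)%N -> t i <= t i.+1) ->
  mutually_independent P (fun i : 'I_n => B (t i.+1) \- B (t i)).
Hypothesis statB : forall (s t s' t' : R) (E : set R), 0 <= s -> s <= t -> t <= 1 ->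
  0 <= s' -> s' <= t' -> t' <= 1 -> t - s = t' - s' -> measurable E ->
  P (incr B s t @^-1` E) = P (incr B s' t' @^-1` E).
Implicit Types (a b : R) (l : rat).

(** Subtracting the value at [a] leaves the minimizers in place and makes the window a function of
    the increments over [[a, a + l]], to which independence and stationarity apply. *)
Definition window a l (w : T) : seqS R :=
  path_of (fun t => if 0 <= t <= ratr l then incr B a (a + t) w else 0).

Lemma window_coord a l w k : window a l w k =
  oapp (fun q : rat => if 0 <= q <= l then incr B a (a + ratr q) w else 0) 0
    (choice.unpickle k).
Proof.
rewrite /window /path_of; case: choice.unpickle => //= q.
by rewrite ler0q ler_rat.
Qed.

Lemma measurable_window a l : measurable_fun setT (window a l).
Proof.
apply: measurable_seqP => k; under eq_fun do rewrite window_coord.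
case: (choice.unpickle k) => [q|] /=; last exact: measurable_cst.
case: (0 <= q <= l); [exact: measurable_incr|exact: measurable_cst].
Qed.

Lemma measurable_window2 l : measurable_fun setT (fun p : R * T => window p.1 l p.2).
Proof.
have mB2 := measurable_caratheodory mB cB.
apply: measurable_seqP => k; under eq_fun do rewrite window_coord.
case: (choice.unpickle k) => [q|] /=; last exact: measurable_cst.
case: (0 <= q <= l); last exact: measurable_cst.
apply: measurable_funB => //.
apply: (measurableT_comp mB2 (g := fun p : R * T => (p.1 + ratr q, p.2))).
apply: measurable_fun_pair => //=; apply: measurable_funD => //.
Qed.

Lemma window_generated (D : R -> R -> Prop) a l E :
  (forall t, 0 <= t <= ratr l -> D a (a + t)) -> measurable (E : set (seqS R)) ->
  <<s incr_rects B D >> (window a l @^-1` E).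
Proof.
move=> hD mE.
pose G : measurableType _ := g_sigma_algebraType (incr_rects B D).
have mW : measurable_fun setT (window a l : G -> seqS R).
  apply: measurable_seqP => k; under eq_fun do rewrite window_coord.
  case: (choice.unpickle k) => [q|] /=; last exact: measurable_cst.
  case: (boolP (0 <= q <= l)) => [hq|_]; last exact: measurable_cst.
  move=> _ F mF; rewrite setTI; apply: sub_sigma_algebra.
  exists 1%N, (fun=> a), (fun=> a + ratr q), (fun=> F); split => //.
    by move=> _ _; apply: hD; rewrite ler0q ler_rat.
  by apply/seteqP; split=> w /= h; [move=> _ _|exact: (h 0%N)].
by have := mW measurableT E mE; rewrite setTI.
Qed.

(** Finitely many coordinates of a window are partial sums ([phi]) of the increments over the cells
    of one grid of [[0, l]]; these are independent, and their laws depend on the lengths of the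
    cells only. *)
Lemma window_law a a' l E : 0 <= l -> 0 <= a -> a + ratr l <= 1 ->
  0 <= a' -> a' + ratr l <= 1 -> measurable (E : set (seqS R)) ->
  P (window a l @^-1` E) = P (window a' l @^-1` E).
Proof.
move=> l0 a0 a1 a'0 a'1; move: E.
apply: seq_law_unique; [exact: measurable_window|exact: measurable_window|].
move=> n E mE.
pose valid (k : nat) : bool :=
  if (choice.unpickle k : option rat) is Some q then 0 <= q <= l else false.
pose tm (k : nat) : R := oapp (ratr : rat -> R) 0 (choice.unpickle k : option rat).
pose ts : seq R := 0 :: [seq tm k | k <- iota 0 n & valid k].
pose N := (size (grid ts)).-1.
pose g k := nth 0 (grid ts) k.
have ts0l x : x \in ts -> 0 <= x <= ratr l.
  rewrite inE => /orP[/eqP->|/mapP[k]]; first by rewrite lexx ler0q.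
  rewrite mem_filter => /andP[+ _] ->; rewrite /valid /tm.
  by case: choice.unpickle => //= q /andP[q0 ql]; rewrite ler0q ler_rat q0.
have s0 : (0 < size (grid ts))%N.
  by rewrite lt0n size_eq0; apply/eqP => h; have := mem_grid ts 0; rewrite h mem_head.
have gts k : (k <= N)%N -> g k \in ts.
  by move=> kN; rewrite -mem_grid mem_nth// -(prednK s0) ltnS.
pose X b (w : T) : seqS R := fun i =>
  if (i < N)%N then incr B (b + g i) (b + g i.+1) w else 0.
have mX b : measurable_fun setT (X b).
  apply: measurable_seqP => i; rewrite /X; case: (i < N)%N.
    exact: measurable_incr.
  exact: measurable_cst.
have lawX : forall F, measurable (F : set (seqS R)) ->
    P (X a @^-1` F) = P (X a' @^-1` F).
  apply: seq_law_unique => // m F mF.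
  (* The coordinates of [X] from [N] on are constantly 0: a rectangle with a side excluding 0 there
     has empty preimages. *)
  have [h|h] := pselect (forall i, (N <= i < m)%N -> F i 0); last first.
    have e0 b : X b @^-1` rect m F = set0.
      apply/seteqP; split=> // w /= XF; apply: h => i /andP[Ni im].
      by have := XF i im; rewrite /X ltnNge Ni.
    by rewrite !e0.
  pose F' i := if (i < m)%N then F i else setT.
  have mF' i : measurable (F' i) by rewrite /F'; case: ifP.
  have eX b : X b @^-1` rect m F =
      [set w | forall i, (i < N)%N -> F' i (incr B (b + g i) (b + g i.+1) w)].
    apply/seteqP; split=> w /=.
      move=> XF i iN; rewrite /F'; case: ifP => // im.
      by have := XF i im; rewrite /X iN.
    move=> hF i im; rewrite /X; case: ltnP => iN; last by apply: h; rewrite iN.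
    by have := hF i iN; rewrite /F' im.
  have bnd1 b : 0 <= b -> b + ratr l <= 1 -> forall k, (k <= N)%N ->
      0 <= b + g k /\ b + g k <= 1.
    by move=> b0 b1 k /gts /ts0l/andP[g0 gl]; split; lra.
  have mono k : (k < N)%N -> g k <= g k.+1.
    by move=> kN; apply: grid_le; rewrite leqnSn/= -(prednK s0) ltnS.
  rewrite !eX.
  rewrite (grid_prob indB (n := N) (t := fun k => a + g k))//; first last.
  - by move=> i iN; rewrite lerD2l mono.
  - by have [] := bnd1 a a0 a1 N (leqnn N).
  - by have [] := bnd1 a a0 a1 0%N (leq0n N).
  rewrite (grid_prob indB (n := N) (t := fun k => a' + g k))//; first last.
  - by move=> i iN; rewrite lerD2l mono.
  - by have [] := bnd1 a' a'0 a'1 N (leqnn N).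
  - by have [] := bnd1 a' a'0 a'1 0%N (leq0n N).
  apply: eq_bigr => i _; apply: statB => //.
  - by have [] := bnd1 a a0 a1 i (ltnW (ltn_ord i)).
  - by rewrite lerD2l mono.
  - by have [] := bnd1 a a0 a1 i.+1 (ltn_ord i).
  - by have [] := bnd1 a' a'0 a'1 i (ltnW (ltn_ord i)).
  - by rewrite lerD2l mono.
  - by have [] := bnd1 a' a'0 a'1 i.+1 (ltn_ord i).
  - by ring.
pose phi (x : seqS R) : seqS R := fun k => if valid k then
  \sum_(index 0%R (grid ts) <= i < index (tm k) (grid ts)) x i else 0.
have mphi : measurable_fun setT phi.
  apply: measurable_seqP => k; rewrite /phi; case: (valid k); last exact: measurable_cst.
  by apply: measurable_sum => i; exact: measurable_coord.
have mpre : measurable (phi @^-1` rect n E).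
  by rewrite -[X in measurable X]setTI; apply: mphi => //; exact: measurable_rect.
have winE b : window b l @^-1` rect n E = X b @^-1` (phi @^-1` rect n E).
  have key w k : (k < n)%N -> window b l w k = phi (X b w) k.
    move=> kn; rewrite window_coord /phi.
    have hk : valid k -> tm k \in ts.
      move=> vk; rewrite inE map_f ?orbT// mem_filter vk mem_iota.
      by rewrite add0n leq0n kn.
    rewrite /valid /tm in hk *; case: (choice.unpickle k) hk => //= q hk.
    case: ifP => // q0l; have {}hk := hk q0l.
    have q0 : (0 : R) <= ratr q by rewrite ler0q; case/andP: q0l.
    rewrite (eq_big_nat _ _ (F2 := fun i => B (b + g i.+1) w - B (b + g i) w)).
      rewrite (telescope_sumr (fun i => B (b + g i) w)); last first.
        by apply: grid_index_le => //; rewrite mem_head.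
      by rewrite /g !nth_index ?mem_grid ?mem_head// addr0.
    move=> i /andP[_ iq]; rewrite /X ifT//.
    rewrite /N -ltnS prednK//; apply: leq_ltn_trans iq _.
    by rewrite index_mem mem_grid.
  by apply/seteqP; split=> w /= h k kn; have := h k kn; rewrite key.
by rewrite !winE; exact: lawX.
Qed.

End rescaled_path.

(** * Continuous versions *)

Section regular_version.
Context (d : measure_display) (T : measurableType d) (R : realType).
Variable P : probability T R.

Lemma prob_eq_off_null (A A' N : set T) : measurable A -> measurable A' ->
  measurable N -> P N = 0%E -> (forall w, ~ N w -> A w <-> A' w) -> P A = P A'.
Proof.
move=> mA mA' mN N0 h; rewrite -!Ex_indic//; congr EFin.
apply: (Ex_null _ _ mN N0); [exact: bmeas_indic|exact: bmeas_indic|].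
move=> w /h AA'; rewrite !indicE; congr ((nat_of_bool _)%:R).
by apply/idP/idP; rewrite !inE; apply AA'.
Qed.

Definition clamp01 (t : R) : R := Num.max 0 (Num.min 1 t).

Lemma clamp01_in t : 0 <= clamp01 t <= 1.
Proof.
by rewrite /clamp01 le_max lexx/= ge_max ler01/= ge_min lexx.
Qed.

Lemma clamp01_id t : 0 <= t <= 1 -> clamp01 t = t.
Proof. by move=> /andP[t0 t1]; rewrite /clamp01 min_r// max_r. Qed.

Lemma clamp01_lip s t : `|clamp01 s - clamp01 t| <= `|s - t|.
Proof.
wlog st : s t / t <= s.
  by move=> h; have [/h//|/ltW/h] := leP t s; rewrite distrC (distrC t).
rewrite ler_norml /clamp01 ger0_norm ?subr_ge0//.
have [hs|hs] := leP 1 s; have [ht|ht] := leP 1 t;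
  rewrite ?(max_r ler01); [|have [ht0|ht0] := leP 0 t| |
    have [ht0|ht0] := leP 0 t; have [hs0|hs0] := leP 0 s];
  by apply/andP; split; lra.
Qed.

Lemma continuous_clamp01 (f : R -> R) : {within `[0, 1], continuous f} ->
  continuous (f \o clamp01).
Proof.
move=> /subspace_continuousP cf t; apply/cvgrPdist_lt => e e0.
have /cf/cvgrPdist_lt/(_ e e0) : `[0, 1]%classic (clamp01 t).
  by rewrite /= in_itv/= clamp01_in.
rewrite near_withinE => /nbhs_ballP[dl /= dl0 h].
apply/nbhs_ballP; exists dl => //= y; rewrite /ball/= => ty.
apply: h; last by rewrite in_itv/= clamp01_in.
by rewrite /ball/=; apply: le_lt_trans (clamp01_lip _ _) ty.
Qed.

Lemma local_minimizers01_eq (b b' : R -> R) :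
  (forall t, 0 <= t <= 1 -> b t = b' t) ->
  local_minimizers01 b = local_minimizers01 b'.
Proof.
suff K (c c' : R -> R) : (forall t, 0 <= t <= 1 -> c t = c' t) ->
    local_minimizers01 c `<=` local_minimizers01 c'.
  move=> h; apply/seteqP; split; first exact: K.
  by apply: K => t t01; rewrite h.
move=> h s [/andP[s0 s1] [e [e0 he]]]; split; first by rewrite s0 s1.
exists (Num.min e (Num.min s (1 - s))); split.
  by rewrite !lt_min e0 s0 subr_gt0 s1.
have m1 : Num.min e (Num.min s (1 - s)) <= e by rewrite ge_min lexx.
have m2 : Num.min e (Num.min s (1 - s)) <= s by rewrite !ge_min lexx orbT.
have m3 : Num.min e (Num.min s (1 - s)) <= 1 - s by rewrite !ge_min lexx !orbT.
move: m1 m2 m3; move: (Num.min _ _) => m m1 m2 m3 t ht.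
have t01 : 0 <= t <= 1 by case: ht => /andP[? ?]; apply/andP; split; lra.
have s01 : 0 <= s <= 1 by apply/andP; split; lra.
rewrite -(h t t01) -(h s s01); apply: he.
by case: ht => /andP[? ?]; [left|right]; apply/andP; split; lra.
Qed.

(** The path is set to 0 on the null set of discontinuous paths and frozen outside [[0, 1]].
    Continuity then holds surely and on the whole line, as joint measurability in time and path
    requires. *)
Lemma brownian_regular_version (B : R -> {RV P >-> R}) : brownian_motion01 P B ->
  exists B' : R -> T -> R,
  [/\ (forall t, measurable_fun setT (B' t)),
      (forall w, continuous (B'^~ w)),
      (forall (n : nat) (t : nat -> R), 0 <= t 0%N -> t n <= 1 ->
        (forall i, (i < n)%N -> t i <= t i.+1) ->
        mutually_independent P (fun i : 'I_n => B' (t i.+1) \- B' (t i))),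
      (forall (s t s' t' : R) (E : set R), 0 <= s -> s <= t -> t <= 1 ->
        0 <= s' -> s' <= t' -> t' <= 1 -> t - s = t' - s' -> measurable E ->
        P (incr B' s t @^-1` E) = P (incr B' s' t' @^-1` E)) &
      {ae P, forall w, local_minimizers01 (fun t => B t w) =
         local_minimizers01 (fun t => B' t w)}].
Proof.
move=> [_ lawB indB [N [mN N0 hN]]].
pose B' (t : R) (w : T) : R := \1_(~` N) w * B (clamp01 t) w.
have B'E t w : 0 <= t <= 1 -> ~ N w -> B' t w = B t w.
  by move=> t01 Nw; rewrite /B' indicE mem_set// mul1r clamp01_id.
have mB' t : measurable_fun setT (B' t).
  apply: measurable_funM; first by apply: measurable_indic; exact: measurableC.
  exact: measurable_funP.
have mpre (f : T -> R) (E : set R) : measurable_fun setT f -> measurable E ->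
    measurable (f @^-1` E).
  by move=> mf mE; rewrite -[X in measurable X]setTI; exact: mf.
have mincr (C : R -> T -> R) s t : (forall u, measurable_fun setT (C u)) ->
    measurable_fun setT (C t \- C s).
  by move=> mC; exact: measurable_funB.
have mBt t : measurable_fun setT (B t) by exact: measurable_funP.
have incrE s t E : measurable E -> 0 <= s <= 1 -> 0 <= t <= 1 ->
    P ((B' t \- B' s) @^-1` E) = P ((B t \- B s) @^-1` E).
  move=> mE s01 t01; apply: (prob_eq_off_null _ _ mN N0).
  - by apply: mpre => //; exact: mincr.
  - by apply: mpre => //; exact: mincr.
  - by move=> w Nw /=; rewrite !B'E.
exists B'; split => //.
- move=> w; have [Nw|Nw] := pselect (N w).
    rewrite (_ : B'^~ w = fun=> 0); first by move=> t; exact: cvg_cst.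
    by apply/funext => t; rewrite /B' indicE memNset ?mul0r//; apply.
  rewrite (_ : B'^~ w = (fun t => B t w) \o clamp01).
    by apply: continuous_clamp01; apply: contrapT => h; apply: Nw; exact: hN.
  by apply/funext => t; rewrite /B' indicE mem_set// mul1r.
- move=> n t t0 tn tS J E mE.
  have t01 i : (i <= n)%N -> 0 <= t i <= 1.
    move=> lin; apply/andP; split.
      elim: i lin => // i IH lin; apply: le_trans (IH (ltnW lin)) _.
      exact: tS.
    have : t i <= t n; last by move=> /le_trans; apply.
    have : forall k, (i + k <= n)%N -> t i <= t (i + k)%N.
      elim=> [|k IH]; first by rewrite addn0.
      rewrite addnS => ik; apply: le_trans (IH (ltnW ik)) _; exact: tS.
    by move=> /(_ (n - i)%N); rewrite subnKC//; apply.
  have i01 (i : 'I_n) : (0 <= t i <= 1) /\ (0 <= t i.+1 <= 1).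
    by split; apply: t01; [exact: ltnW|exact: ltn_ord].
  transitivity (P (\bigcap_(i in [set` J]) ((B (t i.+1) \- B (t i)) @^-1` E i))).
    apply: (prob_eq_off_null _ _ mN N0).
    + by apply: fin_bigcap_measurable => // i _; apply: mpre => //; exact: mincr.
    + by apply: fin_bigcap_measurable => // i _; apply: mpre => //; exact: mincr.
    + move=> w Nw; split=> h i Ji; have := h i Ji => /=; have [? ?] := i01 i;
        by rewrite !B'E.
  rewrite (indB n t t0 tn tS J E mE); apply: eq_bigr => i _.
  by have [? ?] := i01 i; rewrite incrE.
- move=> s t s' t' E s0 st t1 s'0 s't' t'1 e mE.
  have in01s : 0 <= s <= 1 by apply/andP; split; lra.
  have in01t : 0 <= t <= 1 by apply/andP; split; lra.
  have in01s' : 0 <= s' <= 1 by apply/andP; split; lra.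
  have in01t' : 0 <= t' <= 1 by apply/andP; split; lra.
  (* The law of an increment is prescribed for [s < t]; when the times coincide, both increments
     vanish. *)
  have [st'|] := ltP s t; last first.
    move=> ts; have {}ts : s = t by apply/eqP; rewrite eq_le st ts.
    have ts' : s' = t' by lra.
    rewrite ts ts'; congr (P _); apply/seteqP; split=> w;
      by rewrite /incr /= !subrr.
  have st'' : s' < t' by lra.
  rewrite (incrE _ _ _ mE)// [RHS](incrE _ _ _ mE)//.
  apply: (etrans (lawB _ _ s0 st' t1 _ mE)).
  by rewrite e; apply: esym; exact: lawB.
- exists N; split => // w /= h; apply: contrapT => Nw; apply: h.
  by apply: local_minimizers01_eq => t t01; rewrite B'E.
Qed.

End regular_version.

(** * Minimizers in windows *)

Section minimizers_in_windows.
Context (d : measure_display) (T : measurableType d) (R : realType).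
Variable B : R -> T -> R.
Hypothesis cB : forall w, continuous (B^~ w).
Implicit Types (a s : R) (l p q : rat) (w : T).

Let increment_path a w (x : R) : R := B (a + x) w - B a w.

Let continuous_increment_path a w : continuous (increment_path a w).
Proof.
move=> x.
have ax : (fun y => a + y) @ x --> a + x.
  by apply: cvgD; [exact: cvg_cst|exact: cvg_id].
have Bax := cvg_comp (fun y => a + y) (B^~ w) ax (@cB w (a + x)).
exact: (cvgB Bax (cvg_cst (B a w))).
Qed.

Let windowE a l p q w t : 0 <= p -> q <= l -> p <= t <= q ->
  window B a l w (choice.pickle t) = increment_path a w (ratr t).
Proof.
move=> p0 ql /andP[pt tq]; rewrite window_coord choice.pickleK/=.
by rewrite (le_trans p0 pt) (le_trans tq ql).
Qed.

Lemma window_minimizer a l p q w : 0 <= a -> a + ratr l <= 1 ->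
  0 <= p -> p < q -> q <= l -> strict_min p q (window B a l w) ->
  local_minimizers01 (B^~ w) (a + argm p q (window B a l w)) /\
  a + ratr p < a + argm p q (window B a l w) < a + ratr q.
Proof.
move=> a0 al p0 pq ql sm.
have [/andP[h1 h2] h3] := strict_min_argm (@continuous_increment_path a w) pq
  (fun t => @windowE a l p q w t p0 ql) sm.
set m := argm p q _ in h1 h2 h3 *.
have p0' : 0 <= ratr p :> R by rewrite ler0q.
have ql' : ratr q <= ratr l :> R by rewrite ler_rat.
split; last by rewrite !ltrD2l h1 h2.
split; first by apply/andP; split; lra.
exists (Num.min (m - ratr p) (ratr q - m)); split.
  by rewrite lt_min !subr_gt0 h1 h2.
have m1 : Num.min (m - ratr p) (ratr q - m) <= m - ratr p by rewrite ge_min lexx.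
have m2 : Num.min (m - ratr p) (ratr q - m) <= ratr q - m by rewrite ge_min lexx orbT.
move: (Num.min _ _) m1 m2 => e m1 m2 t ht.
have tm : t - a != m.
  by case: ht => /andP[? ?]; [rewrite lt_eqF//|rewrite gt_eqF//]; lra.
have := h3 (t - a); rewrite /increment_path (addrC a (t - a)) subrK ltrD2r.
by apply => //; case: ht => /andP[? ?]; apply/andP; split; lra.
Qed.

(** The radius of the strict local minimum serves as [dl]: a rational interval shorter than it
    around [s] has [s] as its only minimizer. Thus each minimizer is reached through countably many
    measurable functionals. *)
Lemma minimizer_window w s : local_minimizers01 (B^~ w) s ->
  exists2 dl : R, 0 < dl & forall a l p q, 0 <= p -> p < q -> q <= l ->
    a + ratr p < s < a + ratr q -> ratr q - ratr p < dl ->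
    strict_min p q (window B a l w) /\ a + argm p q (window B a l w) = s.
Proof.
move=> [_ [e [e0 he]]]; exists e => // a l p q p0 pq ql /andP[ps sq] qpe.
have [] := @argm_of_strict _ (increment_path a w) p q (window B a l w) (s - a)
  (@continuous_increment_path a w) pq (fun t => @windowE a l p q w t p0 ql).
- by apply/andP; split; lra.
- move=> x /andP[px xq] xs.
  rewrite /increment_path (addrC a (s - a)) subrK ltrD2r; apply: he.
  have [xs'|xs'|xs'] := ltgtP x (s - a).
  + by left; apply/andP; split; lra.
  + by right; apply/andP; split; lra.
  + by move: xs; rewrite xs' eqxx.
by move=> h ->; split => //; rewrite addrC subrK.
Qed.

End minimizers_in_windows.

Section pick_min.
Variable R : realType.
Implicit Types (l p q : rat) (x : seqS R).

Definition subwindow l p q := [&& 0 <= p, p < q & q <= l].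

Definition has_min_code l (k : nat) : set (seqS R) :=
  if (choice.unpickle k : option (rat * rat)) is Some (p, q) then
    if subwindow l p q then strict_min p q else set0
  else set0.

Definition argm_code (k : nat) x : R :=
  if (choice.unpickle k : option (rat * rat)) is Some (p, q) then argm p q x
  else -1.

(** Which minimizer of the window is picked does not matter, only that one function of the recentred
    window serves for all positions: by stationarity the law of the pick relative to the start of
    the window is then always the same. *)
Definition pick_min l : seqS R -> R :=
  first_sel (has_min_code l) argm_code (fun=> -1).

Definition has_min l : set (seqS R) := \bigcup_k has_min_code l k.

Lemma measurable_has_min_code l k : measurable (has_min_code l k).
Proof.
rewrite /has_min_code; case: choice.unpickle => [[p q]|//].
by case: ifP => // _; exact: measurable_strict_min.
Qed.

Lemma measurable_has_min l : measurable (has_min l).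
Proof. by apply: bigcupT_measurable => k; exact: measurable_has_min_code. Qed.

Lemma measurable_pick_min l : measurable_fun setT (pick_min l).
Proof.
apply: measurable_first_sel; [exact: measurable_has_min_code| |exact: measurable_cst].
move=> k; rewrite /argm_code; case: (choice.unpickle k : option (rat * rat)) => [[p q]|].
  exact: measurable_argm.
exact: measurable_cst.
Qed.

Lemma has_minP l x : has_min l x <->
  exists p q, subwindow l p q /\ strict_min p q x.
Proof.
split.
  move=> [k _]; rewrite /has_min_code; case: choice.unpickle => // -[p q].
  by case: ifP => // h1 h2; exists p, q.
move=> [p [q [h1 h2]]]; exists (choice.pickle (p, q)); first exact: I.
by rewrite /has_min_code choice.pickleK h1.
Qed.

Lemma pick_minP l x : has_min l x ->
  exists p q, [/\ subwindow l p q, strict_min p q x & pick_min l x = argm p q x].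
Proof.
move=> [k _ hk]; rewrite /pick_min.
have [[k' [h1 _ ->]]|[h _]] :=
  first_selP (has_min_code l) argm_code (fun=> -1) x; last by have := h k hk.
move: h1; rewrite /has_min_code /argm_code.
case: choice.unpickle => // -[p q]; case: ifP => // h1 h2.
by exists p, q.
Qed.

End pick_min.

Lemma unit_fraction (R : realType) (n : nat) :
  ratr (n.+1%:R^-1) = n.+1%:R^-1 :> R.
Proof. by rewrite rmorphV ?unitfE ?pnatr_eq0//= ratr_nat. Qed.

Section brownian_minimizers.
Context (d : measure_display) (T : measurableType d) (R : realType).
Variables (P : probability T R) (B : R -> T -> R) (X : nat -> T -> R) (N : set T).
Hypothesis mB : forall t, measurable_fun setT (B t).
Hypothesis cB : forall w, continuous (B^~ w).
Hypothesis indB : forall (n : nat) (t : nat -> R), 0 <= t 0%N -> t n <= 1 ->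
  (forall i, (i < n)%N -> t i <= t i.+1) ->
  mutually_independent P (fun i : 'I_n => B (t i.+1) \- B (t i)).
Hypothesis statB : forall (s t s' t' : R) (E : set R), 0 <= s -> s <= t -> t <= 1 ->
  0 <= s' -> s' <= t' -> t' <= 1 -> t - s = t' - s' -> measurable E ->
  P (incr B s t @^-1` E) = P (incr B s' t' @^-1` E).
Hypothesis mX : forall k, measurable_fun setT (X k).
Hypothesis mN : measurable N.
Hypothesis N0 : P N = 0%E.
Hypothesis XM : forall w, ~ N w -> local_minimizers01 (B^~ w) = range (X^~ w).
Hypothesis Xinj : forall w, ~ N w -> injective (X^~ w).

Let mpre (f : T -> seqS R) E : measurable_fun setT f -> measurable E ->
  measurable (f @^-1` E).
Proof. by move=> mf mE; rewrite -[X in measurable X]setTI; exact: mf. Qed.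

(* As there are infinitely many minimizers and only [L] interior end points, one
   of the [L.+1] windows tiling [0, 1] contains a minimizer. These windows being
   independent copies of each other, the [L.+1]-st power of the probability
   below vanishes. *)
Lemma window_has_min (L : nat) (a : R) : 0 <= a -> a + L.+1%:R^-1 <= 1 ->
  P (window B a L.+1%:R^-1 @^-1` ~` has_min L.+1%:R^-1) = 0%E.
Proof.
move=> a0 a1.
set l : rat := L.+1%:R^-1.
have lE : ratr l = L.+1%:R^-1 :> R by exact: unit_fraction.
have l0 : 0 < l by rewrite invr_gt0 ltr0n.
have l0' : 0 < ratr l :> R by rewrite ltr0q.
have lL : ratr l * L.+1%:R = 1 :> R by rewrite lE mulVf// pnatr_eq0.
pose E (j : nat) := window B (j%:R * ratr l) l @^-1` ~` has_min l.
have mH : measurable (~` has_min l : set (seqS R)).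
  by apply: measurableC; exact: measurable_has_min.
have jl (j : nat) : (j < L.+1)%N -> 0 <= j%:R * ratr l :> R /\ j%:R * ratr l + ratr l <= 1 :> R.
  move=> jL; split; first by rewrite mulr_ge0// ltW.
  by rewrite -[X in _ + X <= _]mul1r -mulrDl natr1 -[leRHS]lL mulrC ler_pM2l// ler_nat.
have EP j : (j < L.+1)%N -> P (E j) = P (window B a l @^-1` ~` has_min l).
  move=> /jl[h1 h2]; apply: (window_law mB indB statB) => //; first exact: ltW.
  by rewrite lE.
set c := P _.
have prodE k : (k <= L.+1)%N -> P (\bigcap_(j in `I_k) E j) = (c ^+ k)%E.
  elim: k => [|k IH] kL; first by rewrite II0 bigcap_set0 probability_setT expe0.
  rewrite IIS bigcap_setU bigcap_set1 setIC.
  have [k0 k1] := jl k kL.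
  rewrite (inside_outside_indep mB indB k0 k1 (E := E k)).
  - by rewrite EP// IH 1?ltnW// expeS.
  - apply: (window_generated (D := inside (k%:R * ratr l) (k%:R * ratr l + ratr l))) => //.
    by move=> t /andP[t0 tl]; split; rewrite ?lerDl ?lerD2l.
  - apply: (@bigcap_measurableType _ (g_sigma_algebraType (incr_rects B
      (outside (k%:R * ratr l) (k%:R * ratr l + ratr l))))) => j jk.
    apply: (window_generated (D := outside (k%:R * ratr l) (k%:R * ratr l + ratr l))) => //.
    move=> t /andP[t0 tl]; have [j0 j1] := jl j (ltn_trans jk kL).
    split; rewrite ?lerDl//; first by rewrite (le_trans _ j1)// lerD2l.
    left; apply: (@le_trans _ _ (j%:R * ratr l + ratr l)); first by rewrite lerD2l.
    by rewrite -[X in _ + X <= _]mul1r -mulrDl natr1 ler_pM2r// ler_nat.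
have : P (\bigcap_(j in `I_L.+1) E j) = 0%E.
  apply/eqP; rewrite eq_le measure_ge0 andbT -N0; apply: le_measure.
  - by rewrite inE; apply: bigcap_measurableType => j _; apply: mpre => //; exact: measurable_window.
  - by rewrite inE.
  move=> w hw; apply: contrapT => Nw.
  have sub : range (X^~ w) `<=` (fun j : nat => j%:R * ratr l) @` `I_L.+2.
    rewrite -(XM Nw) => s Ms; apply: contrapT => hs.
    have /andP[s0 s1] := Ms.1.
    pose j := Num.truncn (s * L.+1%:R).
    have sL0 : 0 <= s * L.+1%:R by rewrite mulr_ge0// ltW.
    have /andP[j1 j2] := truncn_itv sL0.
    have jL : (j < L.+1)%N.
      rewrite -(ltr_nat R); apply: le_lt_trans j1 _.
      by rewrite gtr_pMl ?ltr0n.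
    have sE : s = s * L.+1%:R * ratr l by rewrite -mulrA (mulrC _ (ratr l)) lL mulr1.
    have js : j%:R * ratr l < s.
      rewrite lt_neqAle; apply/andP; split.
        by apply/eqP => js; apply: hs; exists j => //=; exact: ltn_trans jL _.
      by rewrite sE ler_pM2r.
    have sj : s < j%:R * ratr l + ratr l.
      by rewrite -[X in _ + X]mul1r -mulrDl natr1 {1}sE ltr_pM2r.
    have [dl dl0 hdl] := minimizer_window cB Ms.
    have /rat_in_itvoo[p] : Num.max 0 (s - j%:R * ratr l - dl / 2) < s - j%:R * ratr l.
      by rewrite gt_max; apply/andP; split; lra.
    rewrite in_itv/= gt_max => /andP[/andP[p0 pd] ps].
    have /rat_in_itvoo[q] : s - j%:R * ratr l < Num.min (ratr l) (s - j%:R * ratr l + dl / 2).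
      by rewrite lt_min; apply/andP; split; lra.
    rewrite in_itv/= lt_min => /andP[sq /andP[ql qd]].
    have p0' : 0 <= p by rewrite -(ler0q R) ltW.
    have pq : p < q by rewrite -(ltr_rat R); exact: lt_trans ps sq.
    have ql' : q <= l by rewrite -(ler_rat R) ltW.
    have h1 : j%:R * ratr l + ratr p < s < j%:R * ratr l + ratr q.
      by apply/andP; split; lra.
    have h2 : ratr q - ratr p < dl by lra.
    have [sm _] := hdl (j%:R * ratr l) l p q p0' pq ql' h1 h2.
    have := hw j jL; apply; apply/has_minP; exists p, q.
    by split => //; apply/and3P; split.
  have /(sub_finite_set sub) : finite_set ((fun j : nat => j%:R * ratr l : R) @` `I_L.+2).
    exact/finite_image/finite_II.
  have Xinj' : {in X^~ w @^-1` range (X^~ w) &, injective (X^~ w)}.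
    by move=> x y _ _; exact: Xinj.
  move=> /(finite_preimage Xinj'); rewrite preimage_range; exact: infinite_nat.
rewrite prodE// => /eqP.
by rewrite expe_eq0/= => /eqP.
Qed.

End brownian_minimizers.

(** * Candidates are nearly uniform *)

Lemma Ex_indep (d d1 d2 : measure_display) (T : measurableType d)
    (S1 : measurableType d1) (S2 : measurableType d2) (R : realType)
    (P : probability T R) (X : T -> S1) (Y : T -> S2) (f : S1 * S2 -> R) :
  measurable_fun setT X -> measurable_fun setT Y ->
  (forall E F, measurable E -> measurable F ->
    P (X @^-1` E `&` Y @^-1` F) = (P (X @^-1` E) * P (Y @^-1` F))%E) ->
  bmeas f ->
  Ex P (fun w => f (X w, Y w)) = Ex P (fun w => Ex P (fun w' => f (X w', Y w))).
Proof.
move=> mX mY ind hf.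
have mXY : measurable_fun setT (fun w => (X w, Y w)) by exact: measurable_fun_pair.
pose X' : {mfun T >-> S1} := mfun_Sub (mem_set mX : X \in mfun).
pose Y' : {mfun T >-> S2} := mfun_Sub (mem_set mY : Y \in mfun).
pose XY' : {mfun T >-> (S1 * S2)%type} := mfun_Sub (mem_set mXY : _ \in mfun).
rewrite -(Ex_distribution P XY' hf).
have -> : Ex (distribution P XY') f = Ex (distribution P X' \x distribution P Y')%E f.
  apply: EFin_inj; rewrite !ExE//; apply: eq_measure_integral => A mA _.
  have XYE E F : measurable E -> measurable F ->
      distribution P XY' (E `*` F) = (distribution P X' E * distribution P Y' F)%E.
    by move=> mE mF; exact: (ind E F mE mF).
  by rewrite [RHS](@product_measure_unique _ _ _ _ _ (distribution P X')
    (distribution P Y') (distribution P XY') XYE A mA).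
rewrite Ex_prodr// Ex_distribution.
  apply: Ex_ext => w; rewrite Ex_distribution//.
  exact: (bmeas_comp hf).
apply: (bmeas_Ex (f := fun y x => f (x, y)) (distribution P Y') (distribution P X')).
by apply: (bmeas_comp hf); exact: measurable_swap.
Qed.

(** The enumeration property holds off a single measurable null set [N], so that later arguments are
    pointwise there. *)
Record minima_setting (d : measure_display) (T : measurableType d) (R : realType)
    (P : probability T R) (B : R -> T -> R) (X : nat -> T -> R) (N : set T) : Prop := {
  ms_measB : forall t, measurable_fun setT (B t);
  ms_contB : forall w, continuous (B^~ w);
  ms_indB : forall (n : nat) (t : nat -> R), 0 <= t 0%N -> t n <= 1 ->
    (forall i, (i < n)%N -> t i <= t i.+1) ->
    mutually_independent P (fun i : 'I_n => B (t i.+1) \- B (t i));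
  ms_statB : forall (s t s' t' : R) (E : set R), 0 <= s -> s <= t -> t <= 1 ->
    0 <= s' -> s' <= t' -> t' <= 1 -> t - s = t' - s' -> measurable E ->
    P (incr B s t @^-1` E) = P (incr B s' t' @^-1` E);
  ms_measX : forall k, measurable_fun setT (X k);
  ms_X01 : forall k w, 0 < X k w < 1;
  ms_measN : measurable N;
  ms_N0 : P N = 0%E;
  ms_range : forall w, ~ N w -> local_minimizers01 (B^~ w) = range (X^~ w);
  ms_inj : forall w, ~ N w -> injective (X^~ w) }.

(* Pairwise disjoint small intervals. The minimizers of the path over them form a
   history that only involves the increments over these intervals, so that it is
   independent of the increments over a window lying outside of them. *)
Definition box : Type := seq (rat * rat).

Definition box_ok (R : realType) (e : R) (Q : box) : Prop :=
  (forall i, (i < size Q)%N -> let q := nth (0, 0) Q i in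
    [/\ 0 <= q.1, q.1 < q.2, q.2 <= 1 & ratr (q.2 - q.1) < e]) /\
  (forall i j, (i < size Q)%N -> (j < size Q)%N -> i != j ->
    (nth (0, 0) Q i).2 <= (nth (0, 0) Q j).1 \/
    (nth (0, 0) Q j).2 <= (nth (0, 0) Q i).1).

Section averaging.
Context (d : measure_display) (T : measurableType d) (R : realType).
Variables (P : probability T R) (B : R -> T -> R) (X : nat -> T -> R) (N : set T).
Hypothesis HS : minima_setting P B X N.
Local Notation U1 := (uniform01 R).
Let mB := ms_measB HS.
Let cB := ms_contB HS.
Let indB := ms_indB HS.
Let statB := ms_statB HS.

(** A unit fraction, as the tiling of [[0, 1]] in [window_has_min] requires, and rational because
    windows are coded by rational times. *)
Definition ell (L : nat) : rat := L.+1%:R^-1.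

Lemma ell_gt0 L : 0 < ell L. Proof. by rewrite invr_gt0 ltr0n. Qed.

(* For a uniform [a] independent of the path, a nearly uniform minimizer. *)
Definition cand L (a : R) (w : T) : R :=
  a + pick_min (ell L) (window B a (ell L) w).

Definition box_argmin (q : rat * rat) (w : T) : R :=
  ratr q.1 + argm 0 (q.2 - q.1) (window B (ratr q.1) (q.2 - q.1) w).

Definition box_argmins (Q : box) (w : T) : seqS R :=
  fun i => if (i < size Q)%N then box_argmin (nth (0, 0) Q i) w else 0.

Lemma measurable_box_argmin q : measurable_fun setT (box_argmin q).
Proof.
apply: measurable_funD; first exact: measurable_cst.
exact: (measurableT_comp (@measurable_argm R _ _) (measurable_window mB _ _)).
Qed.

Lemma measurable_box_argmins Q : measurable_fun setT (box_argmins Q).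
Proof.
apply: measurable_seqP => i; rewrite /box_argmins.
by case: (i < size Q)%N; [exact: measurable_box_argmin|exact: measurable_cst].
Qed.

Lemma measurable_cand2 L : measurable_fun setT (fun p : R * T => cand L p.1 p.2).
Proof.
apply: measurable_funD => //.
exact: (measurableT_comp (@measurable_pick_min R _) (measurable_window2 mB cB _)).
Qed.

Definition away L (Q : box) (a : R) : Prop :=
  [/\ 0 <= a, a + ratr (ell L) <= 1 & forall i, (i < size Q)%N ->
     ratr (nth (0, 0) Q i).2 <= a \/ a + ratr (ell L) <= ratr (nth (0, 0) Q i).1].

Lemma window_measurable_generated (D : R -> R -> Prop) a l :
  (forall t, 0 <= t <= ratr l -> D a (a + t)) ->
  measurable_fun setT (window B a l : g_sigma_algebraType (incr_rects B D) -> seqS R).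
Proof.
by move=> hD _ E mE; rewrite setTI; exact: window_generated.
Qed.

Lemma box_argmins_generated (e : R) L Q a : box_ok e Q -> away L Q a ->
  measurable_fun setT (box_argmins Q :
    g_sigma_algebraType (incr_rects B (outside a (a + ratr (ell L)))) -> seqS R).
Proof.
move=> [hQ _] [a0 a1 aQ]; apply: measurable_seqP => i; rewrite /box_argmins.
case: (ltnP i (size Q)) => iQ; last exact: measurable_cst.
apply: measurable_funD; first exact: measurable_cst.
apply: (measurableT_comp (@measurable_argm R _ _)).
apply: window_measurable_generated => t /andP[t0]; rewrite rmorphB/= => tl.
have [q0 q1 q2 _] := hQ i iQ; have qa := aQ i iQ.
move: q0 q2; rewrite -(ler0q R) -(ler_rat R) rmorph1 => q0 q2.
by split; [|lra|lra|case: qa => qa; [left|right]; lra].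
Qed.

Lemma window_box_indep (e : R) L Q a b : box_ok e Q -> away L Q a ->
  0 <= b -> b + ratr (ell L) <= 1 ->
  b + ratr (ell L) <= a \/ a + ratr (ell L) <= b ->
  forall f : seqS R * (seqS R * seqS R) -> R, bmeas f ->
  Ex P (fun w => f (window B a (ell L) w,
                    (box_argmins Q w, window B b (ell L) w))) =
  Ex P (fun w => Ex P (fun w' => f (window B a (ell L) w',
                    (box_argmins Q w, window B b (ell L) w)))).
Proof.
move=> hQ aQ b0 b1 ab f hf.
have [a0 a1 _] := aQ.
apply: (@Ex_indep _ _ _ _ _ _ _ P (window B a (ell L))
  (fun w => (box_argmins Q w, window B b (ell L) w))) => //.
- exact: measurable_window.
- by apply: measurable_fun_pair; [exact: measurable_box_argmins|exact: measurable_window].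
move=> E F mE mF; apply: (inside_outside_indep mB indB a0 a1).
  apply: window_generated => // t /andP[t0 tl].
  by split; rewrite ?lerDl ?lerD2l.
have mY : measurable_fun setT ((fun w => (box_argmins Q w, window B b (ell L) w)) :
    g_sigma_algebraType (incr_rects B (outside a (a + ratr (ell L)))) -> _).
  apply: measurable_fun_pair; first exact: (box_argmins_generated hQ aQ).
  apply: window_measurable_generated => t /andP[t0 tl].
  by split; [|lra|lra|case: ab => ab; [left|right]; lra].
by have := mY measurableT F mF; rewrite setTI.
Qed.

Section fixed_test_function.
Variables (L : nat) (F : seqS R * R -> R).
Hypothesis mF : measurable_fun setT F.
Hypothesis F01 : forall x, 0 <= F x <= 1.
Let bF : bmeas F := bmeas_01 mF F01.
Local Notation l := (ratr (ell L) : R).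

Let pick0 (w : T) : R := pick_min (ell L) (window B 0 (ell L) w).

Let measurable_pick0 : measurable_fun setT pick0.
Proof.
exact: (measurableT_comp (@measurable_pick_min R _) (measurable_window mB _ _)).
Qed.

(** The mean of [F (h, cand L a w)] over the path with [h] frozen: by stationarity the window at 0
    stands for the window at [a]. *)
Definition cand_mean (h : seqS R) (a : R) : R :=
  Ex P (fun w => F (h, a + pick0 w)).

Lemma measurable_shifted_test : measurable_fun setT
  (fun p : (seqS R * R) * T => F (p.1.1, p.1.2 + pick0 p.2)).
Proof.
apply: (measurableT_comp mF); apply: measurable_fun_pair => /=.
  exact: measurableT_comp.
apply: measurable_funD; first exact: measurableT_comp.
exact: measurableT_comp.
Qed.

Lemma bmeas_cand_mean : bmeas (fun p : seqS R * R => cand_mean p.1 p.2).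
Proof.
(* Fubini asks for some probability on the pairs [(h, a)]; the joint law of the window at 0 and of
   its pick serves. *)
apply: (bmeas_Ex (f := fun (p : seqS R * R) w => F (p.1, p.2 + pick0 w))
  (distribution P (mfun_Sub (mem_set (measurable_fun_pair
     (measurable_window mB 0 (ell L)) measurable_pick0) : _ \in mfun))) P).
by apply: bmeas_01; [exact: measurable_shifted_test|move=> x; exact: F01].
Qed.

Lemma cand_mean01 h a : 0 <= cand_mean h a <= 1.
Proof.
apply: Ex_01; last by move=> w; exact: F01.
apply: (measurableT_comp mF); apply: measurable_fun_pair => //.
by apply: measurable_funD.
Qed.

Definition centered (h : seqS R) (a y : R) : R := F (h, y) - cand_mean h a.

Lemma centered_le1 h a y : `|centered h a y| <= 1.
Proof.
rewrite /centered ler_norml.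
have /andP[? ?] := F01 (h, y); have /andP[? ?] := cand_mean01 h a.
by apply/andP; split; lra.
Qed.

Lemma bmeas_centered (d' : measure_display) (S : measurableType d')
    (h : S -> seqS R) (a y : S -> R) : measurable_fun setT h ->
  measurable_fun setT a -> measurable_fun setT y ->
  bmeas (fun s => centered (h s) (a s) (y s)).
Proof.
move=> mh ma my; apply: bmeasB.
  by apply: (bmeas_comp bF); exact: measurable_fun_pair.
by apply: (bmeas_comp bmeas_cand_mean (g := fun s => (h s, a s)));
  exact: measurable_fun_pair.
Qed.

Lemma centered_mean0 h a : 0 <= a -> a + l <= 1 ->
  Ex P (fun w => centered h a (cand L a w)) = 0.
Proof.
move=> a0 a1.
have l1 : l <= 1 by lra.
have mc : measurable_fun setT (cand L a).
  apply: measurable_funD => //.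
  exact: (measurableT_comp (@measurable_pick_min R _) (measurable_window mB _ _)).
rewrite ExB; last exact: bmeas_cst.
  rewrite Ex_cst /cand_mean; apply/eqP; rewrite subr_eq0; apply/eqP.
  apply: (@Ex_law _ _ _ _ _ _ _ P P (window B a (ell L)) (window B 0 (ell L))
    (fun x => F (h, a + pick_min (ell L) x))).
  - exact: measurable_window.
  - exact: measurable_window.
  - move=> E mE; apply: (window_law mB indB statB) => //.
    + by rewrite ltW ?ell_gt0.
    + by rewrite add0r.
  - apply: (bmeas_comp bF); apply: measurable_fun_pair => //.
    by apply: measurable_funD => //; exact: measurable_pick_min.
by apply: (bmeas_comp bF); exact: measurable_fun_pair.
Qed.

(** The window at [a] is independent of the boxes and of the window at [b] taken jointly.
    Integrating over it first, with the history frozen, kills the first factor. *)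
Lemma centered_orth (e : R) Q a b : box_ok e Q -> away L Q a -> away L Q b ->
  l <= `|a - b| ->
  Ex P (fun w => centered (box_argmins Q w) a (cand L a w) *
                 centered (box_argmins Q w) b (cand L b w)) = 0.
Proof.
move=> hQ aQ bQ; rewrite ler_normr => ab.
have [a0 a1 _] := aQ; have [b0 b1 _] := bQ.
pose f (x : seqS R * (seqS R * seqS R)) : R :=
  centered x.2.1 a (a + pick_min (ell L) x.1) *
  centered x.2.1 b (b + pick_min (ell L) x.2.2).
have mp21 : measurable_fun setT (fun x : seqS R * (seqS R * seqS R) => x.2.1).
  exact: measurableT_comp.
have mp22 : measurable_fun setT (fun x : seqS R * (seqS R * seqS R) => x.2.2).
  exact: measurableT_comp.
have hf : bmeas f.
  apply: bmeasM; apply: bmeas_centered => //.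
    apply: measurable_funD => //.
    exact: (measurableT_comp (@measurable_pick_min R _)).
  apply: measurable_funD => //.
  exact: (measurableT_comp (@measurable_pick_min R _) mp22).
rewrite (window_box_indep hQ aQ b0 b1 _ hf); last by case/orP: ab => ?; [left|right]; lra.
rewrite (@Ex_ext _ _ _ _ _ (fun=> 0)) ?Ex_cst// => w.
rewrite /f/=.
rewrite (@Ex_ext _ _ _ _ _ (fun w' =>
   centered (box_argmins Q w) b (cand L b w) *
   centered (box_argmins Q w) a (cand L a w'))); last by move=> w'; rewrite mulrC.
rewrite ExZ ?centered_mean0 ?mulr0//.
apply: bmeas_centered => //; apply: measurable_funD => //.
exact: (measurableT_comp (@measurable_pick_min R _) (measurable_window mB _ _)).
Qed.

End fixed_test_function.

End averaging.

Lemma Ex_uniform_le (R : realType) (f g : R -> R) : bmeas f -> bmeas g ->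
  (forall x, 0 <= f x) -> (forall x, 0 <= g x) ->
  (forall x, 0 <= x <= 1 -> f x <= g x) ->
  Ex (uniform01 R) f <= Ex (uniform01 R) g.
Proof.
move=> hf hg f0 g0 fg; rewrite -lee_fin !Ex_uniform01//.
apply: ge0_le_integral => //.
- by move=> x _; rewrite lee_fin.
- by apply/measurable_EFinP; apply: measurable_funTS; case: hf.
- by apply/measurable_EFinP; apply: measurable_funTS; case: hg.
Qed.

(** Plays the part of the Cauchy-Schwarz inequality: it turns a bound on a second moment into a
    bound on a mean absolute value. *)
Lemma norm_le_square (R : realFieldType) (x e : R) : 0 < e -> `|x| <= e + x * x / e.
Proof.
move=> e0; rewrite -lerBlDl ler_pdivlMr// mulrBl.
have -> : x * x = `|x| * `|x| by rewrite -normrM ger0_norm// -expr2 sqr_ge0.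
by nra.
Qed.

(** * Second moment of the average over window positions *)

Section second_moment.
Context (d : measure_display) (T : measurableType d) (R : realType).
Variables (P : probability T R) (B : R -> T -> R) (X : nat -> T -> R) (N : set T).
Hypothesis HS : minima_setting P B X N.
Local Notation U1 := (uniform01 R).
Variables (L : nat) (F : seqS R * R -> R).
Hypothesis mF : measurable_fun setT F.
Hypothesis F01 : forall x, 0 <= F x <= 1.
Local Notation l := (ratr (ell L) : R).
Local Notation centered := (centered P B L F).
Let l0 : 0 < l. Proof. by rewrite ltr0q ell_gt0. Qed.

Lemma measurable_away Q : measurable (away L Q : set R).
Proof.
rewrite (_ : away L Q = `[0%R, 1 - l]%classic `&` \bigcap_i
  (if (i < size Q)%N then
     `[ratr (nth (0, 0) Q i).2, +oo[%classic `|` `]-oo, ratr (nth (0, 0) Q i).1 - l]%classic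
   else setT)); last first.
  apply/seteqP; split=> a; rewrite /away/=.
    move=> [a0 a1 h]; split; first by rewrite in_itv/= a0 lerBrDr.
    move=> i _; case: ifP => // iQ /=; rewrite !in_itv/= andbT lerBrDr.
    by case: (h i iQ); [left|right].
  rewrite in_itv/= lerBrDr => -[/andP[a0 a1] h]; split => // i iQ.
  have := h i I; rewrite iQ /= !in_itv/= andbT lerBrDr.
  by case; [left|right].
apply: measurableI; first exact: measurable_itv.
apply: bigcapT_measurable => i; case: ifP => // _.
by apply: measurableU; exact: measurable_itv.
Qed.

Definition centered_away Q (w : T) (a : R) : R :=
  \1_(away L Q) a * centered (box_argmins B Q w) a (cand B L a w).

Lemma centered_away_le1 Q w a : `|centered_away Q w a| <= 1.
Proof.
rewrite /centered_away normrM mulr_ile1//; last exact: (centered_le1 HS).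
by rewrite indicE; case: (_ \in _); rewrite ?normr1 ?normr0.
Qed.

Lemma bmeas_centered_away (d' : measure_display) (S : measurableType d')
    (w : S -> T) (a : S -> R) Q : measurable_fun setT w -> measurable_fun setT a ->
  bmeas (fun s => centered_away Q (w s) (a s)).
Proof.
move=> mw ma; apply: bmeasM.
  apply: (bmeas_comp (bmeas_indic R (measurable_away Q)) ma).
apply: (bmeas_centered HS) => //.
  exact: (measurableT_comp (measurable_box_argmins HS Q) mw).
apply: (measurableT_comp (measurable_cand2 HS L) (g := fun s => (a s, w s))).
exact: measurable_fun_pair.
Qed.

Definition away_average Q (w : T) : R := Ex U1 (centered_away Q w).

Lemma bmeas_away_average Q : bmeas (away_average Q).
Proof.
apply: (bmeas_Ex (f := fun w a => centered_away Q w a) P U1).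
exact: bmeas_centered_away.
Qed.

Lemma centered_away_prod (e : R) Q a b : box_ok e Q ->
  Ex P (fun w => centered_away Q w a * centered_away Q w b) <=
  \1_[set p : R * R | `|p.1 - p.2| < l] (a, b).
Proof.
move=> hQ.
have hz : Ex P (fun w => centered_away Q w a * centered_away Q w b) = 0 ->
   Ex P (fun w => centered_away Q w a * centered_away Q w b) <=
   \1_[set p : R * R | `|p.1 - p.2| < l] (a, b).
  by move=> ->; rewrite indicE ler0n.
have bw c : bmeas (fun w => centered_away Q w c).
  by apply: bmeas_centered_away.
have z0 : (~ away L Q a \/ ~ away L Q b) ->
    Ex P (fun w => centered_away Q w a * centered_away Q w b) = 0.
  move=> h; rewrite -[RHS](Ex_cst P 0); apply: Ex_ext => w.
  rewrite /centered_away; case: h => h.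
    by rewrite [X in X * _ * _]indicE memNset ?mul0r.
  by rewrite [X in _ * (X * _)]indicE memNset ?mul0r ?mulr0.
have [aQ|aQ] := pselect (away L Q a); last by apply: hz; apply: z0; left.
have [bQ|bQ] := pselect (away L Q b); last by apply: hz; apply: z0; right.
have [ab|ab] := ltP `|a - b| l; last first.
  apply: hz; rewrite -(centered_orth HS mF F01 hQ aQ bQ ab).
  by apply: Ex_ext => w; rewrite /centered_away !indicE !mem_set// !mul1r.
rewrite indicE mem_set//= -[leRHS](Ex_cst P 1).
apply: Ex_le; [exact: bmeasM|exact: bmeas_cst|].
move=> w; rewrite (le_trans (ler_norm _))// normrM mulr_ile1//; exact: centered_away_le1.
Qed.

(* The windows at [a] and [b] are independent unless [a] and [b] are close, which
   leaves a set of pairs of area at most [l + l]. *)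
Lemma away_average_square (e : R) Q : box_ok e Q ->
  Ex P (fun w => away_average Q w * away_average Q w) <= l + l.
Proof.
move=> hQ.
have bw c : bmeas (centered_away Q c).
  by apply: bmeas_centered_away.
have b2 w : bmeas (fun p : R * R => centered_away Q w p.1 * centered_away Q w p.2).
  by apply: bmeasM; apply: bmeas_centered_away => //; exact: measurable_cst.
have b3 : bmeas (fun x : T * (R * R) =>
    centered_away Q x.1 x.2.1 * centered_away Q x.1 x.2.2).
  by apply: bmeasM; apply: bmeas_centered_away => //; exact: measurableT_comp.
rewrite (@Ex_ext _ _ _ _ _ (fun w => Ex (U1 \x U1)%E (fun p : R * R =>
    centered_away Q w p.1 * centered_away Q w p.2))); last first.
  move=> w; rewrite Ex_prod// -ExZ//; apply: Ex_ext => a /=.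
  by rewrite mulrC -ExZ.
rewrite (@Ex_swap _ _ _ _ _ P (U1 \x U1)%E
  (fun w p => centered_away Q w p.1 * centered_away Q w p.2))//.
have mS : measurable [set p : R * R | `|p.1 - p.2| < l].
  have mf : measurable_fun setT (fun p : R * R => `|p.1 - p.2| < l).
    apply: measurable_fun_ltr => //; apply: measurableT_comp => //.
    exact: measurable_funB.
  have := mf measurableT [set true] I.
  by rewrite setTI; congr measurable; apply/seteqP; split.
have bS : bmeas (\1_[set p : R * R | `|p.1 - p.2| < l] : R * R -> R).
  exact: bmeas_indic.
apply: (@le_trans _ _ (Ex (U1 \x U1)%E (\1_[set p : R * R | `|p.1 - p.2| < l]))).
  apply: Ex_le => //.
    apply: (bmeas_Ex (f := fun p w => centered_away Q w p.1 * centered_away Q w p.2)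
      (U1 \x U1)%E P).
    by apply: bmeasM; apply: bmeas_centered_away => //; exact: measurableT_comp.
  by move=> [a b]; exact: (centered_away_prod a b hQ).
have ba a : bmeas (fun b : R => \1_[set p : R * R | `|p.1 - p.2| < l] (a, b) : R).
  exact: (bmeas_comp bS (pair1_measurable a)).
rewrite Ex_prod// -[leRHS](Ex_cst U1 (l + l)); apply: Ex_le.
- apply: (bmeas_Ex (f := fun a b => \1_[set p : R * R | `|p.1 - p.2| < l] (a, b)) U1 U1).
  by rewrite [X in bmeas X](_ : _ = \1_[set p : R * R | `|p.1 - p.2| < l])//; apply/funext => -[].
- exact: bmeas_cst.
move=> a; rewrite (_ : l + l = (a + l) - (a - l)); last by ring.
apply: Ex_uniform_le_itv.
- by have := l0; lra.
- by have [] := ba a.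
- by move=> b; rewrite indicE; case: (_ \in _); rewrite ?lexx ?ler01.
- move=> b; rewrite indicE; case: (boolP (_ \in _)); last by rewrite eqxx.
  rewrite inE/= ltr_norml => /andP[? ?] _.
  by apply/andP; split; lra.
Qed.

Lemma away_average_norm (e : R) Q (t : R) : box_ok e Q -> 0 < t ->
  Ex P (fun w => `|away_average Q w|) <= t + (l + l) / t.
Proof.
move=> hQ t0; have bA := bmeas_away_average Q.
apply: (@le_trans _ _ (Ex P (fun w => t + t^-1 * (away_average Q w * away_average Q w)))).
  apply: Ex_le.
  - exact: bmeas_norm.
  - by apply: bmeasD; [exact: bmeas_cst|apply: bmeasM; [exact: bmeas_cst|exact: bmeasM]].
  - by move=> w; rewrite [t^-1 * _]mulrC; exact: norm_le_square.
rewrite ExD; [|exact: bmeas_cst|by apply: bmeasM; [exact: bmeas_cst|exact: bmeasM]].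
rewrite Ex_cst lerD2l ExZ; last exact: bmeasM.
by rewrite mulrC ler_pM2r ?invr_gt0//; exact: away_average_square hQ.
Qed.

Lemma Ex_not_away (e : R) Q : box_ok e Q -> 0 < e ->
  Ex U1 \1_(~` away L Q) <= l + (size Q)%:R * (e + l).
Proof.
move=> [hQ _] e0.
(* The positions [a] whose window can meet the [i]-th box: the box enlarged by [l] to the left, of
   length at most [e + l]. *)
pose J i : set R := `[ratr (nth (0, 0) Q i).1 - l, ratr (nth (0, 0) Q i).2]%classic.
have bJ i : bmeas (\1_(J i) : R -> R) by apply: bmeas_indic; exact: measurable_itv.
have b1 : bmeas (\1_`[1 - l, 1] : R -> R) by apply: bmeas_indic; exact: measurable_itv.
have bS : bmeas (fun a => \sum_(i <- iota 0 (size Q)) \1_(J i) a : R) by exact: bmeas_sum.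
apply: (@le_trans _ _ (Ex U1 (fun a => \1_`[1 - l, 1] a +
    \sum_(i <- iota 0 (size Q)) \1_(J i) a))).
  apply: Ex_uniform_le.
  - by apply: bmeas_indic; apply: measurableC; exact: measurable_away.
  - exact: bmeasD.
  - by move=> x; rewrite indicE.
  - by move=> x; rewrite addr_ge0// ?sumr_ge0// => *; rewrite indicE.
  move=> a /andP[a0 a1]; rewrite indicE; case: (boolP (_ \in _)) => [|_]; last first.
    by rewrite addr_ge0// ?sumr_ge0// => *; rewrite indicE.
  rewrite inE => na.
  have [al|al] := leP (1 - l) a.
    rewrite indicE mem_set//= ?in_itv/= ?al ?a1// lerDl.
    by rewrite sumr_ge0// => *; rewrite indicE.
  have [i iQ hi] : exists2 i, (i < size Q)%N & J i a.
    apply: contrapT => h; apply: na; split => //; first by lra.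
    move=> i iQ; apply: contrapT => /not_orP[/negP h1 /negP h2]; apply: h.
    exists i => //; rewrite /J/= in_itv/=; move: h1 h2; rewrite -!ltNge => h1 h2.
    by apply/andP; split; lra.
  rewrite (bigD1_seq i) ?iota_uniq ?mem_iota//= [X in _ + (X + _)]indicE mem_set//.
  rewrite addrCA lerDl addr_ge0 ?indicE// sumr_ge0// => *; by rewrite indicE.
rewrite ExD// Ex_sum//; apply: lerD.
  by apply: le_trans (Ex_uniform_itv _) _; have := l0; lra.
rewrite mulr_natl.
apply: (@le_trans _ _ (\sum_(i <- iota 0 (size Q)) (e + l))); last first.
  by rewrite big_const_seq count_predT size_iota iter_addr_0.
rewrite big_seq [leRHS]big_seq; apply: ler_sum => i; rewrite mem_iota add0n/= => iQ.
have [_ q1 _ q2] := hQ i iQ.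
have q1' : ratr (nth (0, 0) Q i).1 < ratr (nth (0, 0) Q i).2 :> R by rewrite ltr_rat.
apply: le_trans (Ex_uniform_itv _) _; first by have := l0; lra.
by move: q2; rewrite rmorphB/= => q2; lra.
Qed.

End second_moment.

Lemma common_radius (R : realFieldType) (n : nat) (A : nat -> R -> Prop) :
  (forall i r r', 0 < r' -> r' <= r -> A i r -> A i r') ->
  (forall i, (i < n)%N -> exists2 r, 0 < r & A i r) ->
  exists2 r, 0 < r & forall i, (i < n)%N -> A i r.
Proof.
move=> mono; elim: n => [|n IH] h; first by exists 1.
have [r r0 hr] := IH (fun i lin => h i (ltnW lin)).
have [r' r'0 hr'] := h n (ltnSn n).
have m0 : 0 < Num.min r r' by rewrite lt_min r0 r'0.
exists (Num.min r r') => // i; rewrite ltnS leq_eqVlt => /orP[/eqP->|lin].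
  by apply: mono hr' => //; rewrite ge_min lexx orbT.
by apply: mono (hr i lin) => //; rewrite ge_min lexx.
Qed.

(** * Capturing finitely many minimizers by boxes *)

Section covering.
Context (d : measure_display) (T : measurableType d) (R : realType).
Variables (P : probability T R) (B : R -> T -> R) (X : nat -> T -> R) (N : set T).
Hypothesis HS : minima_setting P B X N.
Variables (lam : probability (seqS R) R).
Local Notation Om := (T * seqS R)%type.
Local Notation Pr := (P \x lam)%E.
Let mB := ms_measB HS.
Let cB := ms_contB HS.

Definition lists_minima (n : nat) (f : Om -> seqS R) : Prop :=
  forall w u, ~ N w ->
    (forall i, (i < n)%N -> exists k, f (w, u) i = X k w) /\
    (forall i j, (i < n)%N -> (j < n)%N -> i != j -> f (w, u) i != f (w, u) j).

Definition captured n (f : Om -> seqS R) (Q : box) : set Om :=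
  [set o | size Q = n /\ forall i, (i < n)%N -> f o i = box_argmin B (nth (0, 0) Q i) o.1].

Lemma measurable_captured n f Q : measurable_fun setT f -> measurable (captured n f Q).
Proof.
move=> mf; rewrite /captured.
have [Qn|Qn] := eqVneq (size Q) n; last first.
  by rewrite (_ : mkset _ = set0)//; apply/seteqP; split=> // o [/eqP]; rewrite (negbTE Qn).
rewrite (_ : mkset _ = \bigcap_i (if (i < n)%N then
   [set o | f o i = box_argmin B (nth (0, 0) Q i) o.1] else setT)); last first.
  apply/seteqP; split=> o /=.
    by move=> [_ h] i _; case: ifP => //; exact: h.
  by move=> h; split => // i lin; have := h i I; rewrite lin.
apply: bigcapT_measurable => i; case: ifP => // _.
have m1 : measurable_fun setT (fun o : Om => f o i == box_argmin B (nth (0, 0) Q i) o.1).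
  apply: measurable_fun_eqr.
    exact: (measurableT_comp (@measurable_coord R i) mf).
  exact: (measurableT_comp (measurable_box_argmin HS _)).
have := m1 measurableT [set true] I; rewrite setTI; congr measurable.
by apply/seteqP; split=> o /=; [move/eqP|move=> ->; rewrite eqxx].
Qed.

(** Each listed minimizer is recognized by all sufficiently short rational intervals around it, and
    finitely many distinct points have a positive least distance. All requirements improve as the
    radius shrinks, so one radius suits all points. *)
Lemma captured_exists n f (e : R) w u : lists_minima n f -> 0 < e -> ~ N w ->
  exists Q, box_ok e Q /\ captured n f Q (w, u).
Proof.
move=> hf e0 Nw; have [fX fneq] := hf w u Nw.
pose s i := f (w, u) i.
pose A i (r : R) := [/\ r <= e, 0 <= s i - r, s i + r <= 1,
  (forall a l p q, 0 <= p -> p < q -> q <= l ->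
    a + ratr p < s i < a + ratr q -> ratr q - ratr p < r ->
    a + argm p q (window B a l w) = s i) &
  forall j, (j < n)%N -> i != j -> r <= `|s i - s j|].
have [|i lin|r r0 hr] := @common_radius R n A.
- move=> i r r' r'0 r'r [h1 h2 h3 h4 h5]; split; try lra.
    by move=> a l p q p0 pq ql hs hpq; apply: h4 => //; lra.
  by move=> j jn ij; apply: le_trans r'r _; exact: h5.
- have [k sk] := fX i lin.
  have Ms : local_minimizers01 (B^~ w) (s i).
    by rewrite (ms_range HS Nw) /s sk; exists k.
  have [/andP[s0 s1] _] := Ms.
  have [dl dl0 hdl] := minimizer_window cB Ms.
  have [r1 r10 hr1] : exists2 r1 : R, 0 < r1 &
      forall j, (j < n)%N -> i != j -> r1 <= `|s i - s j|.
    apply: (@common_radius R n (fun j r => i != j -> r <= `|s i - s j|)).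
      by move=> j r r' _ r'r h ij; apply: le_trans r'r _; exact: h.
    move=> j jn; have [->|ij] := eqVneq i j; first by exists 1 => //; rewrite eqxx.
    exists `|s i - s j| => //.
    by rewrite normr_gt0 subr_eq0; exact: fneq.
  pose m := Num.min e (Num.min (s i) (Num.min (1 - s i) (Num.min dl r1))).
  have m0 : 0 < m by rewrite !lt_min e0 s0 subr_gt0 s1 dl0 r10.
  have m1 : m <= e by rewrite /m ge_min lexx.
  have m2 : m <= s i by rewrite /m !ge_min lexx orbT.
  have m3 : m <= 1 - s i by rewrite /m !ge_min lexx !orbT.
  have m4 : m <= dl by rewrite /m !ge_min lexx !orbT.
  have m5 : m <= r1 by rewrite /m !ge_min lexx !orbT.
  exists m => //; split => //; try lra.
    move=> a l p q p0 pq ql hs hpq.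
    by have [] := hdl a l p q p0 pq ql hs (lt_le_trans hpq m4).
  by move=> j jn ij; apply: le_trans m5 _; exact: hr1.
(* End points within [r / 2] of the points give boxes shorter than [r], and disjoint ones since
   distinct points are at least [r] apart. *)
have /choice[c hc] : forall i, exists c : rat, s i - r / 2 < ratr c < s i.
  move=> i; have /rat_in_itvoo[c] : s i - r / 2 < s i by lra.
  by rewrite in_itv/= => hc; exists c.
have /choice[c' hc'] : forall i, exists c : rat, s i < ratr c < s i + r / 2.
  move=> i; have /rat_in_itvoo[c'] : s i < s i + r / 2 by lra.
  by rewrite in_itv/= => hc'; exists c'.
exists (mkseq (fun i => (c i, c' i)) n).
have sQ : size (mkseq (fun i => (c i, c' i)) n) = n by rewrite size_mkseq.
split; last first.
  split => // i lin; rewrite nth_mkseq// /box_argmin/=.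
  have [h1 h2 h3 h4 _] := hr i lin.
  have /andP[? ?] := hc i; have /andP[? ?] := hc' i.
  have cc' : c i < c' i by rewrite -(ltr_rat R); lra.
  symmetry; apply: h4 => //; rewrite ?subr_gt0// rmorph0 rmorphB/=; last by lra.
  by apply/andP; split; lra.
split; rewrite sQ.
  move=> i lin; rewrite nth_mkseq//=.
  have [h1 h2 h3 h4 _] := hr i lin.
  have /andP[? ?] := hc i; have /andP[? ?] := hc' i.
  split.
  - by rewrite -(ler0q R); lra.
  - by rewrite -(ltr_rat R); lra.
  - by rewrite -(ler_rat R) rmorph1; lra.
  - by rewrite rmorphB/=; lra.
move=> i j lin ljn ij; rewrite !nth_mkseq//=.
have [h1 h2 h3 h4 h5] := hr i lin; have := h5 j ljn ij.
have /andP[? ?] := hc i; have /andP[? ?] := hc' i.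
have /andP[? ?] := hc j; have /andP[? ?] := hc' j.
by rewrite ler_normr => /orP[h|h]; [right|left]; rewrite -(ler_rat R); lra.
Qed.

Lemma prob_null_fiber (E : set Om) : measurable E ->
  (forall o, E o -> N o.1) -> Ex Pr \1_E = 0.
Proof.
move=> mE h; apply: EFin_inj; rewrite Ex_indic//.
apply/eqP; rewrite eq_le measure_ge0 andbT.
have mNT : measurable (N `*` [set: seqS R]).
  by apply: measurableX => //; exact: (ms_measN HS).
apply: (@le_trans _ _ ((P \x lam)%E (N `*` setT))).
  by apply: le_measure; rewrite ?inE// => o /h.
have h0 : (P \x lam)%E (N `*` [set: seqS R]) = (P N * lam setT)%E.
  by apply: product_measure1E => //; exact: (ms_measN HS).
by rewrite [leLHS]h0 (ms_N0 HS) mul0e.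
Qed.

(** Boxes have rational ends, hence are countably many; off [N] some box captures the list, and
    continuity from above leaves finitely many of them. The exceptional event depends on the
    auxiliary randomness as well, like the list. *)
Lemma finite_cover n f (e dl : R) : measurable_fun setT f -> lists_minima n f ->
  0 < e -> 0 < dl ->
  exists2 Qs : seq box, (forall Q, Q \in Qs -> box_ok e Q /\ size Q = n) &
    measurable [set o : Om | forall Q, Q \in Qs -> ~ captured n f Q o] /\
    Ex Pr \1_[set o : Om | forall Q, Q \in Qs -> ~ captured n f Q o] < dl.
Proof.
move=> mf hf e0 dl0.
pose F (k : nat) : set Om := if (choice.unpickle k : option box) is Some Q then
  if `[< box_ok e Q /\ size Q = n >] then captured n f Q else set0 else set0.
have mF k : measurable (F k).
  rewrite /F; case: choice.unpickle => [Q|//]; case: ifP => // _.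
  exact: measurable_captured.
have [K hK] := prob_bigcup_tail Pr mF dl0.
pose Qs := [seq Q <- pmap (choice.unpickle : nat -> option box) (iota 0 K) |
  `[< box_ok e Q /\ size Q = n >] ].
have memQs Q : Q \in Qs -> exists2 k, (k < K)%N & F k = captured n f Q.
  rewrite mem_filter mem_pmap => /andP[h1 /mapP[k]]; rewrite mem_iota add0n/= => kK kQ.
  by exists k => //; rewrite /F -kQ h1.
pose E : set Om := [set o : Om | forall Q, Q \in Qs -> ~ captured n f Q o].
have mE : measurable E.
  rewrite (_ : E = \bigcap_(k in `I_K) ~` F k).
    by apply: bigcap_measurableType => k _; exact: measurableC.
  apply/seteqP; split=> o /= h k.
    move=> kK; rewrite /F; case kQ : choice.unpickle => [Q|//].
    case: ifP => [hQ|_ //]; apply: h; rewrite mem_filter hQ/= mem_pmap -kQ.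
    by apply: map_f; rewrite mem_iota.
  by move=> /memQs[k' k'K <-]; exact: h.
exists Qs => [Q|]; first by rewrite mem_filter => /andP[/asboolP].
split=> //.
apply: le_lt_trans (hK K (leqnn K)).
have mD : measurable (\bigcup_k F k `\` \bigcup_(k in `I_K) F k).
  apply: measurableD; first exact: bigcupT_measurable.
  by apply: bigcup_measurable => k _.
have mM : measurable (E `&` [set o | N o.1]).
  apply: measurableI => //; rewrite (_ : mkset _ = N `*` setT).
    by apply: measurableX => //; exact: (ms_measN HS).
  by apply/seteqP; split=> -[w u] //= [].
rewrite -[leRHS]addr0 -(prob_null_fiber mM); last by move=> o [].
rewrite -ExD; [|exact: bmeas_indic|exact: bmeas_indic].
apply: Ex_le; [exact: bmeas_indic|by apply: bmeasD; exact: bmeas_indic|].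
move=> o; rewrite indicE; case: (boolP (_ \in _)) => [|_]; last first.
  by rewrite addr_ge0 ?indicE.
rewrite inE => Eo.
have [No|No] := pselect (N o.1).
  have EN : (E `&` [set o | N o.1]) o by split.
  by rewrite [X in _ + X]indicE (mem_set EN) lerDr indicE.
rewrite [X in X + _]indicE mem_set ?lerDl ?indicE//.
split.
  case: o Eo No => w u Eo No.
  have [Q [hQ cQ]] := captured_exists u hf e0 No.
  exists (choice.pickle Q); first exact: I.
  rewrite /F choice.pickleK ifT//; apply/asboolP; split=> //.
  by case: cQ.
move=> [k /= kK]; rewrite /F; case kQ : choice.unpickle => [Q|//].
case: ifP => [hQ|_ //]; apply: Eo; rewrite mem_filter hQ/= mem_pmap -kQ.
by apply: map_f; rewrite mem_iota.
Qed.

End covering.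

(** * Comparison of a candidate with a uniform point *)

Section candidate_law.
Context (d : measure_display) (T : measurableType d) (R : realType).
Variables (P : probability T R) (B : R -> T -> R) (X : nat -> T -> R) (N : set T).
Hypothesis HS : minima_setting P B X N.
Variables (lam : probability (seqS R) R).
Local Notation Om := (T * seqS R)%type.
Local Notation Pr := (P \x lam)%E.
Local Notation U1 := (uniform01 R).
Let mB := ms_measB HS.
Let cB := ms_contB HS.

Lemma ell_le1 L : ratr (ell L) <= 1 :> R.
Proof. by rewrite unit_fraction invf_le1// ler1n. Qed.

Lemma ell_gt0R L : 0 < ratr (ell L) :> R.
Proof. by rewrite ltr0q ell_gt0. Qed.

Lemma exists_ell (e : R) : 0 < e -> exists L, ratr (ell L) <= e.
Proof.
move=> e0; have /cvgrPdist_lt/(_ e e0)[n _ /(_ n (leqnn n))] := @cvg_harmonic R.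
rewrite sub0r normrN ger0_norm ?invr_ge0//= => hn.
by exists n; rewrite unit_fraction ltW.
Qed.

Lemma cand_bounds L a w : 0 <= a -> a + ratr (ell L) <= 1 ->
  has_min (ell L) (window B a (ell L) w) ->
  a <= cand B L a w <= a + ratr (ell L) /\
  local_minimizers01 (B^~ w) (cand B L a w).
Proof.
move=> a0 a1 /pick_minP[p [q [/and3P[p0 pq ql] sm hp]]].
have [h1 /andP[h2 h3]] := window_minimizer cB a0 a1 p0 pq ql sm.
rewrite /cand hp; split => //.
move: p0 ql; rewrite -(ler0q R) -(ler_rat R) => p0 ql.
by apply/andP; split; lra.
Qed.

Lemma prob_no_min L a : 0 <= a -> a + ratr (ell L) <= 1 ->
  P (window B a (ell L) @^-1` ~` has_min (ell L)) = 0%E.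
Proof.
move=> a0; rewrite unit_fraction => a1.
exact: (window_has_min mB cB (ms_indB HS) (ms_statB HS) (ms_measN HS) (ms_N0 HS)
  (ms_range HS) (ms_inj HS)).
Qed.

Lemma measurable_no_min L a :
  measurable (window B a (ell L) @^-1` ~` has_min (ell L)).
Proof.
rewrite -[X in measurable X]setTI; apply: (measurable_window mB) => //.
by apply: measurableC; exact: measurable_has_min.
Qed.

(** After exchanging the integrals, for almost every path the point is a uniform variable shifted by
    an amount between 0 and the window length. *)
Lemma Ex_cand_mean L (F : seqS R * R -> R) h : measurable_fun setT F ->
  (forall x, 0 <= F x <= 1) ->
  Ex U1 (cand_mean P B L F h) <= Ex U1 (fun y => F (h, y)) + ratr (ell L).
Proof.
move=> mF F01.
have bF := bmeas_01 mF F01.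
set l : R := ratr (ell L).
pose pick0 w : R := pick_min (ell L) (window B 0 (ell L) w).
have mpick0 : measurable_fun setT pick0.
  exact: (measurableT_comp (@measurable_pick_min R _) (measurable_window mB _ _)).
pose N1 := window B 0 (ell L) @^-1` ~` has_min (ell L).
have mN1 : measurable N1 by exact: measurable_no_min.
have N10 : P N1 = 0%E by apply: prob_no_min; rewrite ?add0r ?ell_le1.
have b2 : bmeas (fun p : R * T => F (h, p.1 + pick0 p.2)).
  apply: (bmeas_comp bF); apply: measurable_fun_pair => //.
  by apply: measurable_funD => //; exact: measurableT_comp.
have Fh y : 0 <= F (h, y) <= 1 by exact: F01.
have mFh : measurable_fun setT (fun y => F (h, y)).
  exact: (measurableT_comp mF (pair1_measurable h)).
have b3 : bmeas (\1_N1 : T -> R) by exact: bmeas_indic.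
rewrite /cand_mean (@Ex_swap _ _ _ _ _ U1 P (fun a w => F (h, a + pick0 w)))//.
apply: (@le_trans _ _ (Ex P (fun w => (Ex U1 (fun y => F (h, y)) + l) + \1_N1 w))).
  apply: Ex_le.
  - apply: (bmeas_Ex (f := fun w a => F (h, a + pick0 w)) P U1).
    exact: (bmeas_comp b2 (@measurable_swap _ _ T R)).
  - by apply: bmeasD => //; exact: bmeas_cst.
  move=> w; have [wN1|wN1] := pselect (N1 w).
    rewrite [\1_N1 w]indicE mem_set//=.
    have /andP[E0 _] : 0 <= Ex U1 (fun y => F (h, y)) <= 1 by exact: Ex_01.
    have /andP[_ E1] : 0 <= Ex U1 (fun a => F (h, a + pick0 w)) <= 1.
      apply: Ex_01 => //; case: b2 => mb2 _.
      exact: (measurableT_comp mb2 (pair2_measurable w)).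
    apply: le_trans E1 _; rewrite lerDr addr_ge0// ltW//; exact: ell_gt0R.
  rewrite [\1_N1 w]indicE memNset// addr0.
  have hm : has_min (ell L) (window B 0 (ell L) w) by apply: contrapT.
  have l1 : 0 + ratr (ell L) <= 1 :> R by rewrite add0r ell_le1.
  have [/andP[h1 h2] _] := cand_bounds (lexx 0) l1 hm.
  rewrite /cand !add0r in h1 h2.
  by apply: le_trans (Ex_uniform_shift_le h1 mFh Fh) _; rewrite lerD2l.
rewrite ExD//; last exact: bmeas_cst.
rewrite Ex_cst (_ : Ex P \1_N1 = 0) ?addr0//.
by apply: EFin_inj; rewrite Ex_indic.
Qed.

(** Only the first [n] coordinates of a list are meaningful; with zeros behind, the list equals
    [box_argmins] as a sequence wherever it is captured. *)
Definition trunc n (h : seqS R) : seqS R := fun i => if (i < n)%N then h i else 0.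

Lemma measurable_trunc n : measurable_fun setT (trunc n).
Proof.
apply: measurable_seqP => i; rewrite /trunc.
by case: (i < n)%N; [exact: measurable_coord|exact: measurable_cst].
Qed.

(** [F] is split into its mean over the path with history and position frozen, handled by
    [Ex_cand_mean], and a centred part. On a captured list the centred part is at most an
    [away_average] plus the measure of the positions whose window meets a box or leaves [[0, 1]]. *)
Lemma cand_uniform n (f : Om -> seqS R) (dl : R) : measurable_fun setT f ->
  lists_minima X N n f -> 0 < dl ->
  exists L, ratr (ell L) <= dl /\
  forall F : seqS R * R -> R, measurable_fun setT F -> (forall x, 0 <= F x <= 1) ->
  Ex Pr (fun o => Ex U1 (fun a => F (trunc n (f o), cand B L a o.1))) <=
  Ex Pr (fun o => Ex U1 (fun y => F (trunc n (f o), y))) + dl.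
Proof.
move=> mf hf dl0.
(* The centred part takes six shares: the uncaptured event, [l], [n%:R * e], [n%:R * l], and twice
   [r * t]. One more pays for the [l] of [Ex_cand_mean]. *)
pose t0 := dl / 8.
have t00 : 0 < t0 by rewrite divr_gt0.
have n0 : 0 < n.+1%:R :> R by rewrite ltr0n.
pose e := t0 / n.+1%:R.
have e0 : 0 < e by rewrite divr_gt0.
have ne : n%:R * e <= t0.
  rewrite /e mulrCA -[leRHS]mulr1 ler_pM2l// ler_pdivrMr// mul1r ler_nat.
  exact: leqnSn.
have [Qs hQs [mE hE]] := finite_cover HS lam mf hf e0 t00.
set E := [set o : Om | _] in mE hE.
pose r : R := (size Qs)%:R.
have r0 : 0 <= r by rewrite ler0n.
pose t := t0 / (r + 1).
have tpos : 0 < t by rewrite divr_gt0// ltr_wpDl.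
have rt : r * t <= t0.
  rewrite /t mulrCA -[leRHS]mulr1 ler_pM2l// ler_pdivrMr ?ltr_wpDl//.
  by rewrite mul1r lerDl.
(* The bound [t * t / 2] makes each [away_average] at most [t + t] in mean; [t] already accounts for
   the number of boxes in [Qs]. *)
have [L hL] : exists L, ratr (ell L) <= Num.min e (t * t / 2).
  by apply: exists_ell; rewrite lt_min e0 divr_gt0// mulr_gt0.
set l : R := ratr (ell L) in hL.
have l0 : 0 < l by exact: ell_gt0R.
have le_ : l <= e by apply: le_trans hL _; rewrite ge_min lexx.
have lt_ : l <= t * t / 2 by apply: le_trans hL _; rewrite ge_min lexx orbT.
have et0 : e <= t0.
  by rewrite /e ler_pdivrMr// -[leLHS]mulr1 ler_pM2l// ler1n.
have nl : n%:R * l <= t0 by apply: le_trans ne; rewrite ler_wpM2l.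
have llt : (l + l) / t <= t by rewrite ler_pdivrMr//; lra.
exists L; split; first by rewrite -/l; rewrite /t0 in et0; lra.
move=> F mF F01.
have bF := bmeas_01 mF F01.
have mtf : measurable_fun setT (fun o => trunc n (f o)).
  exact: (measurableT_comp (measurable_trunc n) mf).
have mtf1 : measurable_fun setT (fun p : Om * R => trunc n (f p.1)).
  exact: (measurableT_comp mtf).
have mc : measurable_fun setT (fun p : Om * R => cand B L p.2 p.1.1).
  apply: (measurableT_comp (measurable_cand2 HS L) (g := fun p : Om * R => (p.2, p.1.1))).
  by apply: measurable_fun_pair => //; exact: measurableT_comp.
pose D o := Ex U1 (fun a => centered P B L F (trunc n (f o)) a (cand B L a o.1)).
have bD : bmeas D.
  apply: (bmeas_Ex (f := fun o a => centered P B L F (trunc n (f o)) a (cand B L a o.1)) Pr U1).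
  by apply: (bmeas_centered HS).
have bcm o : bmeas (fun a => cand_mean P B L F (trunc n (f o)) a).
  exact: (bmeas_comp (bmeas_cand_mean HS L mF F01) (pair1_measurable (trunc n (f o)))).
have mco o : measurable_fun setT (fun a => cand B L a o.1).
  exact: (measurableT_comp (measurable_cand2 HS L) (pair2_measurable o.1)).
have bco o : bmeas (fun a => centered P B L F (trunc n (f o)) a (cand B L a o.1)).
  by apply: (bmeas_centered HS) => //; exact: measurable_cst.
have split_ o : Ex U1 (fun a => F (trunc n (f o), cand B L a o.1)) =
    D o + Ex U1 (fun a => cand_mean P B L F (trunc n (f o)) a).
  rewrite -ExD//; apply: Ex_ext => a.
  by rewrite /centered subrK.
have bW : bmeas (fun o : Om => \sum_(Q <- Qs) `|away_average P B L F Q o.1|).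
  apply: bmeas_sum => Q.
  exact: (bmeas_comp (bmeas_norm (bmeas_away_average HS L mF F01 Q))).
have bE : bmeas (\1_E : Om -> R) by exact: bmeas_indic.
have DE : Ex Pr D <= 6 * t0.
  apply: (@le_trans _ _ (Ex Pr (fun o : Om => (\1_E o + (l + n%:R * (e + l))) +
      \sum_(Q <- Qs) `|away_average P B L F Q o.1|))).
    apply: Ex_le => //; first by apply: bmeasD => //; apply: bmeasD => //; exact: bmeas_cst.
    move=> o.
    have S0 : 0 <= \sum_(Q <- Qs) `|away_average P B L F Q o.1| by apply: sumr_ge0.
    have C0 : 0 <= l + n%:R * (e + l).
      by rewrite addr_ge0 ?(ltW l0)// mulr_ge0// addr_ge0 ?(ltW e0) ?(ltW l0).
    rewrite indicE; case: (boolP (o \in E)) => [_|].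
      apply: (@le_trans _ _ 1); last by rewrite -addrA lerDl addr_ge0.
      rewrite (le_trans (ler_norm _))// (le_trans (Ex_norm _ (bco o)))//.
      rewrite -[leRHS](Ex_cst U1 1); apply: Ex_le.
      - exact: bmeas_norm.
      - exact: bmeas_cst.
      - by move=> a; exact: (centered_le1 HS).
    rewrite notin_setE => /existsNP[Q /not_implyP[QQs /contrapT[sQ cQ]]].
    have [okQ _] := hQs Q QQs.
    have trE : trunc n (f o) = box_argmins B Q o.1.
      apply/funext => i; rewrite /trunc /box_argmins sQ.
      by case: ifP => // lin; exact: cQ.
    apply: (@le_trans _ _ (away_average P B L F Q o.1 + Ex U1 \1_(~` away L Q))).
      rewrite /D trE /away_average -ExD; last 2 first.
      - apply: (bmeas_centered_away HS L mF F01) => //; exact: measurable_cst.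
      - by apply: bmeas_indic; apply: measurableC; exact: measurable_away.
      apply: Ex_le.
      - by rewrite -trE.
      - apply: bmeasD.
          apply: (bmeas_centered_away HS L mF F01) => //; exact: measurable_cst.
        by apply: bmeas_indic; apply: measurableC; exact: measurable_away.
      move=> a; rewrite /centered_away.
      have [aQ|aQ] := pselect (away L Q a).
        by rewrite [\1_(away L Q) a]indicE mem_set// mul1r lerDl indicE.
      rewrite [\1_(away L Q) a]indicE memNset// mul0r add0r indicE mem_set//.
      by rewrite (le_trans (ler_norm _))//; exact: (centered_le1 HS).
    have := Ex_not_away L okQ e0; rewrite sQ -/l.
    have : `|away_average P B L F Q o.1| <= \sum_(Q <- Qs) `|away_average P B L F Q o.1|.
      by rewrite (big_rem Q)//= lerDl sumr_ge0.
    have := ler_norm (away_average P B L F Q o.1).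
    by rewrite add0r; lra.
  rewrite ExD//; last by apply: bmeasD => //; exact: bmeas_cst.
  rewrite ExD//; last exact: bmeas_cst.
  rewrite Ex_cst Ex_sum; last first.
    move=> Q.
    exact: (bmeas_comp (bmeas_norm (bmeas_away_average HS L mF F01 Q))).
  have sumle : \sum_(Q <- Qs) Ex Pr (fun o : Om => `|away_average P B L F Q o.1|) <=
      r * (t + t).
    apply: (@le_trans _ _ (\sum_(Q <- Qs) (t + t))); last first.
      by rewrite big_const_seq count_predT iter_addr_0 mulr_natl.
    rewrite big_seq [leRHS]big_seq; apply: ler_sum => Q QQs.
    have [okQ _] := hQs Q QQs.
    have bQ := bmeas_norm (bmeas_away_average HS L mF F01 Q).
    rewrite Ex_prod; last exact: (bmeas_comp bQ).
    rewrite (@Ex_ext _ _ _ _ _ (fun w => `|away_average P B L F Q w|)); last first.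
      by move=> w /=; rewrite Ex_cst.
    apply: le_trans (away_average_norm HS L mF F01 okQ tpos) _.
    by rewrite lerD2l.
  have := sumle; have : r * (t + t) = r * t + r * t by rewrite mulrDr.
  have : n%:R * (e + l) = n%:R * e + n%:R * l by rewrite mulrDr.
  by move: hE; lra.
have bFy : bmeas (fun o : Om => Ex U1 (fun y => F (trunc n (f o), y))).
  apply: (bmeas_Ex (f := fun o y => F (trunc n (f o), y)) Pr U1).
  by apply: (bmeas_comp bF); exact: measurable_fun_pair.
have bFm : bmeas (fun o => Ex U1 (fun a => cand_mean P B L F (trunc n (f o)) a)).
  apply: (bmeas_Ex (f := fun o a => cand_mean P B L F (trunc n (f o)) a) Pr U1).
  apply: (bmeas_comp (bmeas_cand_mean HS L mF F01)
    (g := fun p : Om * R => (trunc n (f p.1), p.2))).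
  exact: measurable_fun_pair.
under Ex_ext do rewrite split_.
rewrite ExD//.
have cmE : Ex Pr (fun o => Ex U1 (fun a => cand_mean P B L F (trunc n (f o)) a)) <=
    Ex Pr (fun o => Ex U1 (fun y => F (trunc n (f o), y))) + l.
  rewrite -[X in _ + X](Ex_cst Pr l) -ExD//; last exact: bmeas_cst.
  apply: Ex_le => //; first by apply: bmeasD => //; exact: bmeas_cst.
  by move=> o; exact: Ex_cand_mean.
have -> : dl = 6 * t0 + (t0 + t0) by rewrite /t0; field.
apply: (le_trans (lerD DE cmE)); rewrite addrCA lerD2l lerD2l.
by rewrite (le_trans (le_trans le_ et0))// lerDl ltW.
Qed.

End candidate_law.

(** * Partial enumerations *)

Definition ins (R : realType) n (h : seqS R) (y : R) : seqS R :=
  fun i => if (i < n)%N then h i else y.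

Lemma measurable_ins (R : realType) n (d : measure_display) (T : measurableType d)
    (h : T -> seqS R) (y : T -> R) : measurable_fun setT h ->
  measurable_fun setT y -> measurable_fun setT (fun w => ins n (h w) (y w)).
Proof.
move=> mh my; apply: measurable_seqP => i; rewrite /ins.
by case: (i < n)%N => //; exact: (measurableT_comp (@measurable_coord R i) mh).
Qed.

Lemma measurable_eq_set (R : realType) (d : measure_display) (T : measurableType d)
    (f g : T -> R) : measurable_fun setT f -> measurable_fun setT g ->
  measurable [set w | f w = g w].
Proof.
move=> mf mg.
have h : measurable_fun setT (fun w => f w == g w) by exact: measurable_fun_eqr.
have := h measurableT [set true] I.
by rewrite setTI; congr measurable; apply/seteqP; split=> w /=;
  [move/eqP|move=> ->; rewrite eqxx].
Qed.

Section enumeration_steps.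
Context (d : measure_display) (T : measurableType d) (R : realType).
Variables (P : probability T R) (B : R -> T -> R) (X : nat -> T -> R) (N : set T).
Hypothesis HS : minima_setting P B X N.
Variables (lam : probability (seqS R) R).
Hypothesis hlam : iid_law lam.
Local Notation Om := (T * seqS R)%type.
Local Notation Pr := (P \x lam)%E.
Local Notation U1 := (uniform01 R).
Let mX := ms_measX HS.

(* [m] bounds the number of auxiliary uniform variables that [f] has consumed;
   the next ones remain available as independent randomness. *)
Record enum_state (n m : nat) (f : Om -> seqS R) : Prop := {
  es_meas : measurable_fun setT f;
  es_minima : lists_minima X N n f;
  es_dep : forall w u u', (forall i, (i < m)%N -> u i = u' i) -> f (w, u) = f (w, u') }.

(* The law of the first [n] points of [f] continued by an independent sequence of
   law [lam], tested against [G]. *)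
Definition completed n (f : Om -> seqS R) (G : seqS R -> R) : R :=
  Ex Pr (fun o => Ex lam (fun v => G (hyb n (f o) v))).

Lemma enum_state_ins n m m' f (y : Om -> R) : enum_state n m f -> (m <= m')%N ->
  measurable_fun setT y ->
  (forall w u, ~ N w -> (exists k, y (w, u) = X k w) /\
     forall i, (i < n)%N -> f (w, u) i != y (w, u)) ->
  (forall w u u', (forall i, (i < m')%N -> u i = u' i) -> y (w, u) = y (w, u')) ->
  enum_state n.+1 m' (fun o => ins n (f o) (y o)).
Proof.
move=> [mf lf df] mm my hy dy; split.
- exact: measurable_ins.
- move=> w u Nw; have [l1 l2] := lf w u Nw; have [y1 y2] := hy w u Nw.
  split.
    by move=> i _; rewrite /ins; case: (ltnP i n) => // /l1.
  move=> i j; rewrite !ltnS /ins => ilen jlen ij.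
  case: (ltnP i n) => lin; case: (ltnP j n) => ljn.
  + exact: l2.
  + exact: y2.
  + by rewrite eq_sym; exact: y2.
  + by move: ij; rewrite (anti_leq (introT andP (conj ilen lin)))
      (anti_leq (introT andP (conj jlen ljn))) eqxx.
- move=> w u u' uu'; rewrite (dy w u u' uu') (df w u u')// => i im.
  exact: uu' (leq_trans im mm).
Qed.

Definition fresh_at n (f : Om -> seqS R) (k : nat) : set Om :=
  [set o | forall i, (i < n)%N -> X k o.1 <> f o i].

Definition fresh n (f : Om -> seqS R) : Om -> R :=
  first_sel (fresh_at n f) (fun k o => X k o.1) (fun o => X 0 o.1).

Lemma measurable_X1 k : measurable_fun setT (fun o : Om => X k o.1).
Proof. exact: measurableT_comp. Qed.

Lemma measurable_fresh n f : measurable_fun setT f -> measurable_fun setT (fresh n f).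
Proof.
move=> mf; apply: measurable_first_sel; [|exact: measurable_X1|exact: measurable_X1].
move=> k; rewrite (_ : fresh_at n f k = \bigcap_i (if (i < n)%N then
   ~` [set o | X k o.1 = f o i] else setT)).
  apply: bigcapT_measurable => i; case: ifP => // _.
  apply: measurableC; apply: measurable_eq_set; first exact: measurable_X1.
  exact: (measurableT_comp (@measurable_coord R i) mf).
apply/seteqP; split=> o h i.
  by move=> _; case: ifP => // /h.
by move=> lin; have := h i I; rewrite lin.
Qed.

(** Finitely many places cannot contain all values of an injective sequence. The last clause, that
    all earlier points are already listed, is what later proves that no minimizer is forgotten. *)
Lemma fresh_spec n f w u : ~ N w ->
  exists k, [/\ fresh n f (w, u) = X k w,
    forall i, (i < n)%N -> f (w, u) i != X k w &
    forall j, (j < k)%N -> exists2 i, (i < n)%N & X j w = f (w, u) i].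
Proof.
move=> Nw; rewrite /fresh.
have [[k [h1 h2 ->]]|[h _]] :=
  first_selP (fresh_at n f) (fun k o => X k o.1) (fun o => X 0 o.1) (w, u).
  exists k; split => // [i lin|j jk].
    by apply/eqP => h; exact: (h1 i lin).
  apply: contrapT => h; apply: (h2 j jk) => i lin /= hi; apply: h; by exists i.
exfalso.
have sub : range (X^~ w) `<=` f (w, u) @` `I_n.
  move=> _ [k _ <-]; apply: contrapT => hk; apply: (h k) => i lin /= hi.
  by apply: hk; exists i.
have /(sub_finite_set sub) : finite_set (f (w, u) @` `I_n).
  exact/finite_image/finite_II.
have Xinj' : {in X^~ w @^-1` range (X^~ w) &, injective (X^~ w)}.
  by move=> x y _ _; exact: (ms_inj HS Nw).
by move=> /(finite_preimage Xinj'); rewrite preimage_range; exact: infinite_nat.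
Qed.

Lemma fresh_dep n m f : enum_state n m f -> forall w u u',
  (forall i, (i < m)%N -> u i = u' i) -> fresh n f (w, u) = fresh n f (w, u').
Proof.
move=> [_ _ df] w u u' uu'; have fE := df w u u' uu'.
have GE k : fresh_at n f k (w, u) <-> fresh_at n f k (w, u').
  by rewrite /fresh_at/= fE.
rewrite /fresh.
have [[k [h1 h2 ->]]|[h ->]] :=
  first_selP (fresh_at n f) (fun k o => X k o.1) (fun o => X 0 o.1) (w, u);
have [[k' [h1' h2' ->]]|[h' ->]] :=
  first_selP (fresh_at n f) (fun k o => X k o.1) (fun o => X 0 o.1) (w, u') => //=.
- have [kk'|k'k|-> //] := ltngtP k k'.
    by case: (h2' k kk'); apply/GE.
  by case: (h2 k' k'k); apply/GE.
- by case: (h' k); apply/GE.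
- by case: (h k'); apply/GE.
Qed.

Lemma enum_state_fresh n m f : enum_state n m f ->
  enum_state n.+1 m (fun o => ins n (f o) (fresh n f o)).
Proof.
move=> sf; apply: (enum_state_ins sf) => //.
- exact: measurable_fresh (es_meas sf).
- move=> w u Nw; have [k [-> h _]] := fresh_spec n f u Nw.
  by split=> //; exists k.
- exact: fresh_dep sf.
Qed.

(** [Psi] sees the coordinates below [m] only, so the auxiliary sequence can be resampled from place
    [m] on, and its entry there becomes an independent uniform variable. *)
Lemma Ex_fresh_coord m (Psi : Om * R -> R) : bmeas Psi ->
  (forall w u u' a, (forall i, (i < m)%N -> u i = u' i) ->
     Psi ((w, u), a) = Psi ((w, u'), a)) ->
  Ex Pr (fun o => Psi (o, o.2 m)) = Ex Pr (fun o => Ex U1 (fun a => Psi (o, a))).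
Proof.
move=> bPsi dPsi.
have mcm : measurable_fun setT (fun o : Om => o.2 m).
  exact: (measurableT_comp (@measurable_coord R m)).
rewrite Ex_prod; last by apply: (bmeas_comp bPsi); exact: measurable_fun_pair.
rewrite Ex_prod; last first.
  apply: (bmeas_Ex (f := fun o a => Psi (o, a)) Pr U1).
  by rewrite [X in bmeas X](_ : _ = Psi)//; apply/funext => -[].
apply: Ex_ext => w /=.
rewrite (Ex_hyb hlam m); last first.
  apply: (bmeas_comp bPsi); apply: measurable_fun_pair; last exact: measurable_coord.
  exact: pair1_measurable.
apply: Ex_ext => u.
rewrite -(Ex_coord hlam 0); last first.
  exact: (bmeas_comp bPsi (pair1_measurable (w, u))).
apply: Ex_ext => v.
have -> : hyb m u v m = v 0%N by rewrite /hyb ltnn subnn.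
by apply: dPsi => i im; rewrite /hyb im.
Qed.

Definition tail_mean n (G : seqS R -> R) (x : seqS R * R) : R :=
  Ex lam (fun v => G (hyb n.+1 (ins n x.1 x.2) v)).

Lemma measurable_hyb_ins n : measurable_fun setT
  (fun p : (seqS R * R) * seqS R => hyb n.+1 (ins n p.1.1 p.1.2) p.2).
Proof.
by apply: measurable_hyb => //; apply: measurable_ins; exact: measurableT_comp.
Qed.

Section test_function.
Variable (G : seqS R -> R).
Hypothesis mG : measurable_fun setT G.
Hypothesis G01 : forall x, 0 <= G x <= 1.
Let bG := bmeas_01 mG G01.

Lemma bmeas_tail_mean n : bmeas (tail_mean n G).
Proof.
apply: (bmeas_Ex (f := fun x v => G (hyb n.+1 (ins n x.1 x.2) v))
  (distribution lam (mfun_Sub (mem_set (measurable_fun_pair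
     (@measurable_id _ (seqS R) setT) (@measurable_coord R 0)) : _ \in mfun))) lam).
exact: (bmeas_comp bG (measurable_hyb_ins n)).
Qed.

Lemma tail_mean01 n x : 0 <= tail_mean n G x <= 1.
Proof.
apply: Ex_01 => //; apply: (measurableT_comp mG).
exact: (measurable_hyb n.+1 (measurable_cst (ins n x.1 x.2)) (@measurable_id _ (seqS R) setT)).
Qed.

Lemma hyb_ins_trunc n (h : seqS R) (y : R) (v : seqS R) :
  hyb n.+1 (ins n (trunc n h) y) v = hyb n.+1 (ins n h y) v.
Proof.
apply/funext => i; rewrite /hyb /ins /trunc.
by case: (i < n)%N; case: (i < n.+1)%N.
Qed.

(** Detaches the first point of the independent tail: [tail_mean] is the test function in which this
    point is to be compared with a candidate. *)
Lemma completed_tail_mean n (h : seqS R) :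
  Ex lam (fun v => G (hyb n h v)) = Ex U1 (fun y => tail_mean n G (trunc n h, y)).
Proof.
have mh : measurable_fun setT (fun v => hyb n h v).
  exact: (measurable_hyb n (measurable_cst h) (@measurable_id _ (seqS R) setT)).
rewrite (Ex_hyb hlam 1); last exact: (bmeas_comp bG mh).
rewrite -(Ex_coord hlam 0); last first.
  exact: (bmeas_comp (bmeas_tail_mean n) (pair1_measurable (trunc n h))).
apply: Ex_ext => v; rewrite /tail_mean; apply: Ex_ext => v' /=; congr G.
rewrite hyb_ins_trunc; apply/funext => i; rewrite /hyb /ins !ltnS.
case: (ltngtP i n) => [lin|nli|->] //=.
- by rewrite leqn0 subn_eq0 leqNgt nli/= subn1 -subnS.
- by rewrite subnn.
Qed.

Lemma completed_ins n f (y : Om -> R) :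
  completed n.+1 (fun o => ins n (f o) (y o)) G =
  Ex Pr (fun o => tail_mean n G (trunc n (f o), y o)).
Proof.
rewrite /completed; apply: Ex_ext => o; rewrite /tail_mean.
by apply: Ex_ext => v /=; rewrite hyb_ins_trunc.
Qed.

End test_function.

(** A test function for [cand_uniform]: a uniform point almost surely avoids the finitely many
    listed ones, so a candidate seldom repeats one of them. *)
Definition hits n (x : seqS R * R) : R := \1_[set x : seqS R * R |
  exists2 i, (i < n)%N & x.1 i = x.2] x.

Lemma measurable_hits_set n :
  measurable [set x : seqS R * R | exists2 i, (i < n)%N & x.1 i = x.2].
Proof.
rewrite (_ : mkset _ = \bigcup_(i in `I_n) [set x : seqS R * R | x.1 i = x.2]).
  apply: bigcup_measurable => i _; apply: measurable_eq_set => //.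
  exact: (measurableT_comp (@measurable_coord R i)).
by apply/seteqP; split=> x /=; [move=> [i lin h]; exists i|move=> [i lin h]; exists i].
Qed.

Lemma hits01 n x : 0 <= hits n x <= 1.
Proof. by rewrite /hits indicE; case: (_ \in _); rewrite ?lexx ?ler01. Qed.

Lemma measurable_hits n : measurable_fun setT (hits n).
Proof. by apply: measurable_indic; exact: measurable_hits_set. Qed.

Lemma Ex_hits n (h : seqS R) : Ex U1 (fun y => hits n (h, y)) = 0.
Proof.
apply/eqP; rewrite eq_le; apply/andP; split; last first.
  by apply: Ex_ge0 => y; case/andP: (hits01 n (h, y)).
have bJ i : bmeas (\1_`[h i, h i] : R -> R) by apply: bmeas_indic; exact: measurable_itv.
apply: (@le_trans _ _ (Ex U1 (fun y => \sum_(i <- iota 0 n) \1_`[h i, h i] y))).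
  apply: Ex_le.
  - exact: (bmeas_comp (bmeas_01 (measurable_hits n) (hits01 n)) (pair1_measurable h)).
  - exact: bmeas_sum.
  move=> y; rewrite /hits indicE; case: (boolP (_ \in _)) => [|_]; last first.
    by apply: sumr_ge0 => i _; rewrite indicE.
  rewrite inE/= => -[i lin hy].
  rewrite (bigD1_seq i) ?iota_uniq ?mem_iota//= indicE mem_set/=; last first.
    by rewrite in_itv/= hy lexx.
  by rewrite lerDl sumr_ge0// => j _; rewrite indicE.
rewrite Ex_sum// big_seq; apply: sumr_le0 => i _.
by apply: le_trans (Ex_uniform_itv (lexx _)) _; rewrite subrr.
Qed.

(** The candidate is no minimizer at all: up to null events this needs a window leaving [[0, 1]],
    that is, a position in an interval of the length of a window. *)
Definition misses L (x : T * R) : R :=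
  \1_(~` \bigcup_k [set x : T * R | X k x.1 = cand B L x.2 x.1]) x.

Lemma measurable_cand_swap L : measurable_fun setT (fun x : T * R => cand B L x.2 x.1).
Proof.
exact: (measurableT_comp (measurable_cand2 HS L) (@measurable_swap _ _ T R)).
Qed.

Lemma bmeas_misses L : bmeas (misses L).
Proof.
apply: bmeas_indic; apply: measurableC; apply: bigcupT_measurable => k.
apply: measurable_eq_set; last exact: measurable_cand_swap.
exact: measurableT_comp.
Qed.

Lemma misses01 L x : 0 <= misses L x <= 1.
Proof. by rewrite /misses indicE; case: (_ \in _); rewrite ?lexx ?ler01. Qed.

Lemma Ex_misses L : Ex P (fun w => Ex U1 (fun a => misses L (w, a))) <= ratr (ell L).
Proof.
have l0 := ell_gt0R R L; have l1 := ell_le1 R L.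
set l : R := ratr (ell L) in l0 l1 *.
have bm := bmeas_misses L.
rewrite (@Ex_swap _ _ _ _ _ P U1 (fun w a => misses L (w, a))); last first.
  by rewrite [X in bmeas X](_ : _ = misses L)//; apply/funext => -[].
have bma a : bmeas (fun w => misses L (w, a)).
  exact: (bmeas_comp bm (pair2_measurable a)).
apply: (@le_trans _ _ (Ex U1 \1_`[1 - l, 1])); last first.
  by apply: le_trans (Ex_uniform_itv _) _; lra.
apply: Ex_uniform_le.
- apply: (bmeas_Ex (f := fun a w => misses L (w, a)) U1 P).
  exact: (bmeas_comp bm (@measurable_swap _ _ R T)).
- by apply: bmeas_indic; exact: measurable_itv.
- by move=> a; apply: Ex_ge0 => w; case/andP: (misses01 L (w, a)).
- by move=> a; rewrite indicE.
move=> a /andP[a0 a1].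
have [al|al] := leP (1 - l) a.
  rewrite indicE mem_set/=; last by rewrite in_itv/= al a1.
  rewrite -[leRHS](Ex_cst P 1); apply: Ex_le => //; first exact: bmeas_cst.
  by move=> w; case/andP: (misses01 L (w, a)).
have a1' : a + ratr (ell L) <= 1 by rewrite -/l; lra.
rewrite (_ : Ex P _ = 0) ?indicE// -(Ex_cst P 0).
have mM := measurable_no_min HS L a.
apply: (@Ex_null _ _ _ _ _ _ (N `|` window B a (ell L) @^-1` ~` has_min (ell L))) => //.
- exact: bmeas_cst.
- by apply: measurableU => //; exact: (ms_measN HS).
- apply: null_set_setU => //; [exact: (ms_measN HS)|exact: (ms_N0 HS)|].
  exact: (prob_no_min HS a0 a1').
move=> w /not_orP[Nw /contrapT hm].
have [_] := cand_bounds HS a0 a1' hm.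
rewrite (ms_range HS Nw) => -[k _ hk].
by rewrite /misses indicE memNset//=; apply; exists k.
Qed.

(** The candidate is taken unless it is no minimizer or already listed, in which case [fresh]
    replaces it, so that the list remains valid. Three equal shares of [dl] pay for the deviation
    from the uniform law and for these two failures. *)
Lemma append_cand n m f (dl : R) : enum_state n m f -> 0 < dl ->
  exists f', [/\ enum_state n.+1 m.+1 f',
    forall o i, (i < n)%N -> f' o i = f o i &
    forall G : seqS R -> R, measurable_fun setT G -> (forall x, 0 <= G x <= 1) ->
      completed n.+1 f' G <= completed n f G + dl].
Proof.
move=> sf dl0.
have dl30 : 0 < dl / 3 by rewrite divr_gt0.
have [L [hL hF]] := cand_uniform HS lam (es_meas sf) (es_minima sf) dl30.
pose c (o : Om) : R := cand B L (o.2 m) o.1.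
have mc : measurable_fun setT c.
  apply: (measurableT_comp (measurable_cand_swap L) (g := fun o : Om => (o.1, o.2 m))).
  apply: measurable_fun_pair => //.
  exact: (measurableT_comp (@measurable_coord R m)).
pose bad : set Om := (~` \bigcup_k [set o : Om | X k o.1 = c o]) `|`
  [set o | exists2 i, (i < n)%N & trunc n (f o) i = c o].
have mtf : measurable_fun setT (fun o => trunc n (f o)).
  exact: (measurableT_comp (@measurable_trunc R n) (es_meas sf)).
have mbad : measurable bad.
  apply: measurableU.
    apply: measurableC; apply: bigcupT_measurable => k.
    by apply: measurable_eq_set => //; exact: measurable_X1.
  have mp : measurable_fun setT (fun o => (trunc n (f o), c o)) by exact: measurable_fun_pair.
  by have := mp measurableT _ (measurable_hits_set n); rewrite setTI.
pose y (o : Om) : R := \1_(~` bad) o * c o + \1_bad o * fresh n f o.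
have my : measurable_fun setT y.
  apply: measurable_funD; apply: measurable_funM.
  - by apply: measurable_indic; exact: measurableC.
  - exact: mc.
  - exact: measurable_indic.
  - exact: measurable_fresh (es_meas sf).
have yc o : ~ bad o -> y o = c o.
  by move=> h; rewrite /y !indicE mem_set// memNset// mul1r mul0r addr0.
have yf o : bad o -> y o = fresh n f o.
  by move=> h; rewrite /y !indicE memNset; [rewrite mem_set// mul0r add0r mul1r|move=> /(_ h)].
exists (fun o => ins n (f o) (y o)); split.
- apply: (enum_state_ins sf) => //.
    move=> w u Nw; have [bo|bo] := pselect (bad (w, u)).
      by rewrite yf//; have [k [-> h _]] := fresh_spec n f u Nw; split=> //; exists k.
    rewrite yc//; move: bo => /not_orP[/contrapT[k _ /= hk] h].
    split; first by exists k.
    move=> i lin; apply/eqP => hi; apply: h; exists i => //.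
    by rewrite /trunc lin.
  move=> w u u' uu'.
  have uu1 : forall i, (i < m)%N -> u i = u' i by move=> i im; apply: uu'; exact: leqW.
  have fE := es_dep sf w uu1.
  have cE : c (w, u) = c (w, u') by rewrite /c/= uu'.
  have bE : bad (w, u) <-> bad (w, u').
    split=> -[h|[i lin /= hi]]; [left|right|left|right].
    - by move=> [k _ /= hk]; apply: h; exists k => //=; rewrite cE.
    - by exists i => //=; rewrite -fE -cE.
    - by move=> [k _ /= hk]; apply: h; exists k => //=; rewrite -cE.
    - by exists i => //=; rewrite fE cE.
  have [bo|bo] := pselect (bad (w, u)).
    rewrite !yf//; [exact: fresh_dep sf _ _ _ uu1|exact/bE].
  by rewrite !yc// => /bE.
- by move=> o i lin; rewrite /ins lin.
move=> G mG G01.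
have bG := bmeas_01 mG G01.
have bt := bmeas_tail_mean mG G01 n.
have mtc : measurable_fun setT (fun o => (trunc n (f o), c o)) by exact: measurable_fun_pair.
have bF0 : bmeas (fun o => tail_mean n G (trunc n (f o), c o)) by exact: (bmeas_comp bt).
have bmis : bmeas (fun o : Om => misses L (o.1, o.2 m)).
  apply: (bmeas_comp (bmeas_misses L)); apply: measurable_fun_pair => //.
  exact: (measurableT_comp (@measurable_coord R m)).
have bhit : bmeas (fun o => hits n (trunc n (f o), c o)).
  exact: (bmeas_comp (bmeas_01 (measurable_hits n) (hits01 n)) mtc).
rewrite completed_ins.
apply: (@le_trans _ _ (Ex Pr (fun o => (tail_mean n G (trunc n (f o), c o) +
   misses L (o.1, o.2 m)) + hits n (trunc n (f o), c o)))).
  apply: Ex_le.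
  - by apply: (bmeas_comp bt); exact: measurable_fun_pair.
  - by apply: bmeasD => //; exact: bmeasD.
  move=> o.
  have /andP[t0 _] := tail_mean01 mG G01 n (trunc n (f o), c o).
  have /andP[_ t1] := tail_mean01 mG G01 n (trunc n (f o), y o).
  have /andP[m0 _] := misses01 L (o.1, o.2 m).
  have /andP[h0 _] := hits01 n (trunc n (f o), c o).
  have [bo|bo] := pselect (bad o); last first.
    by rewrite yc// -addrA lerDl addr_ge0.
  case: bo => bo.
    have -> : misses L (o.1, o.2 m) = 1 by rewrite /misses indicE mem_set.
    by lra.
  have -> : hits n (trunc n (f o), c o) = 1 by rewrite /hits indicE mem_set.
  by lra.
rewrite ExD//; last exact: bmeasD.
rewrite ExD//.
have mc2 : measurable_fun setT (fun p : Om * R => cand B L p.2 p.1.1).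
  apply: (measurableT_comp (measurable_cand_swap L) (g := fun p : Om * R => (p.1.1, p.2))).
  by apply: measurable_fun_pair => //; exact: measurableT_comp.
have mtc2 : measurable_fun setT (fun p : Om * R => (trunc n (f p.1), cand B L p.2 p.1.1)).
  by apply: measurable_fun_pair => //; exact: (measurableT_comp mtf).
have dep (H : seqS R * R -> R) w u u' a : (forall i, (i < m)%N -> u i = u' i) ->
    H (trunc n (f (w, u)), cand B L a w) = H (trunc n (f (w, u')), cand B L a w).
  by move=> uu'; rewrite (es_dep sf w uu').
have E1 := @Ex_fresh_coord m (fun p => tail_mean n G (trunc n (f p.1), cand B L p.2 p.1.1))
  (bmeas_comp bt mtc2) (dep (tail_mean n G)).
have E2 := @Ex_fresh_coord m (fun p => hits n (trunc n (f p.1), cand B L p.2 p.1.1))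
  (bmeas_comp (bmeas_01 (measurable_hits n) (hits01 n)) mtc2) (dep (hits n)).
have E3 := @Ex_fresh_coord m (fun p => misses L (p.1.1, p.2)).
have mp112 : measurable_fun setT (fun p : Om * R => (p.1.1, p.2)).
  by apply: measurable_fun_pair => //; exact: measurableT_comp.
rewrite [X in X + _ + _]E1 [X in _ + X]E2 [X in _ + X + _]E3//=; last first.
  exact: (bmeas_comp (bmeas_misses L) mp112).
have K1 : Ex Pr (fun o => Ex U1 (fun a => tail_mean n G (trunc n (f o), cand B L a o.1))) <=
    completed n f G + dl / 3.
  apply: (le_trans (hF (tail_mean n G) (proj1 bt) (tail_mean01 mG G01 n))).
  rewrite lerD2r le_eqVlt; apply/orP; left; apply/eqP.
  by rewrite /completed; apply: Ex_ext => o; rewrite (completed_tail_mean mG G01).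
have K2 : Ex Pr (fun o => Ex U1 (fun a => hits n (trunc n (f o), cand B L a o.1))) <= dl / 3.
  apply: (le_trans (hF (hits n) (measurable_hits n) (hits01 n))).
  rewrite -[leRHS]add0r lerD2r le_eqVlt; apply/orP; left; apply/eqP.
  by under Ex_ext do rewrite Ex_hits; rewrite Ex_cst.
have K3 : Ex Pr (fun o => Ex U1 (fun a => misses L (o.1, a))) <= dl / 3.
  apply: le_trans hL.
  rewrite Ex_prod; last first.
    apply: (bmeas_Ex (f := fun (o : Om) a => misses L (o.1, a)) Pr U1).
    exact: (bmeas_comp (bmeas_misses L) mp112).
  apply: le_trans (Ex_misses L); rewrite le_eqVlt; apply/orP; left; apply/eqP.
  by apply: Ex_ext => w /=; rewrite Ex_cst.
apply: (le_trans (lerD (lerD K1 K3) K2)).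
by rewrite -!addrA lerD2l le_eqVlt; apply/orP; left; apply/eqP; field.
Qed.

End enumeration_steps.

(** * Absolute continuity of the law of a minimizer *)

Section absolute_continuity.
Context (d : measure_display) (T : measurableType d) (R : realType).
Variables (P : probability T R) (B : R -> T -> R) (X : nat -> T -> R) (N : set T).
Hypothesis HS : minima_setting P B X N.
Local Notation U1 := (uniform01 R).
Let mB := ms_measB HS.
Let cB := ms_contB HS.

Lemma Ex_uniform_half : 1 / 2 <= Ex U1 \1_`[0, 1 / 2].
Proof.
have bI (a b : R) : bmeas (\1_`[a, b] : R -> R) by apply: bmeas_indic; exact: measurable_itv.
have h : (1 : R) / 2 <= 1 by lra.
have := Ex_uniform_itv h.
have : 1 <= Ex U1 (fun x => \1_`[0, 1 / 2] x + \1_`[1 / 2, 1] x).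
  rewrite -[leLHS](Ex_cst U1 1); apply: Ex_uniform_le => //.
  - exact: bmeas_cst.
  - exact: bmeasD.
  move=> x /andP[x0 x1]; rewrite !indicE.
  have [xh|xh] := leP x (1 / 2).
    by rewrite mem_set/= ?lerDl// in_itv/= x0 xh.
  by rewrite (@mem_set _ `[1 / 2, 1]%classic)/= ?lerDr// in_itv/= (ltW xh) x1.
rewrite ExD//; move: (Ex U1 _) (Ex U1 _) => u v; lra.
Qed.

(* Moving the window by a uniform amount [s] moves its minimizer, which is one
   of countably many random variables [X k]: so up to a small probability the
   law of the minimizer is dominated by finitely many shifts of the uniform law. *)
Lemma box_argmin_abs_cont (q : rat * rat) (dl : R) : 0 <= q.1 -> q.1 < q.2 ->
  q.2 <= 1 -> ratr (q.2 - q.1) <= 1 / 2 :> R -> 0 < dl ->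
  exists2 C : R, 0 <= C & forall phi : R -> R, measurable_fun setT phi ->
    (forall x, 0 <= phi x <= 1) ->
    Ex P (fun w => phi (box_argmin B q w) *
      \1_(strict_min 0 (q.2 - q.1)) (window B (ratr q.1) (q.2 - q.1) w)) <=
    dl + C * Ex U1 phi.
Proof.
move=> q0 q12 q21 qh dl0.
set l := q.2 - q.1; set c : R := ratr q.1.
have l0 : 0 < l by rewrite subr_gt0.
have c0 : 0 <= c by rewrite ler0q.
have cl1 : c + ratr l <= 1.
  by rewrite /c -rmorphD/= /l addrC subrK -(rmorph1 (ratr : rat -> R)) ler_rat.
have lh : ratr l <= 1 / 2 :> R by [].
(* For [s] in [[0, 1 / 2]] the shifted window stays in [[0, 1]], its length being at most [1 / 2];
   by stationarity its functionals have the same means as those of the box. *)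
pose sh (p : R * T) := window B (1 / 2 - p.1) l p.2.
have msh : measurable_fun setT sh.
  apply: (measurableT_comp (measurable_window2 mB cB l)
    (g := fun p : R * T => (1 / 2 - p.1, p.2))).
  by apply: measurable_fun_pair => //; exact: measurable_funB.
pose F k : set (R * T) := [set p | X k p.2 = 1 / 2 - p.1 + argm 0 l (sh p)].
have mX2 k : measurable_fun setT (fun p : R * T => X k p.2).
  exact: (measurableT_comp (ms_measX HS k)).
have mF k : measurable (F k).
  apply: measurable_eq_set => //; apply: measurable_funD; first exact: measurable_funB.
  exact: (measurableT_comp (@measurable_argm R 0 l) msh).
have dl20 : 0 < dl / 2 by rewrite divr_gt0.
have [K /(_ K (leqnn K))] := prob_bigcup_tail (U1 \x P)%E mF dl20.
set E := _ `\` _ => hE.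
have mE : measurable E.
  by apply: measurableD; [exact: bigcupT_measurable|exact: bigcup_measurable].
(* The shift is uniform on [[0, 1]] but used on [[0, 1 / 2]] only: this halves the left-hand side,
   whence the factor 2 here and the [dl / 2] above. *)
exists (2 * K%:R) => [|phi mphi phi01]; first by rewrite mulr_ge0.
have bphi := bmeas_01 mphi phi01.
have phi0 x : 0 <= phi x by case/andP: (phi01 x).
have bI (a b : R) : bmeas (\1_`[a, b] : R -> R) by apply: bmeas_indic; exact: measurable_itv.
pose psi (x : seqS R) : R := phi (c + argm 0 l x) * \1_(strict_min 0 l) x.
have bpsi : bmeas psi.
  apply: bmeasM.
    by apply: (bmeas_comp bphi); apply: measurable_funD => //; exact: measurable_argm.
  by apply: bmeas_indic; exact: measurable_strict_min.
set E0 := (X in X <= _).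
have E0ge : 0 <= E0 by apply: Ex_ge0 => w; rewrite mulr_ge0// indicE.
have shiftE s : 0 <= s <= 1 / 2 -> E0 = Ex P (fun w => psi (sh (s, w))).
  move=> /andP[s0 s1].
  apply: (@Ex_law _ _ _ _ _ _ _ P P (window B c l) (window B (1 / 2 - s) l) psi) => //.
  - exact: measurable_window.
  - exact: measurable_window.
  - move=> A mA; apply: (window_law mB (ms_indB HS) (ms_statB HS) (ltW l0)) => //; lra.
(* If the minimizer of the shifted window is [X k], the one of the box corresponds to
   [c - 1 / 2 + X k + s]: for a fixed path, a translate of the uniform variable [s]. *)
pose g k (p : R * T) : R :=
  phi ((c - 1 / 2 + X k p.2) + p.1) * \1_`[0, 1] ((c - 1 / 2 + X k p.2) + p.1).
have bg k : bmeas (g k).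
  have m1 : measurable_fun setT (fun p : R * T => (c - 1 / 2 + X k p.2) + p.1).
    by apply: measurable_funD => //; exact: measurable_funD.
  by apply: bmeasM; [exact: (bmeas_comp bphi m1)|exact: (bmeas_comp (bI 0 1) m1)].
have g0 k p : 0 <= g k p by rewrite /g mulr_ge0// indicE.
have bE : bmeas (\1_E : R * T -> R) by exact: bmeas_indic.
have bN : bmeas (fun p : R * T => \1_N p.2 : R).
  apply: (bmeas_comp (bmeas_indic R (ms_measN HS))); exact: measurable_snd.
pose H (p : R * T) : R := \sum_(k <- iota 0 K) g k p + (\1_E p + \1_N p.2).
have S0 p : 0 <= \sum_(k <- iota 0 K) g k p by apply: sumr_ge0.
have bH : bmeas H by apply: bmeasD; [exact: bmeas_sum|exact: bmeasD].
have H0 p : 0 <= H p by rewrite /H !addr_ge0// indicE.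
have psiH s w : 0 <= s <= 1 / 2 -> psi (sh (s, w)) <= H (s, w).
  move=> /andP[s0 s1].
  have psi1 : psi (sh (s, w)) <= 1.
    have /andP[? ?] := phi01 (c + argm 0 l (sh (s, w))).
    by rewrite /psi indicE; case: (_ \in _); rewrite ?mulr1 ?mulr0.
  have [Nw|Nw] := pselect (N w).
    apply: (le_trans psi1); rewrite /H [\1_N _]indicE mem_set//=.
    by rewrite addrA lerDr addr_ge0// indicE.
  have [sm|sm] := pselect (strict_min 0 l (sh (s, w))); last first.
    by rewrite /psi indicE memNset// mulr0.
  have a0 : 0 <= 1 / 2 - s by lra.
  have a1 : 1 / 2 - s + ratr l <= 1 by lra.
  have [] := window_minimizer cB a0 a1 (lexx 0) l0 (lexx l) sm.
  rewrite (ms_range HS Nw) rmorph0 => -[k _ hk] /andP[h1 h2].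
  have [kK|kK] := ltnP k K.
    apply: (@le_trans _ _ (g k (s, w))); last first.
      rewrite /H (bigD1_seq k) ?iota_uniq ?mem_iota//= -addrA lerDl.
      by rewrite !addr_ge0// ?sumr_ge0// indicE.
    rewrite /g/= hk /psi.
    set z := argm 0 l (sh (s, w)).
    have -> : c - 1 / 2 + (1 / 2 - s + argm 0 l (window B (1 / 2 - s) l w)) + s = c + z.
      by rewrite /z /sh/=; ring.
    have zb : 0 < z < ratr l by rewrite /z /sh/=; apply/andP; split; lra.
    move: zb => /andP[z0 zl].
    rewrite [\1_(strict_min 0 l) _]indicE mem_set// indicE mem_set//= in_itv/=.
    by apply/andP; split; lra.
  have [Esw|nEsw] := pselect (E (s, w)).
    apply: (le_trans psi1); rewrite /H [\1_E _]indicE mem_set//=.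
    by rewrite addrCA lerDl addr_ge0// indicE.
  have : (\bigcup_(k in `I_K) F k) (s, w).
    apply: contrapT => h; apply: nEsw; split=> //; by exists k.
  move=> [k' /= k'K hk'].
  by have kk' := ms_inj HS Nw (etrans hk (esym hk')); move: k'K; rewrite -kk' ltnNge kK.
have EH : Ex U1 (fun s => \1_`[0, 1 / 2] s * E0) <= Ex U1 (fun s => Ex P (fun w => H (s, w))).
  apply: Ex_uniform_le.
  - by apply: bmeasM => //; exact: bmeas_cst.
  - apply: (bmeas_Ex (f := fun s w => H (s, w)) U1 P).
    by rewrite [X in bmeas X](_ : _ = H)//; apply/funext => -[].
  - by move=> s; rewrite mulr_ge0// indicE.
  - by move=> s; exact: Ex_ge0.
  move=> s /andP[s0 s1]; rewrite indicE.
  have [sh2|sh2] := leP s (1 / 2); last first.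
    rewrite memNset ?mul0r ?Ex_ge0//=; rewrite in_itv/= => /andP[_]; lra.
  have s01 : 0 <= s <= 1 / 2 by rewrite s0 sh2.
  rewrite mem_set ?mul1r/=; last by move: s01; rewrite in_itv/= div1r.
  rewrite (shiftE s s01); apply: Ex_le.
  - exact: (bmeas_comp bpsi (measurableT_comp msh (pair1_measurable s))).
  - exact: (bmeas_comp bH (pair1_measurable s)).
  - by move=> w; exact: psiH.
rewrite -(Ex_prod U1 P bH) in EH.
have gle k : Ex (U1 \x P)%E (g k) <= Ex U1 phi.
  rewrite Ex_prodr// -[leRHS](Ex_cst P); apply: Ex_le.
  - apply: (bmeas_Ex (f := fun w s => g k (s, w)) P U1).
    exact: (bmeas_comp (bg k) (@measurable_swap _ _ T R)).
  - exact: bmeas_cst.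
  - by move=> w; exact: (Ex_uniform_shift (c - 1 / 2 + X k w) bphi phi0).
have N0 : Ex (U1 \x P)%E (fun p => \1_N p.2) = 0.
  rewrite Ex_prod//= (@Ex_ext _ _ _ _ _ (fun=> 0)) ?Ex_cst// => s.
  by apply: EFin_inj; rewrite [LHS]Ex_indic ?(ms_N0 HS)//; exact: (ms_measN HS).
have HE : Ex (U1 \x P)%E H <= K%:R * Ex U1 phi + dl / 2.
  rewrite /H ExD; [|exact: bmeas_sum|exact: bmeasD].
  rewrite ExD// N0 addr0 Ex_sum//; apply: lerD; last exact: ltW.
  apply: (@le_trans _ _ (\sum_(k <- iota 0 K) Ex U1 phi)).
    by apply: ler_sum => k _; exact: gle.
  by rewrite big_const_seq count_predT size_iota iter_addr_0 mulr_natl.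
have halfE : Ex U1 (fun s => \1_`[0, 1 / 2] s * E0) = E0 * Ex U1 \1_`[0, 1 / 2].
  by rewrite -ExZ//; apply: Ex_ext => s; rewrite mulrC.
have hh : E0 * (1 / 2) <= E0 * Ex U1 \1_`[0, 1 / 2].
  by rewrite ler_wpM2l//; exact: Ex_uniform_half.
suff : E0 * (1 / 2) <= K%:R * Ex U1 phi + dl / 2.
  rewrite -mulrA; move: (K%:R * Ex U1 phi) => z; move: (E0) => y; lra.
by apply: (le_trans hh); rewrite -halfE; exact: le_trans EH HE.
Qed.

End absolute_continuity.

(** * Mixing *)

Definition swapn (i j k : nat) : nat :=
  if k == i then j else if k == j then i else k.

Lemma swapnK i j : involutive (swapn i j).
Proof.
by move=> k; rewrite /swapn; case: (eqVneq k i) => [->|ki];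
  [case: (eqVneq j i) => // _; rewrite eqxx|
   case: (eqVneq k j) => [->|kj]; rewrite ?eqxx// (negbTE ki) (negbTE kj)].
Qed.

Lemma swapn_fix i j k : (maxn i j < k)%N -> swapn i j k = k.
Proof. by rewrite gtn_max /swapn => /andP[ik jk]; rewrite !gtn_eqF. Qed.

Section uniform_index.
Variable R : realType.
Local Notation U1 := (uniform01 R).

(** The number of the cell of length [K.+1%:R^-1] containing [a]. The search stops at [K], so the
    default value of [find] is the last of the [K.+1] cells. *)
Definition idx (K : nat) (a : R) : nat :=
  find (fun j => a <= j.+1%:R / K.+1%:R) (iota 0 K).

Lemma idx_le K a : (idx K a <= K)%N.
Proof. by rewrite /idx -[leqRHS](size_iota 0) find_size. Qed.

Lemma idx_bounds K a : 0 <= a <= 1 ->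
  (idx K a)%:R / K.+1%:R <= a <= (idx K a).+1%:R / K.+1%:R.
Proof.
move=> /andP[a0 a1]; rewrite /idx; set p := fun j => _.
have K0 : (0 : R) < K.+1%:R by rewrite ltr0n.
apply/andP; split.
  case E : (find p (iota 0 K)) => [|j]; first by rewrite mul0r.
  have jK : (j.+1 <= K)%N by rewrite -E -[leqRHS](size_iota 0) find_size.
  have : (j < find p (iota 0 K))%N by rewrite E.
  move=> /(before_find 0%N); rewrite nth_iota// add0n /p => /negbT.
  by rewrite -ltNge => /ltW.
have [hp|hp] := boolP (has p (iota 0 K)); last first.
  by rewrite (hasNfind hp) size_iota divff// lt0r_neq0.
have := nth_find 0%N hp; rewrite nth_iota; first by rewrite add0n.
by rewrite -[ltnRHS](size_iota 0) -has_find.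
Qed.

Lemma measurable_find (d : measure_display) (S : measurableType d) (s : seq nat)
    (p : S -> nat -> bool) (f : nat -> S -> R) :
  (forall j, measurable_fun setT (fun o => p o j)) ->
  (forall j, measurable_fun setT (f j)) ->
  measurable_fun setT (fun o => f (find (p o) s) o).
Proof.
move=> mp; elim: s f => [|x s IH] f mf /=; first exact: mf.
rewrite (_ : (fun o => _) = fun o => if p o x then f 0%N o else f (find (p o) s).+1 o).
  by apply: measurable_fun_ifT => //; exact: (IH (fun j => f j.+1)).
by apply/funext => o; case: (p o x).
Qed.

Lemma measurable_idx (d : measure_display) (S : measurableType d) K
    (a : S -> R) (f : nat -> S -> R) : measurable_fun setT a ->
  (forall j, measurable_fun setT (f j)) ->
  measurable_fun setT (fun o => f (idx K (a o)) o).
Proof.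
move=> ma mf; apply: (@measurable_find _ _ (iota 0 K) (fun o j => a o <= j.+1%:R / K.+1%:R)) => // j.
exact: measurable_fun_ler.
Qed.

(** Closed cells overlap at their ends, which gives an inequality for nonnegative [phi]; upper
    bounds are all that is propagated. *)
Lemma Ex_idx K (phi : nat -> R) : (forall j, 0 <= phi j) ->
  Ex U1 (fun a => phi (idx K a)) <= K.+1%:R^-1 * \sum_(j < K.+1) phi j.
Proof.
move=> phi0; have K0 : (0 : R) < K.+1%:R by rewrite ltr0n.
pose J (j : nat) : set R := `[j%:R / K.+1%:R, j.+1%:R / K.+1%:R]%classic.
have bJ j : bmeas (fun a : R => phi j * \1_(J j) a).
  by apply: bmeasM; [exact: bmeas_cst|apply: bmeas_indic; exact: measurable_itv].
have pJ0 j a : 0 <= phi j * \1_(J j) a by rewrite mulr_ge0// indicE.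
apply: (@le_trans _ _ (Ex U1 (fun a => \sum_(j < K.+1) phi j * \1_(J j) a))).
  apply: Ex_uniform_le.
  - split; first by apply: (@measurable_idx _ R K id (fun j _ => phi j)).
    exists (\sum_(j < K.+1) phi j) => a; rewrite ger0_norm//.
    rewrite (bigD1 (Ordinal (idx_le K a : (idx K a < K.+1)%N)))//= lerDl.
    by apply: sumr_ge0.
  - exact: bmeas_sum.
  - by move=> a.
  - by move=> a; apply: sumr_ge0.
  move=> a a01; rewrite (bigD1 (Ordinal (idx_le K a : (idx K a < K.+1)%N)))//=.
  rewrite indicE mem_set ?mulr1 ?lerDl ?sumr_ge0//.
  by rewrite /J/= in_itv/=; exact: idx_bounds.
rewrite Ex_sum// mulr_sumr; apply: ler_sum => j _.
rewrite ExZ; last by apply: bmeas_indic; exact: measurable_itv.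
rewrite mulrC ler_wpM2r//.
have jj : (j%:R / K.+1%:R : R) <= j.+1%:R / K.+1%:R.
  by rewrite ler_pM2r ?invr_gt0// ler_nat.
apply: le_trans (Ex_uniform_itv jj) _.
by rewrite -mulrBl -natrB// subSnn mul1r.
Qed.

End uniform_index.

Section mixing.
Variables (R : realType) (lam : probability (seqS R) R).
Hypothesis hlam : iid_law lam.
Local Notation U1 := (uniform01 R).

(** The point [x.2] stands at place [n + j], and the rest of the tail is independent: seen as a
    function of that point, a conditional expectation of the test given one coordinate. *)
Definition subst_mean n (G : seqS R -> R) (j : nat) (x : seqS R * R) : R :=
  Ex lam (fun v => G (hyb n x.1 (hyb 1 (fun=> x.2) v \o swapn 0 j))).

(** What is gained or lost when a foreign point is put at a random one of [K.+1] places, compared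
    with a purely independent tail. *)
Definition mixing_defect n G K (x : seqS R * R) : R :=
  K.+1%:R^-1 * (\sum_(j < K.+1) subst_mean n G j x) - Ex lam (fun v => G (hyb n x.1 v)).

Variable (G : seqS R -> R).
Hypothesis mG : measurable_fun setT G.
Hypothesis G01 : forall x, 0 <= G x <= 1.
Let bG := bmeas_01 mG G01.

Lemma measurable_subst n j : measurable_fun setT (fun p : (seqS R * R) * seqS R =>
  hyb n p.1.1 (hyb 1 (fun=> p.1.2) p.2 \o swapn 0 j)).
Proof.
apply: measurable_hyb; first exact: measurableT_comp.
apply: (measurableT_comp (@measurable_reindex R (swapn 0 j))
  (g := fun p : (seqS R * R) * seqS R => hyb 1 (fun=> p.1.2) p.2)).
apply: measurable_hyb => //; apply: measurable_seqP => _.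
exact: measurableT_comp.
Qed.

Let dlam : probability (seqS R * R)%type R := (lam \x U1)%E.

Lemma bmeas_subst_mean n j : bmeas (subst_mean n G j).
Proof.
apply: (bmeas_Ex (f := fun x v => G (hyb n x.1 (hyb 1 (fun=> x.2) v \o swapn 0 j)))
  dlam lam).
exact: (bmeas_comp bG (measurable_subst n j)).
Qed.

Lemma subst_mean01 n j x : 0 <= subst_mean n G j x <= 1.
Proof.
apply: Ex_01 => //.
exact: (measurableT_comp mG (measurableT_comp (measurable_subst n j) (pair1_measurable x))).
Qed.

Lemma bmeas_mixing_defect n K : bmeas (mixing_defect n G K).
Proof.
apply: bmeasB.
  by apply: bmeasM; [exact: bmeas_cst|apply: bmeas_sum => j; exact: bmeas_subst_mean].
apply: (bmeas_Ex (f := fun (x : seqS R * R) v => G (hyb n x.1 v)) dlam lam).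
by apply: (bmeas_comp bG); apply: measurable_hyb => //; exact: measurableT_comp.
Qed.

Lemma mixing_defect_le1 n K x : `|mixing_defect n G K x| <= 1.
Proof.
have K0 : (0 : R) < K.+1%:R by rewrite ltr0n.
have mGh : measurable_fun setT (fun v => G (hyb n x.1 v)).
  apply: (measurableT_comp mG).
  exact: (measurable_hyb n (measurable_cst x.1) (@measurable_id _ (seqS R) setT)).
have /andP[c0 c1] : 0 <= Ex lam (fun v => G (hyb n x.1 v)) <= 1 by exact: Ex_01.
have s0 : 0 <= K.+1%:R^-1 * (\sum_(j < K.+1) subst_mean n G j x).
  apply: mulr_ge0; first by rewrite invr_ge0 ltW.
  apply: sumr_ge0 => j _.
  by case/andP: (subst_mean01 n j x).
have s1 : K.+1%:R^-1 * (\sum_(j < K.+1) subst_mean n G j x) <= 1.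
  rewrite ler_pdivrMl// mulr1 -[X in _ <= X%:R]card_ord -sumr_const; apply: ler_sum => j _.
  by case/andP: (subst_mean01 n j x).
by rewrite /mixing_defect ler_norml; apply/andP; split;
  move: (K.+1%:R^-1 * _) (Ex lam _) s0 s1 c0 c1 => u v *; lra.
Qed.

Section fixed_history.
Variables (n : nat) (h : seqS R).
Let g (v : seqS R) : R := G (hyb n h v).

Let bg : bmeas g.
Proof.
apply: (bmeas_comp bG).
exact: (measurable_hyb n (measurable_cst h) (@measurable_id _ (seqS R) setT)).
Qed.

(** The defining property of a conditional expectation given coordinate [j]; exchanging the places 0
    and [j] reduces it to resampling everything after the first coordinate. *)
Lemma Ex_subst_mean j (al : R -> R) : bmeas al ->
  Ex U1 (fun z => subst_mean n G j (h, z) * al z) = Ex lam (fun v => g v * al (v j)).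
Proof.
move=> bal.
have bs : bmeas (fun z => subst_mean n G j (h, z)).
  exact: (bmeas_comp (bmeas_subst_mean n j) (pair1_measurable h)).
have balj i : bmeas (fun v : seqS R => al (v i)).
  exact: (bmeas_comp bal (@measurable_coord R i)).
rewrite -(Ex_coord hlam 0 (bmeasM bs bal)).
rewrite -[RHS](Ex_perm hlam (@swapnK 0 j) (K := j.+1)); last 2 first.
  by move=> i ji; rewrite swapn_fix// max0n.
  exact: bmeasM.
have E0 : swapn 0 j j = 0%N by rewrite /swapn eqxx; case: eqP.
have bgs : bmeas (fun x : seqS R => g (x \o swapn 0 j)).
  exact: (bmeas_comp bg (@measurable_reindex R (swapn 0 j))).
rewrite [RHS](Ex_hyb hlam 1); last first.
  by apply: bmeasM => //=; rewrite E0.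
apply: Ex_ext => u; rewrite mulrC /subst_mean -ExZ; last first.
  apply: (bmeas_comp bG).
  exact: (measurableT_comp (measurable_subst n j) (pair1_measurable (h, u 0%N))).
apply: Ex_ext => v; rewrite /= E0 mulrC /g; congr (G _ * _).
congr (hyb n h); apply/funext => i /=; rewrite /hyb.
by case: (ltnP (swapn 0 j i) 1); rewrite // ltnS leqn0 => /eqP ->.
Qed.

(* Bessel's inequality: a conditional expectation of [G] given one coordinate,
   averaged over [K.+1] independent coordinates, has variance at most 1/(K+1). *)
Lemma mixing_square K :
  Ex U1 (fun z => mixing_defect n G K (h, z) * mixing_defect n G K (h, z)) <= K.+1%:R^-1.
Proof.
set al := fun z => mixing_defect n G K (h, z).
have bal : bmeas al by exact: (bmeas_comp (bmeas_mixing_defect n K) (pair1_measurable h)).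
have bs j : bmeas (fun z => subst_mean n G j (h, z)).
  exact: (bmeas_comp (bmeas_subst_mean n j) (pair1_measurable h)).
have balj i : bmeas (fun v : seqS R => al (v i)).
  exact: (bmeas_comp bal (@measurable_coord R i)).
have k0 : 0 < K.+1%:R^-1 :> R by rewrite invr_gt0 ltr0n.
set k : R := K.+1%:R^-1 in k0 *.
have kK : k * K.+1%:R = 1 by rewrite mulVf// pnatr_eq0.
set c := Ex lam g.
have alM (be : R -> R) : bmeas be ->
    Ex U1 (fun z => al z * be z) =
    k * (\sum_(j < K.+1) Ex lam (fun v => g v * be (v j))) - c * Ex U1 be.
  move=> bbe; rewrite (@Ex_ext _ _ _ _ _ (fun z =>
     k * (\sum_(j < K.+1) subst_mean n G j (h, z) * be z) - c * be z)); last first.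
    by move=> z; rewrite /al /mixing_defect/= mulrBl -mulrA mulr_suml.
  have bsb j : bmeas (fun z => subst_mean n G j (h, z) * be z) by exact: bmeasM.
  rewrite ExB; last 2 first.
    by apply: bmeasM; [exact: bmeas_cst|exact: bmeas_sum].
    by apply: bmeasM; [exact: bmeas_cst|].
  rewrite !ExZ//; last exact: bmeas_sum.
  rewrite Ex_sum//; congr (_ * _ - _); apply: eq_bigr => j _.
  exact: Ex_subst_mean.
have al0 : Ex U1 al = 0.
  rewrite (@Ex_ext _ _ _ _ _ (fun z => al z * 1)); last by move=> z; rewrite mulr1.
  rewrite (alM (fun=> 1)); last exact: bmeas_cst.
  rewrite Ex_cst mulr1 (eq_bigr (fun=> c)); last first.
    by move=> j _; apply: Ex_ext => v; rewrite mulr1.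
  by rewrite sumr_const card_ord -[c *+ _]mulr_natl mulrA kK mul1r subrr.
pose A (v : seqS R) := k * \sum_(j < K.+1) al (v j).
have bA : bmeas A by apply: bmeasM; [exact: bmeas_cst|exact: bmeas_sum].
set I := Ex U1 _.
have IE : I = Ex lam (fun v => g v * A v).
  rewrite /I (alM al bal) al0 mulr0 subr0 -Ex_sum; last by move=> j; exact: bmeasM.
  rewrite -ExZ; last by apply: bmeas_sum => j; exact: bmeasM.
  by apply: Ex_ext => v; rewrite /A [RHS]mulrCA [X in _ = k * X]mulr_sumr.
(* Off the diagonal the products vanish in mean, by independence and [al0]; the diagonal contributes
   [K.+1] terms equal to [I], with the factor [k * k]. *)
have A2 : Ex lam (fun v => A v * A v) = k * I.
  rewrite (@Ex_ext _ _ _ _ _ (fun v : seqS R => (k * k) *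
     \sum_(i < K.+1) \sum_(j < K.+1) al (v i) * al (v j))); last first.
    move=> v; rewrite /A mulrACA; congr (_ * _); rewrite mulr_suml.
    by apply: eq_bigr => i _; rewrite mulr_sumr.
  have bij (i j : 'I_K.+1) : bmeas (fun v : seqS R => al (v i) * al (v j)).
    exact: bmeasM.
  rewrite ExZ; last by apply: bmeas_sum => i; exact: bmeas_sum.
  rewrite Ex_sum; last by move=> i; exact: bmeas_sum.
  rewrite (eq_bigr (fun=> I)); last first.
    move=> i _; rewrite Ex_sum// (bigD1 i)//= big1 ?addr0; last first.
      move=> j ji; have [ij|ji'|/val_inj ij] := ltngtP i j; last by rewrite ij eqxx in ji.
        by rewrite (Ex_coord2 hlam ij bal bal) al0 mul0r.
      rewrite (@Ex_ext _ _ _ _ _ (fun v : seqS R => al (v j) * al (v i))); last by move=> v; rewrite mulrC.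
      by rewrite (Ex_coord2 hlam ji' bal bal) al0 mul0r.
    exact: (Ex_coord hlam i (bmeasM bal bal)).
  by rewrite sumr_const card_ord -[I *+ _]mulr_natl mulrA -(mulrA k) kK mulr1.
(* With [y = A v / k], the inequality [g v * y <= 1 / 2 + y * y / 2] bounds [I], the mean of
   [g v * A v], by [k / 2 + I / 2]; hence [I <= k]. *)
have : I <= k / 2 + k * I / (2 * k).
  rewrite {1}IE -A2 -[X in X + _](Ex_cst lam) [X in _ + X]mulrC -ExZ; last exact: bmeasM.
  have bAA : bmeas (fun v => (2 * k)^-1 * (A v * A v)).
    by apply: bmeasM; [exact: bmeas_cst|exact: bmeasM].
  rewrite -ExD//; last exact: bmeas_cst.
  apply: Ex_le; [exact: bmeasM|by apply: bmeasD => //; exact: bmeas_cst|].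
  move=> v; have /andP[g0 g1] : 0 <= g v <= 1 by exact: G01.
  have -> : (2 * k)^-1 * (A v * A v) = A v * (A v / k) / 2 by field; rewrite lt0r_neq0.
  have Ek : A v = k * (A v / k) by rewrite mulrCA divff ?mulr1// lt0r_neq0.
  rewrite {1 2}Ek; move: (A v / k) (g v) g0 g1 => y x x0 x1.
  have h1 : 0 <= (x - y) * (x - y) by rewrite -expr2 sqr_ge0.
  have h2 : 0 <= (1 - x) * (1 + x) by rewrite mulr_ge0; lra.
  have h3 : 0 <= 1 / 2 + y * y / 2 - x * y by move: h1 h2; rewrite !(mulrDl, mulrDr); lra.
  have h4 := mulr_ge0 (ltW k0) h3.
  rewrite -subr_ge0 (_ : _ - _ = k * (1 / 2 + y * y / 2 - x * y))//; by field.
have -> : k * I / (2 * k) = I / 2 by field; rewrite lt0r_neq0.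
by move: (I) => x; lra.
Qed.

End fixed_history.
End mixing.

Section fresh_defect.
Context (d : measure_display) (T : measurableType d) (R : realType).
Variables (P : probability T R) (B : R -> T -> R) (X : nat -> T -> R) (N : set T).
Hypothesis HS : minima_setting P B X N.
Variables (lam : probability (seqS R) R).
Hypothesis hlam : iid_law lam.
Local Notation Om := (T * seqS R)%type.
Local Notation Pr := (P \x lam)%E.
Local Notation U1 := (uniform01 R).
Let mB := ms_measB HS.
Let cB := ms_contB HS.

Lemma box_last_indep (e : R) (Q : box) n : box_ok e Q -> size Q = n.+1 ->
  let q := nth (0, 0) Q n in
  forall f : seqS R * seqS R -> R, bmeas f ->
  Ex P (fun w => f (window B (ratr q.1) (q.2 - q.1) w, box_argmins B (take n Q) w)) =
  Ex P (fun w => Ex P (fun w' =>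
    f (window B (ratr q.1) (q.2 - q.1) w', box_argmins B (take n Q) w))).
Proof.
move=> [hQ dQ] sQ q f bf.
have nQ : (n < size Q)%N by rewrite sQ.
have [] := hQ n nQ; rewrite -/q => q0 q1 q2 _.
have q0R : 0 <= ratr q.1 :> R by rewrite ler0q.
have q2R : ratr q.2 <= 1 :> R by rewrite -(rmorph1 (ratr : rat -> R)) ler_rat.
apply: (@Ex_indep _ _ _ _ _ _ _ P (window B (ratr q.1) (q.2 - q.1))
  (box_argmins B (take n Q))) => //.
- exact: measurable_window.
- exact: (measurable_box_argmins HS).
move=> E F mE mF; apply: (inside_outside_indep mB (ms_indB HS) q0R q2R).
  apply: window_generated => // t /andP[t0]; rewrite rmorphB/= => tl.
  by split; lra.
have mY : measurable_fun setT (box_argmins B (take n Q) :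
    g_sigma_algebraType (incr_rects B (outside (ratr q.1) (ratr q.2))) -> seqS R).
  apply: measurable_seqP => i; rewrite /box_argmins size_take nQ.
  case: (ltnP i n) => lin; last exact: measurable_cst.
  apply: measurable_funD; first exact: measurable_cst.
  apply: (measurableT_comp (@measurable_argm R _ _)).
  apply: window_measurable_generated => t /andP[t0]; rewrite rmorphB/= nth_take// => tl.
  have iQ : (i < size Q)%N by rewrite sQ ltnS ltnW.
  have [] := hQ i iQ.
  rewrite -(ler0q R) -(ler_rat R _ 1) rmorph1 => p0 _ p1 _.
  have := dQ i n iQ nQ (negbT (ltn_eqF lin)); rewrite -/q -!(ler_rat R) => hh.
  by split; [lra|lra|lra|case: hh => hh; [left|right]; lra].
by have := mY measurableT F mF; rewrite setTI.
Qed.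

(** The indicator restricts to paths on which the last box has a genuine minimizer, the only ones
    covered by [box_argmin_abs_cont]. *)
Definition box_defect n (G : seqS R -> R) K (Q : box) (w : T) : R :=
  let q := nth (0, 0) Q n in
  `|mixing_defect lam n G K (box_argmins B (take n Q) w, box_argmin B q w)| *
    \1_(strict_min 0 (q.2 - q.1)) (window B (ratr q.1) (q.2 - q.1) w).

Lemma bmeas_box_defect n (G : seqS R -> R) K Q : measurable_fun setT G ->
  (forall x, 0 <= G x <= 1) -> bmeas (box_defect n G K Q).
Proof.
move=> mG G01; rewrite /box_defect; set q := nth _ _ _; apply: bmeasM.
  apply: bmeas_norm; apply: (bmeas_comp (bmeas_mixing_defect lam mG G01 n K)).
  apply: measurable_fun_pair; first exact: (measurable_box_argmins HS).
  exact: (measurable_box_argmin HS).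
exact: (bmeas_comp (bmeas_indic R (@measurable_strict_min R 0 (q.2 - q.1)))
  (measurable_window mB (ratr q.1) (q.2 - q.1))).
Qed.

(** The last box is independent of the others, so these are frozen and the law of its minimizer is
    dominated by the uniform law, under which [mixing_square] applies. Applying the domination to
    the squared defect with error [t * t] leaves [t] after division by [t]. *)
Lemma Ex_box_defect n (Q : box) (t : R) : box_ok (1 / 2 : R) Q -> size Q = n.+1 -> 0 < t ->
  exists2 C : R, 0 <= C & forall K (G : seqS R -> R), measurable_fun setT G ->
    (forall x, 0 <= G x <= 1) ->
    Ex P (box_defect n G K Q) <= t + t + C * K.+1%:R^-1.
Proof.
move=> okQ sQ t0; have [hQ _] := okQ.
have nQ : (n < size Q)%N by rewrite sQ.
set q := nth (0, 0) Q n.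
have [] := hQ n nQ; rewrite -/q => q0 q1 q2 q3.
have tt0 : 0 < t * t by rewrite mulr_gt0.
have [C C0 hC] := box_argmin_abs_cont HS q0 q1 q2 (ltW q3) tt0.
exists (C / t) => [|K G mG G01]; first by rewrite divr_ge0// ltW.
have bM := bmeas_mixing_defect lam mG G01 n K.
set W := window B (ratr q.1) (q.2 - q.1).
pose S : set (seqS R) := @strict_min R 0 (q.2 - q.1).
have mS : measurable S by exact: measurable_strict_min.
have mW : measurable_fun setT W by exact: measurable_window.
have mQ' := measurable_box_argmins HS (take n Q).
pose f (p : seqS R * seqS R) : R :=
  (mixing_defect lam n G K (p.2, ratr q.1 + argm 0 (q.2 - q.1) p.1) *
   mixing_defect lam n G K (p.2, ratr q.1 + argm 0 (q.2 - q.1) p.1)) * \1_S p.1.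
have bf : bmeas f.
  have bm : bmeas (fun p : seqS R * seqS R =>
     mixing_defect lam n G K (p.2, ratr q.1 + argm 0 (q.2 - q.1) p.1)).
    apply: (bmeas_comp bM); apply: measurable_fun_pair => //.
    apply: measurable_funD => //.
    exact: (measurableT_comp (@measurable_argm R _ _)).
  apply: bmeasM; first exact: bmeasM.
  exact: (bmeas_comp (bmeas_indic R mS)).
have bfW : bmeas (fun w => f (W w, box_argmins B (take n Q) w)).
  by apply: (bmeas_comp bf); exact: measurable_fun_pair.
have Ef : Ex P (fun w => f (W w, box_argmins B (take n Q) w)) <= t * t + C * K.+1%:R^-1.
  rewrite /W (box_last_indep okQ sQ bf) -[leRHS](Ex_cst P); apply: Ex_le.
  - apply: (bmeas_Ex (f := fun w w' => f (W w', box_argmins B (take n Q) w)) P P).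
    by apply: (bmeas_comp bf); apply: measurable_fun_pair => /=; exact: measurableT_comp.
  - exact: bmeas_cst.
  move=> w; set h := box_argmins B (take n Q) w.
  pose phi z := mixing_defect lam n G K (h, z) * mixing_defect lam n G K (h, z).
  have mphi : measurable_fun setT phi.
    have [+ _] := bmeas_comp bM (pair1_measurable h).
    by move=> mm; exact: measurable_funM.
  have phi01 x : 0 <= phi x <= 1.
    rewrite /phi -expr2 sqr_ge0/= -real_normK ?num_real// expr_le1//.
    exact: mixing_defect_le1.
  apply: (le_trans (hC phi mphi phi01)); rewrite lerD2l ler_wpM2l//.
  exact: mixing_square.
apply: (@le_trans _ _ (Ex P (fun w => t + t^-1 * f (W w, box_argmins B (take n Q) w)))).
  apply: Ex_le.
  - exact: bmeas_box_defect.
  - apply: bmeasD; first exact: bmeas_cst.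
    by apply: bmeasM => //; exact: bmeas_cst.
  move=> w; rewrite /box_defect -/q /f/= -/S -/W.
  rewrite indicE; case: (_ \in _); last by rewrite !mulr0 addr0 ltW.
  rewrite !mulr1 [_^-1 * _]mulrC; exact: norm_le_square.
rewrite ExD; [|exact: bmeas_cst|by apply: bmeasM => //; exact: bmeas_cst].
rewrite Ex_cst ExZ// -addrA lerD2l.
apply: (@le_trans _ _ (t^-1 * (t * t + C * K.+1%:R^-1))).
  by rewrite ler_pM2l// invr_gt0.
by rewrite mulrDr mulKf ?lt0r_neq0// lerD2l mulrCA mulrA.
Qed.

(** The cover is applied to the list already extended by the fresh point, which is thus the
    minimizer over the last box whatever the enumeration does. Boxes shorter than [1 / 2] leave room
    for the translations behind absolute continuity. *)
Lemma fresh_defect n m (f : Om -> seqS R) (dl : R) : enum_state X N n m f -> 0 < dl ->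
  exists K, forall G : seqS R -> R, measurable_fun setT G -> (forall x, 0 <= G x <= 1) ->
    Ex Pr (fun o => mixing_defect lam n G K (f o, fresh X n f o)) <= dl.
Proof.
move=> sf dl0.
have sg := enum_state_fresh HS sf.
set g := fun o => _ in sg.
have h0 : 0 < 1 / 2 :> R by rewrite divr_gt0.
have dl20 : 0 < dl / 2 by rewrite divr_gt0.
have [Qs hQs [mE hE]] := finite_cover HS lam (es_meas sg) (es_minima sg) h0 dl20.
set E := [set o : Om | _] in mE hE.
pose r : R := (size Qs)%:R.
have r0 : 0 <= r by rewrite ler0n.
(* Each box costs [t + t + t], so all of them cost at most [dl / 2]; the other half pays for the
   uncaptured event. *)
pose t := dl / (6 * (r + 1)).
have r10 : 0 < r + 1 by rewrite ltr_wpDl.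
have t0 : 0 < t by rewrite divr_gt0// mulr_gt0.
have rt : r * t <= dl / 6.
  have -> : r * t = r / (r + 1) * (dl / 6) by rewrite /t; field; rewrite lt0r_neq0.
  rewrite -[leRHS]mul1r ler_pM2r ?divr_gt0// ler_pdivrMr// mul1r lerDl.
  exact: ler01.
have /choice[C hC] : forall Q, exists C : R, Q \in Qs -> 0 <= C /\
    forall K (G : seqS R -> R), measurable_fun setT G -> (forall x, 0 <= G x <= 1) ->
    Ex P (box_defect n G K Q) <= t + t + C * K.+1%:R^-1.
  move=> Q; have [QQs|] := boolP (Q \in Qs); last by exists 0.
  have [okQ sQ] := hQs Q QQs.
  by have [C C0 hC] := Ex_box_defect okQ sQ t0; exists C.
pose Cm := \sum_(Q <- Qs) C Q.
have CmQ Q : Q \in Qs -> C Q <= Cm.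
  move=> QQs; rewrite /Cm (big_rem Q)//= lerDl big_seq; apply: sumr_ge0 => Q' /mem_rem Q'Qs.
  by have [] := hC Q' Q'Qs.
have Cm0 : 0 <= Cm.
  by rewrite /Cm big_seq; apply: sumr_ge0 => Q' Q'Qs; have [] := hC Q' Q'Qs.
have tC : 0 < t / (Cm + 1) by rewrite divr_gt0// ltr_wpDl.
have [K hK] := exists_ell tC; exists K => G mG G01.
rewrite unit_fraction in hK.
have CK Q : Q \in Qs -> C Q * K.+1%:R^-1 <= t.
  move=> QQs; have [CQ0 _] := hC Q QQs.
  apply: (@le_trans _ _ ((Cm + 1) * (t / (Cm + 1)))); last first.
    by rewrite mulrC divfK// lt0r_neq0// ltr_wpDl.
  apply: ler_pM => //.
  by apply: (le_trans (CmQ Q QQs)); rewrite lerDl ler01.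
have mfr : measurable_fun setT (fresh X n f) by exact: (measurable_fresh HS _ (es_meas sf)).
have bD : bmeas (fun o => mixing_defect lam n G K (f o, fresh X n f o)).
  apply: (bmeas_comp (bmeas_mixing_defect lam mG G01 n K)).
  by apply: measurable_fun_pair => //; exact: (es_meas sf).
have bE : bmeas (\1_E : Om -> R) by exact: bmeas_indic.
pose EN : set Om := [set o | N o.1].
have mEN : measurable EN.
  rewrite (_ : EN = N `*` [set: seqS R]).
    by apply: measurableX => //; exact: (ms_measN HS).
  by apply/seteqP; split=> o // -[].
have bEN : bmeas (\1_EN : Om -> R) by exact: bmeas_indic.
have bQ Q : bmeas (fun o : Om => box_defect n G K Q o.1).
  by apply: (bmeas_comp (bmeas_box_defect n K Q mG G01)).
have q0 Q w : 0 <= box_defect n G K Q w by rewrite /box_defect mulr_ge0// indicE.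
have S0 (o : Om) : 0 <= \sum_(Q <- Qs) box_defect n G K Q o.1 by apply: sumr_ge0.
apply: (@le_trans _ _ (Ex Pr (fun o : Om => \1_E o + \1_EN o +
    \sum_(Q <- Qs) box_defect n G K Q o.1))).
  apply: Ex_le => //.
    by apply: bmeasD; [exact: bmeasD|exact: bmeas_sum].
  move=> [w u]; have D1 := le_trans (ler_norm _)
    (mixing_defect_le1 lam mG G01 n K (f (w, u), fresh X n f (w, u))).
  have [Nw|Nw] := pselect (N w).
    apply: (le_trans D1); rewrite [\1_EN _]indicE mem_set//= addrAC lerDr addr_ge0//.
    exact: (S0 (w, u)).
  have [Eo|/existsNP[Q /not_implyP[QQs /contrapT[sQ cQ]]]] := pselect (E (w, u)).
    by apply: (le_trans D1); rewrite [\1_E _]indicE mem_set//= -addrA lerDl addr_ge0//; exact: (S0 (w, u)).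
  rewrite (big_rem Q)//= addrCA; apply: ler_wpDr.
    apply: addr_ge0; first by apply: addr_ge0; rewrite indicE.
    exact: sumr_ge0.
  rewrite /box_defect; set q := nth (0, 0) Q n.
  have frE : fresh X n f (w, u) = box_argmin B q w.
    by have := cQ n (ltnSn n); rewrite /g /ins ltnn.
  (* Otherwise [argm] would be -1 and the fresh point [ratr q.1 - 1], which is not positive. *)
  have sm : strict_min 0 (q.2 - q.1) (window B (ratr q.1) (q.2 - q.1) w).
    apply: contrapT => nsm.
    have [okQ _] := hQs Q QQs; have [hok _] := okQ.
    have nQ : (n < size Q)%N by rewrite sQ.
    have [_ q1 q2 _] := hok n nQ.
    have [k [fk _ _]] := fresh_spec HS n f u Nw.
    have /andP[X0 _] := ms_X01 HS k w.
    move: X0; rewrite -fk frE /box_argmin /argm asboolF//.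
    have : ratr q.1 <= 1 :> R.
      by rewrite -(rmorph1 (ratr : rat -> R)) ler_rat (le_trans (ltW q1)).
    by move=> *; lra.
  rewrite indicE mem_set// mulr1 frE -/q.
  rewrite (_ : mixing_defect _ _ _ _ (f (w, u), _) =
    mixing_defect lam n G K (box_argmins B (take n Q) w, box_argmin B q w)).
    exact: ler_norm.
  have hE1 v : hyb n (f (w, u)) v = hyb n (box_argmins B (take n Q) w) v.
    apply/funext => i; rewrite /hyb; case: (ltnP i n) => // lin.
    have := cQ i (ltnW lin); rewrite /g /ins lin => ->.
    by rewrite /box_argmins size_take sQ ltnSn lin nth_take.
  rewrite /mixing_defect /subst_mean/=; congr (_ * _ - _).
    by apply: eq_bigr => j _; apply: Ex_ext => v; rewrite hE1.
  by apply: Ex_ext => v; rewrite hE1.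
rewrite ExD; [|exact: bmeasD|exact: bmeas_sum].
rewrite ExD// (prob_null_fiber HS lam mEN)// addr0 Ex_sum//.
have sumle : \sum_(Q <- Qs) Ex Pr (fun o : Om => box_defect n G K Q o.1) <= r * (t + t + t).
  apply: (@le_trans _ _ (\sum_(Q <- Qs) (t + t + t))); last first.
    by rewrite big_const_seq count_predT iter_addr_0 mulr_natl.
  rewrite big_seq [leRHS]big_seq; apply: ler_sum => Q QQs.
  have [_ hCQ] := hC Q QQs.
  rewrite Ex_prod// (@Ex_ext _ _ _ _ _ (box_defect n G K Q)); last first.
    by move=> w /=; rewrite Ex_cst.
  apply: (le_trans (hCQ K G mG G01)); rewrite lerD2l; exact: CK.
apply: (le_trans (lerD (ltW hE) sumle)).
by rewrite !mulrDr; move: (r * t) rt => z; lra.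
Qed.

End fresh_defect.

(** * Appending a block of minimizers *)

Section block_step.
Context (d : measure_display) (T : measurableType d) (R : realType).
Variables (P : probability T R) (B : R -> T -> R) (X : nat -> T -> R) (N : set T).
Hypothesis HS : minima_setting P B X N.
Variables (lam : probability (seqS R) R).
Hypothesis hlam : iid_law lam.
Local Notation Om := (T * seqS R)%type.
Local Notation Pr := (P \x lam)%E.
Local Notation U1 := (uniform01 R).

Lemma append_cands n m f (dl : R) K : enum_state X N n m f -> 0 < dl ->
  exists f', [/\ enum_state X N (n + K) (m + K) f',
    forall o i, (i < n)%N -> f' o i = f o i &
    forall G : seqS R -> R, measurable_fun setT G -> (forall x, 0 <= G x <= 1) ->
      completed P lam (n + K) f' G <= completed P lam n f G + K%:R * dl].
Proof.
move=> sf dl0; elim: K => [|K [f1 [s1 e1 c1]]].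
  by exists f; rewrite !addn0; split=> // G mG G01; rewrite mul0r addr0.
have [f2 [s2 e2 c2]] := append_cand HS hlam s1 dl0.
exists f2; rewrite !addnS; split=> //.
  by move=> o i lin; rewrite e2 ?e1// ltn_addr.
move=> G mG G01; apply: (le_trans (c2 G mG G01)).
rewrite -natr1 mulrDl mul1r addrA lerD2r; exact: (c1 G mG G01).
Qed.

Lemma hyb_swapn n (x v : seqS R) i j : (i < n)%N -> (j < n)%N ->
  hyb n (x \o swapn i j) v = hyb n x v \o swapn i j.
Proof.
move=> lin ljn; apply/funext => k; rewrite /= /hyb.
have [kn|nk] := ltnP k n; last first.
  by rewrite swapn_fix ?ltnNge ?nk// -ltnNge (leq_trans _ nk)// gtn_max lin ljn.
suff -> : (swapn i j k < n)%N by [].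
by rewrite /swapn; case: ifP => // _; case: ifP.
Qed.

Lemma hyb_ins_swapn n (h v : seqS R) z j :
  hyb n.+1 (ins n h z) v \o swapn n (n + j) =
  hyb n h (hyb 1 (fun=> z) v \o swapn 0 j).
Proof.
apply/funext => i; rewrite /= /hyb /ins /swapn.
have [lin|nin] := ltnP i n.
  rewrite (ltn_eqF lin) (ltn_eqF (ltn_addr j lin)).
  by rewrite ltnS (ltnW lin) lin.
rewrite -[i](subnKC nin) addKn; move: (i - n)%N => k.
rewrite (_ : (n + k == n)%N = (k == 0)%N) ?eqn_add2l; last first.
  by rewrite -{2}[n]addn0 eqn_add2l.
have aux l : (if (n + l < n.+1)%N then (if (n + l < n)%N then h (n + l)%N else z)
    else v (n + l - n.+1)%N) = (if (l < 1)%N then z else v (l - 1)%N).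
  case: l => [|l]; first by rewrite addn0 ltnSn ltnn.
  by rewrite addnS ltnS ltnNge leq_addr/= subSS addKn subn1.
rewrite [RHS]/=; case: (k == 0)%N; first exact: aux.
by case: (k == j)%N; [have := aux 0%N; rewrite addn0|exact: aux].
Qed.

(* The first unused minimizer is inserted at a uniform position among [K] nearly
   uniform candidates: this exhausts all minimizers while the law hardly changes. *)
Lemma block_step n m f (dl : R) : enum_state X N n m f -> 0 < dl ->
  exists n' m' f', [/\ (n < n')%N, enum_state X N n' m' f',
    forall o i, (i < n)%N -> f' o i = f o i,
    forall w u, exists2 i, (i < n')%N & f' (w, u) i = fresh X n f (w, u) &
    forall G : seqS R -> R, measurable_fun setT G -> (forall x, 0 <= G x <= 1) ->
      completed P lam n' f' G <= completed P lam n f G + dl].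
Proof.
move=> sf dl0.
have dl20 : 0 < dl / 2 by rewrite divr_gt0.
have [K hK] := fresh_defect HS hlam sf dl20.
have K10 : 0 < K.+1%:R :> R by rewrite ltr0n.
pose dl' := dl / 2 / K.+1%:R.
have dl'0 : 0 < dl' by rewrite divr_gt0.
have [f2 [s2 e2 c2]] := append_cands K (enum_state_fresh HS sf) dl'0.
set n' := (n.+1 + K)%N in s2 c2; set m' := (m + K)%N in s2.
pose s j := swapn n (n + j).
(* Coordinate [m'] of the auxiliary sequence, not consumed so far, decides with which of the places
   [n, ..., n + K] the fresh point at place [n] is exchanged. *)
pose f3 (o : Om) : seqS R := f2 o \o s (idx K (o.2 m')).
have nn' : (n < n')%N by rewrite /n' addSn ltnS leq_addr.
have jn' j : (j <= K)%N -> (n + j < n')%N by rewrite /n' addSn ltnS leq_add2l.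
have sn' j i : (j <= K)%N -> (i < n')%N -> (s j i < n')%N.
  by move=> jK iN; rewrite /s /swapn; case: ifP => _; [exact: jn'|case: ifP].
have sK j : involutive (s j) by exact: swapnK.
have mcm : measurable_fun setT (fun o : Om => o.2 m').
  exact: (measurableT_comp (@measurable_coord R m')).
exists n', m'.+1, f3; split=> //.
- split.
  + apply: measurable_seqP => i.
    apply: (@measurable_idx _ _ _ K (fun o : Om => o.2 m') (fun j o => f2 o (s j i))) => //.
    by move=> j; exact: (measurableT_comp (@measurable_coord R _) (es_meas s2)).
  + move=> w u Nw; have [h1 h2] := es_minima s2 u Nw; rewrite /f3/=.
    have jK := idx_le K (u m'); move: (idx _ _) jK => j jK; split=> [i iN|i i' iN i'N ii'].
      by apply: h1; exact: sn'.
    by apply: h2; rewrite ?sn'// (inj_eq (inv_inj (sK j))).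
  + move=> w u u' uu'; rewrite /f3/= uu'//; congr (_ \o _).
    by apply: (es_dep s2) => i im; apply: uu'; exact: leqW.
- move=> o i lin; rewrite /f3/= /s /swapn (ltn_eqF lin) (ltn_eqF (ltn_addr _ lin)).
  by rewrite e2 ?(leqW lin)// /ins lin.
- move=> w u; exists (n + idx K (u m'))%N; first by apply: jn'; exact: idx_le.
  rewrite /f3 /s/= /swapn eqxx.
  have -> : (if (n + idx K (u m') == n)%N then (n + idx K (u m'))%N else n) = n.
    by case: eqP.
  by rewrite e2// /ins ltnn.
move=> G mG G01; have bG := bmeas_01 mG G01.
(* The random exchange is moved from the list to the test: since [append_cands] holds for all tests,
   it can be applied to the average of [G] over the exchanges. *)
pose G' (x : seqS R) : R := K.+1%:R^-1 * \sum_(j < K.+1) G (x \o s j).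
have mGs j : measurable_fun setT (fun x : seqS R => G (x \o s j)).
  exact: (measurableT_comp mG (@measurable_reindex R (s j))).
have bGs j : bmeas (fun x : seqS R => G (x \o s j)) by exact: bmeas_01.
have bG' : bmeas G' by apply: bmeasM; [exact: bmeas_cst|exact: bmeas_sum].
have G'01 x : 0 <= G' x <= 1.
  rewrite /G' mulr_ge0 ?invr_ge0 ?(ltW K10)//=; last first.
    by apply: sumr_ge0 => j _; case/andP: (G01 (x \o s j)).
  rewrite ler_pdivrMl// mulr1 -[X in _ <= X%:R]card_ord -sumr_const.
  by apply: ler_sum => j _; case/andP: (G01 (x \o s j)).
pose Psi (p : Om * R) : R := Ex lam (fun v => G (hyb n' (f2 p.1) v \o s (idx K p.2))).
have mH (d0 : measure_display) (S : measurableType d0) (o : S -> Om) (v : S -> seqS R) :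
    measurable_fun setT o -> measurable_fun setT v ->
    measurable_fun setT (fun x => hyb n' (f2 (o x)) (v x)).
  move=> mo mv; apply: measurable_hyb => //.
  exact: (measurableT_comp (es_meas s2) mo).
have bPsi3 : bmeas (fun x : (Om * R) * seqS R =>
    G (hyb n' (f2 x.1.1) x.2 \o s (idx K x.1.2))).
  apply: bmeas_01 => //; apply: (measurableT_comp mG); apply: measurable_seqP => i.
  apply: (@measurable_idx _ _ _ K (fun x : (Om * R) * seqS R => x.1.2)
    (fun j x => hyb n' (f2 x.1.1) x.2 (s j i))).
    exact: measurableT_comp.
  move=> j; apply: (measurableT_comp (@measurable_coord R (s j i))
    (g := fun x : (Om * R) * seqS R => hyb n' (f2 x.1.1) x.2)).
  by apply: mH => //; exact: measurableT_comp.
have bPsi : bmeas Psi.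
  exact: (bmeas_Ex (f := fun p v => G (hyb n' (f2 p.1) v \o s (idx K p.2)))
    (Pr \x U1)%E lam).
have -> : completed P lam n' f3 G = Ex Pr (fun o => Psi (o, o.2 m')).
  apply: Ex_ext => o; apply: Ex_ext => v; rewrite /f3 /s/= hyb_swapn//.
  by apply: jn'; exact: idx_le.
rewrite (Ex_fresh_coord P hlam (m := m'))//; last first.
  by move=> w u u' a uu'; rewrite /Psi/= (es_dep s2 w uu').
have b2 : bmeas (fun p : Om * seqS R => G' (hyb n' (f2 p.1) p.2)).
  by apply: (bmeas_comp bG'); apply: mH.
have step1 : Ex Pr (fun o => Ex U1 (fun a => Psi (o, a))) <= completed P lam n' f2 G'.
  apply: Ex_le.
  - apply: (bmeas_Ex (f := fun o a => Psi (o, a)) Pr U1).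
    by rewrite [X in bmeas X](_ : _ = Psi)//; apply/funext => -[].
  - exact: (bmeas_Ex (f := fun o v => G' (hyb n' (f2 o) v)) Pr lam).
  move=> o; apply: (le_trans (Ex_idx K (phi := fun j =>
     Ex lam (fun v => G (hyb n' (f2 o) v \o s j))) _)).
    by move=> j; apply: Ex_ge0 => v; case/andP: (G01 (hyb n' (f2 o) v \o s j)).
  have bj j : bmeas (fun v => G (hyb n' (f2 o) v \o s j)).
    apply: (bmeas_comp (bGs j) (g := fun v => hyb n' (f2 o) v)).
    by apply: (mH _ _ (fun=> o) id).
  by rewrite -Ex_sum// -ExZ//; exact: bmeas_sum.
apply: (le_trans step1); apply: (le_trans (c2 G' (proj1 bG') G'01)).
have KdlE : K%:R * dl' <= dl / 2.
  rewrite /dl' mulrCA -[leRHS]mulr1 ler_pM2l// ler_pdivrMr// mul1r ler_nat.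
  exact: leqnSn.
have bo1 : bmeas (fun o => mixing_defect lam n G K (f o, fresh X n f o)).
  apply: (bmeas_comp (bmeas_mixing_defect lam mG G01 n K)).
  apply: measurable_fun_pair; first exact: (es_meas sf).
  exact: (measurable_fresh HS _ (es_meas sf)).
have bo2 : bmeas (fun o : Om => Ex lam (fun v => G (hyb n (f o) v))).
  apply: (bmeas_Ex (f := fun o v => G (hyb n (f o) v)) Pr lam).
  apply: (bmeas_comp bG); apply: measurable_hyb => //.
  exact: (measurableT_comp (es_meas sf)).
(* Once the candidates are replaced by an independent tail, exchanging [n] and [n + j] puts the
   fresh point at place [j] of the tail: [G'] yields exactly the mixing defect plus the value
   without the fresh point. *)
have -> : completed P lam n.+1 (fun o => ins n (f o) (fresh X n f o)) G' =
    Ex Pr (fun o => mixing_defect lam n G K (f o, fresh X n f o)) +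
    completed P lam n f G.
  rewrite -ExD//; apply: Ex_ext => o.
  rewrite /mixing_defect subrK /G' /subst_mean.
  have bj j : bmeas (fun v => G (hyb n.+1 (ins n (f o) (fresh X n f o)) v \o s j)).
    apply: (bmeas_comp (bGs j) (g := fun v => hyb n.+1 (ins n (f o) (fresh X n f o)) v)).
    exact: (measurable_hyb n.+1 (measurable_cst _) (@measurable_id _ (seqS R) setT)).
  rewrite ExZ; last exact: bmeas_sum.
  rewrite Ex_sum//; congr (_ * _); apply: eq_bigr => j _; apply: Ex_ext => v.
  by rewrite /s hyb_ins_swapn.
have := hK G mG G01.
by move: (Ex Pr _) (completed P lam n f G) KdlE => x y *; lra.
Qed.

End block_step.

(** * Reordered enumerations *)

Section approximate_enumeration.
Context (d : measure_display) (T : measurableType d) (R : realType).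
Variables (P : probability T R) (B : R -> T -> R) (X : nat -> T -> R) (N : set T).
Hypothesis HS : minima_setting P B X N.
Variables (lam : probability (seqS R) R).
Hypothesis hlam : iid_law lam.
Local Notation Om := (T * seqS R)%type.
Local Notation Pr := (P \x lam)%E.

Lemma reordered_enumeration (e : R) : 0 < e -> exists Y : Om -> seqS R,
  [/\ measurable_fun setT Y,
      forall w u, ~ N w ->
        exists2 s : nat -> nat, bijective s & Y (w, u) = (X^~ w) \o s &
      forall n C, measurable (C : set (seqS R)) -> determined n C ->
        Ex Pr (fun o => \1_C (Y o)) <= Ex lam \1_C + e].
Proof.
move=> e0.
pose st := {s : nat * nat * (Om -> seqS R) | enum_state X N s.1.1 s.1.2 s.2}.
have sf0 : enum_state X N 0 0 (fun _ : Om => (fun=> 0) : seqS R).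
  by split=> // w u _; split.
pose nn (s : st) := (sval s).1.1.
pose ff (s : st) := (sval s).2.
have /choice[next hnext] : forall p : nat * st, exists s' : st,
    [/\ (nn p.2 < nn s')%N,
      forall o i, (i < nn p.2)%N -> ff s' o i = ff p.2 o i,
      forall w u, exists2 i, (i < nn s')%N &
        ff s' (w, u) i = fresh X (nn p.2) (ff p.2) (w, u) &
      forall G : seqS R -> R, measurable_fun setT G -> (forall x, 0 <= G x <= 1) ->
        completed P lam (nn s') (ff s') G <=
        completed P lam (nn p.2) (ff p.2) G + e / 2 ^+ p.1.+1].
  move=> [k [[[n m] f] /= sf]].
  have ek : 0 < e / 2 ^+ k.+1 by rewrite divr_gt0// exprn_gt0.
  have [n' [m' [f' [h1 h2 h3 h4 h5]]]] := block_step HS hlam sf ek.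
  by exists (exist _ (n', m', f') h2); split.
pose fix state k : st :=
  if k is k'.+1 then next (k', state k') else exist _ (0%N, 0%N, _) sf0.
pose n_ k := nn (state k); pose f_ k := ff (state k).
have sf k : enum_state X N (n_ k) (sval (state k)).1.2 (f_ k) by exact: (svalP (state k)).
have nS k : (n_ k < n_ k.+1)%N by have [] := hnext (k, state k).
have n_mono : {homo n_ : j k / (j <= k)%N}.
  by apply: homo_leq => [|????|k]; [exact: leqnn|exact: leq_trans|exact: ltnW].
have n_ge k : (k <= n_ k)%N.
  by elim: k => // k IH; exact: leq_ltn_trans IH (nS k).
have fS k o i : (i < n_ k)%N -> f_ k.+1 o i = f_ k o i.
  by have [_ + _ _] := hnext (k, state k); apply.
have f_mono j k o i : (j <= k)%N -> (i < n_ j)%N -> f_ k o i = f_ j o i.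
  move=> /subnKC <-; elim: (k - j)%N => [|l IH] ij; first by rewrite addn0.
  rewrite addnS fS ?IH//; apply: leq_trans ij _; apply: n_mono; exact: leq_addr.
(* Stage [i.+1] has more than [i] points, so the [i]-th one is settled by then. *)
pose Y (o : Om) : seqS R := fun i => f_ i.+1 o i.
have YE k o i : (i < n_ k)%N -> Y o i = f_ k o i.
  move=> ik; rewrite /Y; have [ki|ki] := leqP k i.+1; first exact: f_mono.
  by rewrite (f_mono i.+1 k o i (ltnW ki))// n_ge.
exists Y; split.
- apply: measurable_seqP => i.
  exact: (measurableT_comp (@measurable_coord R i) (es_meas (sf i.+1))).
- move=> w u Nw.
  have /choice[s hs] i : exists k, Y (w, u) i = X k w.
    by have [h _] := es_minima (sf i.+1) u Nw; apply: h; exact: n_ge.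
  have Yinj : injective (Y (w, u)).
    move=> i j; apply: contra_eq => ij; set k := (maxn i j).+1.
    have ik : (i < n_ k)%N by apply: leq_trans (n_ge k); rewrite ltnS leq_maxl.
    have jk : (j < n_ k)%N by apply: leq_trans (n_ge k); rewrite ltnS leq_maxr.
    rewrite (YE k (w, u) i ik) (YE k (w, u) j jk).
    by have [_ h] := es_minima (sf k) u Nw; apply: h.
  (* If [X l] is listed by stage [j] for all [l < j], the fresh point of that stage is [X j], unless
     [X j] is already listed. *)
  have Ysurj j : exists2 i, (i < n_ j.+1)%N & Y (w, u) i = X j w.
    elim/ltn_ind: j => j IH.
    have IHj l : (l < j)%N -> exists2 i, (i < n_ j)%N & f_ j (w, u) i = X l w.
      move=> lj; have [i il Yl] := IH l lj.
      have ij : (i < n_ j)%N by apply: leq_trans il _; exact: n_mono.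
      by exists i => //; rewrite -YE.
    have [_ _ /(_ w u)[i iS hi] _] := hnext (j, state j).
    have [k [fk knew kmin]] := fresh_spec HS (n_ j) (f_ j) u Nw.
    have [jk|kj|jk] := ltngtP j k.
    + have [i' i'j hi'] := kmin j jk; exists i'; first exact: leq_trans i'j (ltnW (nS j)).
      by rewrite (YE j (w, u) i' i'j) hi'.
    + by have [i' i'j hi'] := IHj k kj; have := knew i' i'j; rewrite hi' eqxx.
    + exists i => //; rewrite (YE j.+1 (w, u) i iS).
      by apply: (etrans hi (etrans fk _)); rewrite jk.
  have sinj : injective s by move=> i j sij; apply: Yinj; rewrite !hs sij.
  have /choice[t ht] j : exists i, s i = j.
    have [i _ Yi] := Ysurj j; exists i; apply: (ms_inj HS Nw).
    by rewrite -hs.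
  exists s; last by apply/funext => i; rewrite hs.
  by exists t => // i; apply: sinj; rewrite ht.
move=> n C mC dC.
have mG : measurable_fun setT (\1_C : seqS R -> R) by exact: measurable_indic.
have G01 (x : seqS R) : 0 <= (\1_C x : R) <= 1.
  by rewrite indicE; case: (_ \in _); rewrite ?lexx ?ler01.
have clos k : completed P lam (n_ k) (f_ k) \1_C <=
    Ex lam (\1_C : seqS R -> R) + (e - e / 2 ^+ k).
  elim: k => [|k IH].
    rewrite expr0 divr1 subrr addr0 -[leRHS](Ex_cst Pr) le_eqVlt.
    apply/orP; left; apply/eqP; apply: Ex_ext => o; apply: Ex_ext => v.
    by congr (\1_C _); apply/funext => i; rewrite /hyb subn0.
  have [_ _ _ /(_ _ mG G01) h] := hnext (k, state k).
  apply: (le_trans h).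
  have ek : e / 2 ^+ k = e / 2 ^+ k.+1 + e / 2 ^+ k.+1.
    by rewrite exprS; field; rewrite expf_neq0.
  rewrite ek in IH; apply: (le_trans (lerD IH (lexx _))).
  by rewrite -addrA lerD2l opprD addrA subrK.
(* Stage [n] has at least [n] points, so an event on the first [n] coordinates does not see the
   independent tail. *)
have -> : Ex Pr (fun o => \1_C (Y o)) = completed P lam (n_ n) (f_ n) \1_C.
  apply: Ex_ext => o; rewrite -[LHS](Ex_cst lam); apply: Ex_ext => v.
  have hE i : (i < n)%N -> Y o i = hyb (n_ n) (f_ n o) v i.
    by move=> lin; have lin' := leq_trans lin (n_ge n); rewrite /hyb lin' -YE.
  rewrite !indicE; congr ((nat_of_bool _)%:R); apply/idP/idP; rewrite !inE; apply: dC => //.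
  by move=> i /hE.
apply: (le_trans (clos n)); rewrite lerD2l gerBl divr_ge0 ?exprn_ge0// ltW//.
Qed.

Lemma Ex_invariant_le (A : set (nat -> R)) : measurable (A : set (seqS R)) ->
  permutation_invariant A -> Ex P (fun w => \1_A (X^~ w)) <= Ex lam \1_A.
Proof.
move=> mA pA; apply/ler_addgt0Pr => e e0.
have e30 : 0 < e / 3 by rewrite divr_gt0.
have [Y [mY sY cY]] := reordered_enumeration e30.
have bA : bmeas (\1_A : seqS R -> R) by exact: bmeas_indic.
pose Y' : {mfun Om >-> seqS R} := mfun_Sub (mem_set mY : Y \in mfun).
(* Three errors of [e / 3]: replacing [A] by [C] under the law of [Y], replacing [C] by [A] under
   [lam], and the distance between the two laws on [C]. *)
have [n [C [mC dC hY hlamC]]] := cylinder_approx (distribution Pr Y') lam mA e30.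
have bC : bmeas (\1_C : seqS R -> R) by exact: bmeas_indic.
have bs := bmeas_sdiff mA mC.
rewrite (Ex_distribution Pr Y' bs) in hY.
have mX : measurable_fun setT (fun w => (X^~ w : seqS R)).
  by apply: measurable_seqP => i; exact: (ms_measX HS).
have bAX : bmeas (fun o : Om => \1_A (X^~ o.1 : seqS R) : R).
  by apply: (bmeas_comp bA); exact: (measurableT_comp mX).
have bAY : bmeas (fun o => \1_A (Y o) : R) by exact: (bmeas_comp bA).
have bCY : bmeas (fun o => \1_C (Y o) : R) by exact: (bmeas_comp bC).
have bsY : bmeas (fun o => sdiff A C (Y o)) by exact: (bmeas_comp bs).
have AXY : Ex P (fun w => \1_A (X^~ w)) = Ex Pr (fun o => \1_A (Y o)).
  rewrite -(@Ex_null _ _ _ Pr (fun o => \1_A (X^~ o.1)) _ (N `*` setT))//.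
  - rewrite Ex_prod//; apply: Ex_ext => w /=.
    by rewrite -[LHS](Ex_cst lam).
  - by apply: measurableX => //; exact: (ms_measN HS).
  - have h0 : Pr (N `*` [set: seqS R]) = (P N * lam setT)%E.
      by apply: product_measure1E => //; exact: (ms_measN HS).
    by rewrite [LHS]h0 (ms_N0 HS) mul0e.
  move=> [w u] Nw; have {}Nw : ~ N w by move=> h; apply: Nw.
  have [s [t st ts] ->] := sY w u Nw.
  rewrite !indicE; congr ((nat_of_bool _)%:R); apply/idP/idP; rewrite !inE/= => h.
    by apply: pA => //; exists t.
  have bt : bijective t by exists s.
  have := pA t _ bt h; congr A.
  by apply/funext => i /=; rewrite ts.
rewrite AXY.
have h1 : Ex Pr (fun o => \1_A (Y o)) <=
    Ex Pr (fun o => \1_C (Y o)) + Ex Pr (fun o => sdiff A C (Y o)).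
  rewrite -ExD//; apply: Ex_le => //; first exact: bmeasD.
  by move=> o; rewrite -lerBlDl /sdiff ler_norm.
have h2 : Ex lam (\1_C : seqS R -> R) <= Ex lam \1_A + Ex lam (sdiff A C).
  rewrite -ExD//; apply: Ex_le => //; first exact: bmeasD.
  by move=> o; rewrite -lerBlDl /sdiff distrC ler_norm.
have h3 := cY n C mC dC.
apply: (le_trans h1); move: hY hlamC h2 h3.
by move: (Ex _ _) (Ex _ _) (Ex _ _) (Ex _ _) (Ex _ _) => *; lra.
Qed.

(** The complement of an invariant set is invariant, so the upper bound applied to both sets gives
    equality. *)
Lemma prob_invariant (A : set (nat -> R)) : measurable (A : set (seqS R)) ->
  permutation_invariant A -> P [set w | A (X^~ w)] = lam A.
Proof.
move=> mA pA.
have mX : measurable_fun setT (fun w => (X^~ w : seqS R)).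
  by apply: measurable_seqP => i; exact: (ms_measX HS).
have mAX : measurable [set w | A (X^~ w)].
  by have := mX measurableT A mA; rewrite setTI.
have pAC : permutation_invariant (~` A).
  move=> s x [t st ts] nA h; apply: nA.
  have bt : bijective t by exists s.
  have := pA t _ bt h; congr A.
  by apply/funext => i /=; rewrite ts.
have bA : bmeas (\1_A : seqS R -> R) by exact: bmeas_indic.
have bAX : bmeas (fun w => \1_A (X^~ w : seqS R) : R) by exact: (bmeas_comp bA).
have CE (x : nat -> R) : \1_(~` A) x = 1 - \1_A x :> R.
  rewrite !indicE in_setC; case: (_ \in _); by rewrite /= ?subr0 ?subrr.
have h1 := Ex_invariant_le mA pA.
have h2 := Ex_invariant_le (measurableC mA : measurable (~` A : set (seqS R))) pAC.
have b1 (d0 : measure_display) (S : measurableType d0) : bmeas (fun _ : S => 1 : R).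
  exact: bmeas_cst.
have EP : Ex P (fun w => \1_(~` A) (X^~ w)) = 1 - Ex P (fun w => \1_A (X^~ w)).
  by rewrite -[X in X - _](Ex_cst P) -ExB//; apply: Ex_ext => w; exact: CE.
have El : Ex lam \1_(~` A) = 1 - Ex lam \1_A.
  by rewrite -[X in X - _](Ex_cst lam) -ExB//; apply: Ex_ext => x; exact: CE.
rewrite EP El lerD2l lerN2 in h2.
rewrite -(Ex_indic lam mA) -(Ex_indic P mAX); congr EFin.
by apply/eqP; rewrite eq_le h2 andbT; exact: h1.
Qed.

End approximate_enumeration.

Theorem corollary5p1 (R : realType)
    (d : measure_display) (T : measurableType d) (P : probability T R)
    (d' : measure_display) (T' : measurableType d') (P' : probability T' R)
    (U : nat -> {RV P' >-> R}) (B : R -> {RV P >-> R})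
    (X : nat -> {RV P >-> R}) (A : set (nat -> R)) :
  iid_uniform01 P' U ->
  brownian_motion01 P B ->
  measurable_enumeration P
    (fun w => local_minimizers01 (fun t => B t w)) X ->
  borel_seq01 A ->
  permutation_invariant A ->
  P [set w | A (fun k => X k w)] = P' [set w | A (fun k => U k w)] /\
  (P' [set w | A (fun k => U k w)] = 0%E \/
   P' [set w | A (fun k => U k w)] = 1%E).
Proof.
move=> iidU BM [X01 enumX] /measurable_borel_seq01 mA pA.
have [lam [hlam lamE]] := iid_law_distribution iidU.
have [B' [mB' cB' indB' statB' minB']] := brownian_regular_version BM.
have [N [mN N0 hN]] : {ae P, forall w,
    local_minimizers01 (B'^~ w) = range (fun k => X k w) /\
    injective (fun k => X k w)}.
  by apply: filterS2 enumX minB' => w [h1 h2] h3; split=> //; rewrite -h1 h3.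
have HS : minima_setting P B' (fun k => X k : T -> R) N.
  split=> //.
  - by move=> w Nw; have [] : local_minimizers01 (B'^~ w) = range (fun k => X k w) /\
      injective (fun k => X k w) by apply: contrapT => h; apply: Nw; exact: hN.
  - by move=> w Nw; have [] : local_minimizers01 (B'^~ w) = range (fun k => X k w) /\
      injective (fun k => X k w) by apply: contrapT => h; apply: Nw; exact: hN.
rewrite (lamE A mA); split; last exact: (hewitt_savage hlam mA pA).
exact: (prob_invariant HS hlam mA pA).
Qed.
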